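(* Let $\mu>-\frac12$ and $\lambda>0$, and for integers $n\ge0$ let $$J_n^{(\lambda;\mu)}=\int_{-1}^1\bigl(C_n^{(\lambda)}(x)\bigr)^2(1-x^2)^{\mu-\frac12}\,dx .$$ Then, as $n\to\infty$, $$J_n^{(\lambda;\mu)}=\begin{cases}\dfrac{\sqrt\pi\,\Gamma(\mu+\frac12-\lambda)}{2^{2\lambda-1}\Gamma(\lambda)^2\,\Gamma(\mu+1-\lambda)}\,n^{2\lambda-2}+\mathcal{O}(n^\eta) & \text{if }\mu>\lambda-\frac12,\\[3mm] \dfrac{1}{2^{2\lambda-2}\Gamma(\lambda)^2}\,n^{2\lambda-2}\bigl(\log n+2\log2-\psi(\lambda)\bigr)+\mathcal{O}\bigl(n^{2\lambda-3}\log n\bigr) & \text{if }\mu=\lambda-\frac12,\\[3mm] \dfrac{\sqrt\pi\,\Gamma(\lambda-\mu-\frac12)\,\Gamma(\mu+\frac12)}{2^{2\lambda-1}\Gamma(\lambda)^2\,\Gamma(\lambda-\mu)\,\Gamma(2\lambda-\mu-\frac12)}\,n^{4\lambda-2\mu-3}+\mathcal{O}(n^\eta) & \text{if }\mu<\lambda-\frac12,\end{cases}$$ where $$\eta=\begin{cases}\max(2\lambda-3,\,4\lambda-2\mu-3) & \text{if }\mu>\lambda-\frac12,\\ \max(2\lambda-2,\,4\lambda-2\mu-4) & \text{if }\mu<\lambda-\frac12.\end{cases}$$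
   Context: $C_n^{(\lambda)}$ denotes the Gegenbauer polynomial in the standard normalisation $\sum_{n=0}^\infty C_n^{(\lambda)}(x)z^n=(1-2xz+z^2)^{-\lambda}$. $\psi=\Gamma'/\Gamma$ is the digamma function. The parameters $\lambda,\mu$ are fixed and implied constants may depend on them. *)

(* Defs.v *)
From HB Require Import structures.
From mathcomp Require Export all_boot all_order all_algebra.
From mathcomp Require Export all_classical all_reals all_analysis.
From mathcomp Require Import ring lra.

Export Order.TTheory GRing.Theory Num.Theory.
Export numFieldNormedType.Exports.

Set Implicit Arguments.
Unset Strict Implicit.
Unset Printing Implicit Defensive.

Local Open Scope classical_set_scope.
Local Open Scope ring_scope.

(* The identity of power series in [z] is read as a convergent expansion in a
   neighbourhood of [z = 0] that may depend on [x]; there the base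
   [1 - 2xz + z^2] is positive, so that [`^] is the genuine real power. *)
Definition gegenbauer_family (R : realType) (lambda : R)
    (C : nat -> {poly R}) : Prop :=
  forall x : R, \forall z \near (0 : R),
    pseries (fun n => (C n).[x]) z @ \oo -->
      (1 - 2 * x * z + z ^+ 2) `^ (- lambda).

(* Meaningful for [0 < x], where the Lebesgue integral is finite. *)
Definition Gamma (R : realType) (x : R) : R :=
  \int[lebesgue_measure]_(t in `]0, +oo[%classic) (t `^ (x - 1) * expR (- t)).

Definition digamma (R : realType) (x : R) : R :=
  derive1 (@Gamma R) x / Gamma x.

(* For [C] the Gegenbauer family of parameter [lambda], this is the integral
   [J_n] of parameters [lambda] and [mu]; it is finite for [mu > - 1 / 2], the
   values of the weight at the endpoints being immaterial. *)
Definition weighted_sq_integral (R : realType) (C : nat -> {poly R}) (mu : R)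
    (n : nat) : R :=
  \int[lebesgue_measure]_(x in `[-1, 1]%classic)
    ((C n).[x] ^+ 2 * (1 - x ^+ 2) `^ (mu - 1 / 2)).

Section GegenbauerExistence.
Variable R : realType.
Implicit Types (u : nat -> R) (x z l : R).

Definition shift_seq u n := if n is m.+1 then u m else 0.

Lemma cvg_shift_pseries u z a :
  pseries u z @ \oo --> a -> pseries (shift_seq u) z @ \oo --> z * a.
Proof.
move=> ua; rewrite -cvg_shiftS.
rewrite (_ : (fun n => _) = (fun n => z * pseries u z n)); first exact: cvgMl_tmp.
apply/funext => n; rewrite /pseries /series /= big_nat_recl// mul0r add0r.
by rewrite mulr_sumr; apply: eq_bigr => i _; rewrite /= exprS mulrCA.
Qed.

Lemma cvg_lin_pseries u v z a b k :
  pseries u z @ \oo --> a -> pseries v z @ \oo --> b ->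
  pseries (fun n => u n + k * v n) z @ \oo --> a + k * b.
Proof.
move=> ua vb.
rewrite (_ : pseries _ z = (fun n => pseries u z n + k * pseries v z n)).
  by apply: cvgD => //; exact: cvgMl_tmp.
apply/funext => n; rewrite /pseries /series /= mulr_sumr -big_split/=.
by apply: eq_bigr => i _; rewrite mulrDl mulrA.
Qed.

Lemma is_cvg_pseries_geo u (D M z : R) : 0 <= D -> 0 <= M ->
  (forall n, `|u n| <= D * M ^+ n) -> M * `|z| < 1 -> cvgn (pseries u z).
Proof.
move=> D0 M0 uD Mz; apply: normed_cvg.
apply: (@series_le_cvg _ _ (geometric D (M * `|z|))) => [n|n|n|] /=.
- by [].
- by rewrite mulr_ge0// exprn_ge0// mulr_ge0.
- by rewrite normrM normrX exprMn mulrA ler_wpM2r// exprn_ge0.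
- by apply: is_cvg_geometric_series; rewrite ger0_norm// mulr_ge0.
Qed.

Lemma diffs_geo u (D M : R) : 0 <= D -> 0 <= M ->
  (forall n, `|u n| <= D * M ^+ n) ->
  forall n, `|pseries_diffs u n| <= (D * (2 * M)) * (2 * M) ^+ n.
Proof.
move=> D0 M0 uD n; rewrite /pseries_diffs normrM ger0_norm//.
rewrite -mulrA -exprS exprMn mulrCA ler_pM//.
by rewrite -natrX ler_nat ltnW// ltn_expl.
Qed.

Lemma cst_ball (f : R -> R) (r z : R) :
  (forall t, `|t| < r -> is_derive t (1 : R) f 0) -> `|z| < r -> f z = f 0.
Proof.
move=> df zr.
have r0 : 0 < r by apply: le_lt_trans zr.
have H a b : `|a| < r -> `|b| < r -> a <= b -> f b = f a.
  move=> ar br ab; apply/eqP; rewrite -subr_eq0; apply/eqP.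
  have inr t : t \in `[a, b] -> `|t| < r.
    rewrite in_itv/= => /andP[at_ tb]; move: ar br; rewrite !ltr_norml.
    move=> /andP[ra _] /andP[_ rb].
    by rewrite (lt_le_trans ra at_)/= (le_lt_trans tb rb).
  have [||c _ ->] := @MVT_segment R f (fun=> 0) a b ab; last by rewrite mul0r.
    by move=> t tab; apply: df; apply: inr; exact: subset_itv_oo_cc.
  apply: derivable_within_continuous => t tab.
  by have [] := df _ (inr _ tab).
have [z0|z0] := leP 0 z; first by apply: H; rewrite ?normr0.
by apply/esym; apply: H; rewrite ?normr0// ltW.
Qed.

Fixpoint gegenbauer_pair l n : {poly R} * {poly R} :=
  if n is m.+1 then
    let: (p, q) := gegenbauer_pair l m in
    (q, (m.+2%:R)^-1 *: ((2 * (m.+1%:R + l)) *: ('X * q)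
                         - (m%:R + 2 * l) *: p))
  else (1, (2 * l) *: 'X).

Definition gegenbauer_poly l n : {poly R} := (gegenbauer_pair l n).1.

Local Notation C := gegenbauer_poly.

Lemma gegenbauer_poly0 l : C l 0 = 1. Proof. by []. Qed.
Lemma gegenbauer_poly1 l : C l 1 = (2 * l) *: 'X. Proof. by []. Qed.
Lemma gegenbauer_polyS l n : C l n.+2 = (n.+2%:R)^-1 *:
  ((2 * (n.+1%:R + l)) *: ('X * C l n.+1) - (n%:R + 2 * l) *: C l n).
Proof. by rewrite /gegenbauer_poly /=; case: (gegenbauer_pair l n). Qed.

Lemma gegenbauer_poly_rec l x n : n.+2%:R * (C l n.+2).[x] =
  2 * (n.+1%:R + l) * x * (C l n.+1).[x] - (n%:R + 2 * l) * (C l n).[x].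
Proof.
rewrite gegenbauer_polyS hornerZ mulrA divff ?mul1r ?pnatr_eq0//.
by rewrite hornerD hornerN !hornerZ hornerM hornerX; ring.
Qed.

Lemma gegenbauer_poly_bound l x : 0 < l -> exists2 M, 1 <= M & forall n, `|(C l n).[x]| <= M ^+ n.
Proof.
move=> l0; pose A := 2 * (1 + l) * `|x|; pose B := 1 + l.
have A0 : 0 <= A by rewrite mulr_ge0// mulr_ge0//; lra.
exists (A + B) => [|n]; first by rewrite /B; lra.
have M1 : 1 <= A + B by rewrite /B; lra.
suff: `|(C l n).[x]| <= (A + B) ^+ n /\ `|(C l n.+1).[x]| <= (A + B) ^+ n.+1.
  by case.
elim: n => [|n [IH0 IH1]]; split=> //.
- by rewrite gegenbauer_poly0 hornerE normr1.
- rewrite gegenbauer_poly1 hornerZ hornerX normrM (@ger0_norm _ (2 * l)); last by lra.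
  rewrite expr1.
  have : 2 * l * `|x| <= A by rewrite /A ler_wpM2r//; lra.
  by rewrite /B; lra.
have n2 : 0 < n.+2%:R :> R by rewrite ltr0n.
rewrite -(ler_pM2l n2) -{1}(@ger0_norm _ n.+2%:R)// -normrM gegenbauer_poly_rec.
have n0 : 0 <= n%:R :> R by [].
have nE1 : n.+1%:R = n%:R + 1 :> R by rewrite -natr1.
have nE2 : n.+2%:R = n%:R + 2 :> R by rewrite -!natr1; ring.
apply: (le_trans (ler_normB _ _)).
have h1 : `|2 * (n.+1%:R + l) * x * (C l n.+1).[x]|
    <= n.+2%:R * A * (A + B) ^+ n.+1.
  rewrite normrM ler_pM// normrM ger0_norm; last by rewrite nE1; lra.
  by rewrite /A mulrA ler_wpM2r// nE1 nE2; nra.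
have h2 : `|(n%:R + 2 * l) * (C l n).[x]| <= n.+2%:R * B * (A + B) ^+ n.+1.
  rewrite normrM ler_pM//.
    by rewrite ger0_norm /B ?nE2; nra.
  by rewrite (le_trans IH0)// exprS ler_peMl// exprn_ge0// (le_trans _ M1).
apply: (le_trans (lerD h1 h2)).
by rewrite -mulrDl -mulrDr -mulrA -exprS.
Qed.

(* The three-term recurrence produces a family as above, so that
   [gegenbauer_family lambda] is inhabited for every [lambda > 0]. *)
Lemma gegenbauer_poly_family l : 0 < l -> gegenbauer_family l (C l).
Proof.
move=> l0 x.
have [M M1 cM] := gegenbauer_poly_bound x l0.
pose c n := (C l n).[x].
have M0 : 0 <= M by lra.
have c1 n : `|c n| <= 1 * M ^+ n by rewrite mul1r; exact: cM.
pose K := (8 * M)^-1.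
have K0 : 0 < K by rewrite invr_gt0; lra.
have MK : M * K = 8^-1 by rewrite /K invfM mulrCA divff ?mulr1//; lra.
have Kn : `|K| = K by rewrite gtr0_norm.
have D1 := diffs_geo ler01 M0 c1.
have M20 : 0 <= 2 * M by lra.
have D20 : 0 <= 1 * (2 * M) by lra.
have D2 := diffs_geo D20 M20 D1.
have ck : cvgn (pseries c K).
  by apply: (is_cvg_pseries_geo ler01 M0 c1); rewrite Kn; lra.
have dk : cvgn (pseries (pseries_diffs c) K).
  by apply: (is_cvg_pseries_geo D20 M20 D1); rewrite Kn; lra.
have ddk : cvgn (pseries (pseries_diffs (pseries_diffs c)) K).
  apply: (is_cvg_pseries_geo _ _ D2); rewrite ?Kn; [nra|lra|lra].
pose F z := limn (pseries c z).
pose G z := limn (pseries (pseries_diffs c) z).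
have dF z : `|z| < K -> is_derive z (1 : R) F (G z).
  by move=> zK; apply: (pseries_snd_diffs ck dk ddk); rewrite Kn.
have cF z : `|z| < K -> pseries c z @ \oo --> F z.
  by move=> zK; apply: (is_cvg_pseries_inside ck); rewrite Kn.
have cG z : `|z| < K -> pseries (pseries_diffs c) z @ \oo --> G z.
  by move=> zK; apply: (is_cvg_pseries_inside dk); rewrite Kn.
pose P z := 1 - 2 * x * z + z ^+ 2.
have ode z : `|z| < K -> P z * G z = 2 * l * (x - z) * F z.
  move=> zK.
  have L1 := @cvg_lin_pseries _ _ _ _ _ (- (2 * x)) (cG _ zK) (cvg_shift_pseries (cG _ zK)).
  have L2 := @cvg_lin_pseries _ _ _ _ _ 1 L1
    (cvg_shift_pseries (cvg_shift_pseries (cG _ zK))).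
  have Z0 : pseries (fun=> 0) z @ \oo --> (0 : R).
    rewrite (_ : pseries _ z = cst 0); first exact: cvg_cst.
    by apply/funext => n; rewrite /pseries /series /= big1// => i _; rewrite mul0r.
  have R1 := @cvg_lin_pseries _ _ _ _ _ (2 * l * x) Z0 (cF _ zK).
  have R2 := @cvg_lin_pseries _ _ _ _ _ (- (2 * l)) R1 (cvg_shift_pseries (cF _ zK)).
  have E : (fun n => pseries_diffs c n + - (2 * x) * shift_seq (pseries_diffs c) n +
       1 * shift_seq (shift_seq (pseries_diffs c)) n) =
      (fun n => 0 + 2 * l * x * c n + - (2 * l) * shift_seq c n).
    apply/funext => -[|[|n]] /=; rewrite /pseries_diffs /c.
    - by rewrite gegenbauer_poly1 gegenbauer_poly0 hornerZ hornerX hornerC; ring.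
    - by rewrite gegenbauer_poly_rec gegenbauer_poly1 gegenbauer_poly0 hornerZ hornerX hornerC; ring.
    - by rewrite gegenbauer_poly_rec -[n.+2%:R]natr1 -[n.+1%:R]natr1; ring.
  rewrite E in L2.
  have := cvg_unique _ L2 R2 => /(_ (@Rhausdorff R)) eqLR.
  rewrite /P; transitivity (G z + - (2 * x) * (z * G z) + 1 * (z * (z * G z))).
    by ring.
  by rewrite eqLR; ring.
have Pnear : \forall z \near (0 : R), 0 < P z.
  have Pc : P z @[z --> (0 : R)] --> P 0.
    apply: cvgD; last exact: exprn_continuous.
    by apply: cvgB; [exact: cvg_cst|exact: mulrl_continuous].
  apply: (cvgr_gt _ Pc); rewrite /P; lra.
have /nbhs_ballP[e /= e0 Pe] := Pnear.
pose r := Num.min e K.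
have rE t : `|t| < r -> `|t| < K /\ 0 < P t.
  rewrite lt_min => /andP[te tK]; split => //.
  by apply: Pe; rewrite /ball/= sub0r normrN.
have r0 : 0 < r by rewrite lt_min e0 K0.
apply/nbhs_ballP; exists r => //= z; rewrite /ball/= sub0r normrN => zr.
have [zK Pz] := rE _ zr.
suff <- : F z = P z `^ (- l) by exact: cF.
have dPl t : `|t| < r -> is_derive t (1 : R) (fun t => F t * P t `^ l) 0.
  move=> tr; have [tK Pt] := rE _ tr.
  have dP : is_derive t (1 : R) P (2 * t - 2 * x).
    pose p : {poly R} := 1 - (2 * x) *: 'X + 'X ^+ 2.
    have -> : P = horner p by apply/funext => y; rewrite /P /p !hornerE.
    have := is_derive_poly p t => /is_derive_eq; apply.
    by rewrite /p !poly.derivE !hornerE /=; ring.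
  have dpow := is_derive1_powR l Pt.
  have dcomp := is_derive1_comp dpow dP.
  have dFt := dF _ tK.
  have := @is_deriveM _ _ F ((@powR R)^~ l \o P) t 1 _ _ dFt dcomp.
  move=> /is_derive_eq; apply; rewrite /GRing.scale/=.
  have Pl : P t `^ l = P t * P t `^ (l - 1).
    by rewrite -{2}(powRr1 (ltW Pt)) -powRD ?[1 + _]addrC ?subrK// gt_eqF ?implybT.
  have := ode _ tK; move: Pl => ->; set w := P t `^ (l - 1).
  move=> o; transitivity (w * (P t * G t - 2 * l * (x - t) * F t)); first by ring.
  by rewrite o subrr mulr0.
have := cst_ball dPl zr.
have -> : F 0 = 1.
  apply: cvg_lim => //; rewrite -cvg_shiftS.
  rewrite (_ : (fun n => _) = cst 1); first exact: cvg_cst.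
  apply/funext => n; rewrite /pseries /series /= big_nat_recl//= big1 ?addr0.
    by rewrite /c gegenbauer_poly0 expr0 mulr1 hornerC.
  by move=> i _; rewrite exprS mul0r mulr0.
have -> : P 0 = 1 by rewrite /P; ring.
rewrite powR1 mulr1 => FP; rewrite powRN -[LHS](mulfK (x := P z `^ l)).
  by rewrite FP mul1r.
by rewrite gt_eqF// powR_gt0.
Qed.

End GegenbauerExistence.

(* Main.v *)
Require Import Defs.
From mathcomp Require Import measurable_realfun ring lra.

Set Implicit Arguments.
Unset Strict Implicit.
Unset Printing Implicit Defensive.

Local Open Scope classical_set_scope.
Local Open Scope ring_scope.

(** The idea is to write the integral as the coefficient of [z^n] in a product
    of two hypergeometric series whose singularities at [z = 1] are opposite
    powers of [1 - z], and to read the three regimes off these singularities.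

    Clausen's formula makes [C_n^2] an explicit polynomial in [1 - x^2]
    ([gegenbauer_sq]).  Integrating it term by term gives a terminating
    balanced 4F3 at 1, whose terms alternate in sign and are far larger than
    their sum.  Sears's transformation ([sears_conv], [clausen_conv]) removes
    the cancellation: with [a = lambda - mu] and
    [u_k(a) = (lambda)_k (a)_k / ((lambda + 1/2)_k k!)],
    [J_n = P_n * sum_k u_k(a) * u_(n-k)(1 - a)],
    where [P_n] is the mass of the weight times Pochhammer symbols
    ([weighted_sq_integralE]).

    Suppose [a < 1/2].  The second factor is, up to a relative error [O(1/k)],
    a multiple of the coefficients of [(1 - z)^(a - 1/2)].  The convolution of
    the first factor with exactly these coefficients is a single hypergeometric
    term, by Euler's transformation, that is, the Pfaff-Saalschutz sum
    ([saalschutz]); its size is a ratio of Gamma values.  The remainder is a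
    convolution of a sequence of size [k^(a - 3/2)] with one of size
    [k^(- a - 3/2)]; as the former is summable, its [n]-th term has the larger
    of the two sizes at [n] ([conv_bound]).  A direct estimate of the
    convolution would only give an error of relative size [n^(a - 1/2)],
    because the contribution of the middle range vanishes by a cancellation
    that Euler's transformation makes exact.  The case [a > 1/2] is the same
    after exchanging the factors, [a] becoming [1 - a]
    ([weighted_sq_integral_asym]).

    If [a = 1/2], both factors are the same sequence [u], with [u_k] close to
    [B / k].  Put [b_k = 1 / k] and [w = u - B b], of size [k^-2].  Then
    [u * u = 2 B (u * b) - B^2 (b * b) + w * w], where [b * b] is a harmonic
    sum and [u * b] is known exactly, from the derivative of the
    Pfaff-Saalschutz sum in its third parameter ([saalschutz_log]); the
    harmonic sums at [lambda] that appear there produce [digamma lambda].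

    About Gamma, the functional equation and the inequality
    [Gamma (x + s) <= x^s * Gamma x] for [0 <= s <= 1] suffice.  They give
    Pochhammer ratios with rate [1/n] ([poch_ratio_rate]) and digamma as a
    limit of harmonic sums ([harmonic_sum_digamma]).  The duplication formula
    and the mass of the weight follow from them too: in both cases the ratio
    of the two sides has period 1 in the parameter, and far away along the
    integers it no longer depends on the parameter ([duplication_ratio_eq],
    [weight_ratio_eq]). *)

(** * Pochhammer symbols, convolutions and hypergeometric identities *)

Definition poch (K : numFieldType) (x : K) n : K := \prod_(i < n) (x + i%:R).

Definition conv (K : numFieldType) (u v : nat -> K) n : K :=
  \sum_(i < n.+1) u i * v (n - i)%N.

(** The coefficients of Gauss's series 2F1(a, b; c; z). *)
Definition hyper (K : numFieldType) (a b c : K) k : K :=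
  poch a k * poch b k / (poch c k * k`!%:R).

Section Pochhammer.
Variable K : numFieldType.
Implicit Types (x a b c s : K) (u v w : nat -> K).

Lemma poch0 x : poch x 0 = 1.
Proof. by rewrite /poch big_ord0. Qed.

Lemma pochS x n : poch x n.+1 = poch x n * (x + n%:R).
Proof. by rewrite /poch big_ord_recr. Qed.

Lemma pochSl x n : poch x n.+1 = x * poch (x + 1) n.
Proof.
rewrite /poch big_ord_recl /= addr0; congr (_ * _).
by apply: eq_bigr => i _; rewrite /bump /= add1n -natr1 [_ + 1]addrC addrA.
Qed.

Lemma poch1 n : poch (1 : K) n = n`!%:R.
Proof.
elim: n => [|n IH]; first by rewrite poch0.
by rewrite pochS IH factS mulnC natrM -natr1 [n%:R + 1]addrC.
Qed.

Lemma poch_neq0 x n : (forall i, (i < n)%N -> x + i%:R != 0) -> poch x n != 0.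
Proof. by move=> h; apply/prodf_neq0 => i _; exact: h. Qed.

Lemma poch_gt0 x n : 0 < x -> 0 < poch x n.
Proof. by move=> x0; apply: prodr_gt0 => i _; rewrite ltr_wpDr. Qed.

Lemma fact_neq0 n : n`!%:R != 0 :> K.
Proof. by rewrite pnatr_eq0 -lt0n fact_gt0. Qed.

(** Reversing the product that defines [poch x n] turns a symbol of index
    [n - k] into one of index [k] whose argument depends on [n]. *)
Lemma poch_reflect x n k : (k <= n)%N ->
  poch (1 - x - n%:R) k * poch x (n - k) = (-1) ^+ k * poch x n.
Proof.
elim: k => [|k IH] kn; first by rewrite poch0 subn0.
transitivity (- (poch (1 - x - n%:R) k * poch x (n - k))); last first.
  rewrite IH; last exact: ltnW.
  by rewrite exprS mulN1r mulNr.
rewrite -(subnSK kn) !pochS natrB// -[k.+1%:R]natr1.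
by move: (poch _ _) (poch _ _) => p q; ring.
Qed.

Lemma hyper0 a b c : hyper a b c 0 = 1.
Proof. by rewrite /hyper !poch0 fact0 !mulr1 divr1. Qed.

Lemma hyperS a b c k : c + k%:R != 0 -> poch c k != 0 ->
  hyper a b c k.+1 * ((c + k%:R) * k.+1%:R) =
  hyper a b c k * ((a + k%:R) * (b + k%:R)).
Proof.
move=> ck pk; rewrite /hyper !pochS factS natrM.
have h1 := fact_neq0 k; have h2 : k%:R + 1 != 0 :> K by rewrite natr1 pnatr_eq0.
rewrite -[k.+1%:R]natr1; field.
by rewrite ck pk h1 h2.
Qed.

Lemma eq_conv u u' v v' n :
  (forall i, (i <= n)%N -> u i = u' i) -> (forall i, (i <= n)%N -> v i = v' i) ->
  conv u v n = conv u' v' n.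
Proof.
move=> uu vv; apply: eq_bigr => i _.
by rewrite (uu i (ltn_ord i)) (vv _ (leq_subr _ _)).
Qed.

Lemma convE u v n N : (n < N)%N ->
  conv u v n = ((\poly_(i < N) u i) * (\poly_(i < N) v i))`_n.
Proof.
move=> nN; rewrite coefM; apply: eq_bigr => i _.
have h1 : (i < N)%N by apply: leq_ltn_trans nN; rewrite -ltnS; exact: ltn_ord.
have h2 : (n - i < N)%N by apply: leq_ltn_trans nN; exact: leq_subr.
by rewrite !coef_poly h1 h2.
Qed.

Lemma convC u v n : conv u v n = conv v u n.
Proof. by rewrite !(convE _ _ (ltnSn n)) mulrC. Qed.

Lemma convA u v w n : conv u (conv v w) n = conv (conv u v) w n.
Proof.
pose P t := \poly_(i < n.+1) t i : {poly K}.
have Pc t j : (j <= n)%N -> (P t)`_j = t j by move=> jn; rewrite coef_poly ltnS jn.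
have Pcc t t' j : (j <= n)%N -> (P t * P t')`_j = conv t t' j.
  by move=> jn; rewrite (@convE t t' j n.+1).
transitivity ((P u * (P v * P w))`_n); last rewrite mulrA.
  rewrite coefM; apply: eq_bigr => i _.
  by rewrite Pcc ?leq_subr // Pc // -ltnS.
rewrite coefM; apply: eq_bigr => i _.
by rewrite Pcc ?Pc ?leq_subr // -ltnS.
Qed.

Lemma conv_delta u n : conv u (fun k => (k == 0%N)%:R) n = u n.
Proof.
rewrite /conv (bigD1 ord_max)//= subnn eqxx mulr1 big1 ?addr0// => i /eqP i_n.
rewrite subn_eq0 leqNgt (_ : (i < n)%N) ?mulr0//.
by rewrite ltn_neqAle -ltnS ltn_ord andbT; apply/eqP => h; apply/i_n/val_inj.
Qed.

(** Euler's transformation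
    [2F1(a, b; c; z) = (1 - z)^(c - a - b) 2F1(c - a, c - b; c; z)] read on
    coefficients, in other words the Pfaff-Saalschutz sum.  Zeilberger's
    algorithm finds a first-order recurrence in [m] that both sides satisfy. *)
Lemma saalschutz a b c m : (forall i, (i < m)%N -> c + i%:R != 0) ->
  conv (hyper a b c) (fun k => poch (c - a - b) k / k`!%:R) m =
  hyper (c - a) (c - b) c m.
Proof.
set s := c - a - b.
elim: m => [|m IH] cm; first by rewrite /conv big_ord1 !hyper0 poch0 fact0; field.
have {}IH := IH (fun i im => cm i (ltnW im)).
pose t n k := hyper a b c k * (poch s (n - k) / (n - k)`!%:R).
have pm k : (k <= m.+1)%N -> poch c k != 0.
  by move=> km; apply: poch_neq0 => i ik; apply: cm; exact: leq_trans ik km.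
(* The summands telescope: the right-hand side is the certificate at [j + 1],
   and the certificate vanishes at 0. *)
have tele j : (j <= m)%N ->
  \sum_(k < j.+1) (m.+1%:R * (c + m%:R) * t m.+1 k -
     (c - a + m%:R) * (c - b + m%:R) * t m k) =
  - (hyper a b c j * ((a + j%:R) * (b + j%:R)) * (poch s (m - j) / (m - j)`!%:R)).
  elim: j => [|j IHj] jm.
    rewrite big_ord1 /t !subn0 pochS factS natrM hyper0 -natr1 /s.
    have h1 := fact_neq0 m; have h2 : m%:R + 1 != 0 :> K by rewrite natr1 pnatr_eq0.
    by field; rewrite h1 h2.
  rewrite big_ord_recr IHj /=; last exact: ltnW.
  rewrite /t.
  rewrite -(subnSK jm) subSS -(subnSK jm) !pochS !factS !natrM.
  set d := (m - j.+1)%N.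
  have dm : m%:R = d%:R + j%:R + 1 :> K by rewrite /d -addrA natr1 -natrD subnK.
  have cj : c + j%:R != 0 by apply: cm; exact: leqW.
  rewrite -(hyperS a b); [|exact: cj|by apply: pm; exact: leqW (ltnW jm)].
  rewrite -!natr1 dm /s.
  have h1 := fact_neq0 d; have h2 : d%:R + 1 != 0 :> K by rewrite natr1 pnatr_eq0.
  by field; rewrite h1 h2.
have key : m.+1%:R * (c + m%:R) * conv (hyper a b c) (fun k => poch s k / k`!%:R) m.+1 =
    (c - a + m%:R) * (c - b + m%:R) * hyper (c - a) (c - b) c m.
  rewrite -IH /conv big_ord_recr /= mulrDr !mulr_sumr.
  have := tele m (leqnn m); rewrite /t sumrB => /eqP; rewrite subr_eq => /eqP ->.
  rewrite !subnn poch0 fact0 -(hyperS a b); [|exact: cm|exact: pm].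
  rewrite divr1 !mulr1; move: (\sum_(i < m.+1) _) (hyper a b c m.+1) => X Y; ring.
have n1 : m.+1%:R * (c + m%:R) != 0 by rewrite mulf_neq0 ?pnatr_eq0 ?cm.
apply: (mulfI n1); rewrite key [RHS]mulrC [m.+1%:R * _]mulrC.
by rewrite hyperS; [rewrite mulrC|exact: cm|exact: pm].
Qed.

(** Coefficientwise [(1 - z)^(- s) * (1 - z)^s = 1]. *)
Lemma vandermonde_opp s m :
  conv (fun k => poch s k / k`!%:R) (fun k => poch (- s) k / k`!%:R) m =
  (m == 0%N)%:R.
Proof.
have := @saalschutz s 1 1 m.
have e : 1 - s - 1 = - s by ring.
rewrite e => h; rewrite (@eq_conv _ (hyper s 1 1) _ (fun k => poch (- s) k / k`!%:R))//.
  rewrite h => [|i _]; last by rewrite addrC natr1 pnatr_eq0.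
  rewrite /hyper subrr; case: m {h} => [|m]; first by rewrite !poch0 fact0 !mulr1 divr1.
  by rewrite [poch 0 _]pochSl mul0r mulr0 mul0r.
move=> i _; rewrite /hyper poch1; have := fact_neq0 i => h1.
by field; rewrite h1.
Qed.

(** Euler's transformation multiplies the two series by opposite powers of
    [1 - z], so their product does not change.  As the parameters may depend
    on [n], this contains Sears's transformation of terminating balanced 4F3
    series. *)
Lemma sears_conv a b c a' b' c' n :
  c - a - b = - (c' - a' - b') ->
  (forall i, (i < n)%N -> c + i%:R != 0) -> (forall i, (i < n)%N -> c' + i%:R != 0) ->
  conv (hyper (c - a) (c - b) c) (hyper (c' - a') (c' - b') c') n =
  conv (hyper a b c) (hyper a' b' c') n.
Proof.
move=> ss cn cn'.
set s := c' - a' - b' in ss.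
rewrite (@eq_conv _ (conv (hyper a b c) (fun k => poch (- s) k / k`!%:R))
                  _ (conv (fun k => poch s k / k`!%:R) (hyper a' b' c'))).
- rewrite -convA (@eq_conv _ (hyper a b c) _ (hyper a' b' c'))// => i _.
  rewrite convA (@eq_conv _ (fun k => (k == 0%N)%:R) _ (hyper a' b' c'))//.
    by rewrite convC conv_delta.
  by move=> j _; rewrite convC vandermonde_opp.
- by move=> i i_n; rewrite -ss saalschutz// => j ji; apply: cn; exact: leq_trans ji i_n.
- by move=> i i_n; rewrite convC saalschutz// => j ji; apply: cn'; exact: leq_trans ji i_n.
Qed.

(** The derivative of [saalschutz] in [c] at [c = a + b], where the second
    factor degenerates: [poch s k / k!] has derivative [1 / k] at [s = 0].
    The certificate is the limit of the one used there. *)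
Lemma saalschutz_log a b n :
  (forall i : nat, a + i%:R != 0) -> (forall i : nat, b + i%:R != 0) ->
  (forall i : nat, a + b + i%:R != 0) ->
  \sum_(k < n) hyper a b (a + b) k / (n - k)%:R =
  hyper a b (a + b) n * \sum_(k < n) ((a + k%:R)^-1 + (b + k%:R)^-1).
Proof.
set c := a + b => an bn cn.
have pm k : poch c k != 0 by apply: poch_neq0 => i _; exact: cn.
elim: n => [|n IH]; first by rewrite !big_ord0 mulr0.
(* Only the terms [k < n] telescope; the term [k = n] occurs in the sum of index
   [n + 1] alone and is added afterwards. *)
have tele j : (j < n)%N ->
  \sum_(k < j.+1) (n.+1%:R * (c + n%:R) * (hyper a b c k / (n.+1 - k)%:R) -
     (a + n%:R) * (b + n%:R) * (hyper a b c k / (n - k)%:R)) =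
  - (hyper a b c j * ((a + j%:R) * (b + j%:R)) / (n - j)%:R).
  elim: j => [|j IHj] jn.
    rewrite big_ord1 !subn0 hyper0 -natr1 /c.
    have h1 : n%:R != 0 :> K by rewrite pnatr_eq0 -lt0n.
    have h2 : n%:R + 1 != 0 :> K by rewrite natr1 pnatr_eq0.
    by field; rewrite h1 h2.
  rewrite big_ord_recr IHj /=; last exact: ltnW.
  rewrite subSS.
  rewrite -(subnSK (ltnW jn)).
  set d := (n - j.+1)%N.
  have dm : n%:R = d%:R + j%:R + 1 :> K by rewrite /d -addrA natr1 -natrD subnK// ltnW.
  rewrite -(hyperS a b); [|exact: cn|exact: pm].
  have h1 : d%:R != 0 :> K by rewrite pnatr_eq0 -lt0n subn_gt0.
  rewrite -!natr1 dm /c.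
  have h2 : d%:R + 1 != 0 :> K by rewrite natr1 pnatr_eq0.
  by field; rewrite h1 h2.
have key : n.+1%:R * (c + n%:R) * \sum_(k < n.+1) hyper a b c k / (n.+1 - k)%:R =
   (a + n%:R) * (b + n%:R) * (\sum_(k < n) hyper a b c k / (n - k)%:R) +
   hyper a b c n * (c + n%:R + n%:R).
  case: n IH tele => [|n] IH tele.
    by rewrite !big_ord0 big_ord1 hyper0 subn0; field.
  rewrite big_ord_recr /= mulrDr !mulr_sumr.
  have := tele n (ltnSn n); rewrite sumrB => /eqP; rewrite subr_eq => /eqP ->.
  rewrite -(hyperS a b); [|exact: cn|exact: pm].
  rewrite !subSnn -[n.+2%:R]natr1 -[n.+1%:R]natr1 /c.
  by move: (\sum_(i < n.+1) _) (hyper a b (a + b) n.+1) => X Y; field.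
have n1 : n.+1%:R * (c + n%:R) != 0 by rewrite mulf_neq0 ?pnatr_eq0 ?cn.
apply: (mulfI n1); rewrite key mulrA [_ * hyper _ _ _ n.+1]mulrC.
rewrite [n.+1%:R * _]mulrC hyperS; [|exact: cn|exact: pm].
rewrite big_ord_recr /= IH /c.
by field; rewrite an bn.
Qed.

End Pochhammer.

(** * Clausen's formula for the square of a Gegenbauer polynomial *)

(** The terms of 3F2(- nu, nu + 2 l, l; l + 1/2, 2 l).  Keeping the degree [nu]
    a field element makes the recurrences below rational identities in [nu];
    only integral [nu] makes the series terminate. *)
Definition clausen_coef (K : realFieldType) (l nu : K) k : K :=
  poch (- nu) k * poch (nu + 2 * l) k * poch l k /
  (poch (l + 1 / 2) k * poch (2 * l) k * k`!%:R).

(** The expansion of [x * C_(nu) * C_(nu - 1)], up to normalisation, in powers of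
    [1 - x^2].  These products appear when the three-term recurrence is squared,
    and together with the squares they form a closed system. *)
Definition cross_coef (K : realFieldType) (l nu : K) k : K :=
  if k is j.+1 then
    (poch (- nu) k * poch (nu - 1 + 2 * l) k * poch l k / (poch (2 * l) k * k`!%:R)
     - poch (1 - nu) j * poch (nu + 2 * l) j * poch l j / (2 * (poch (2 * l) j * j`!%:R)))
    / poch (l + 1 / 2) k
  else 1.

(** The coefficients of [(1 - 'X) * p]; in the variable [s = 1 - x^2] this is the
    multiplication of [p] by [x^2]. *)
Definition mul1subX_coef (K : realFieldType) (f : nat -> K) k : K :=
  f k - (if k is j.+1 then f j else 0).

Ltac neq0_conj := repeat (apply/andP; split); try done; lra.

Section Clausen.
Variables (K : realFieldType) (l : K).
Hypothesis l0 : 0 < l.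

Let pn0 k : poch l k != 0. Proof. by rewrite gt_eqF// poch_gt0. Qed.
Let p2n0 k : poch (2 * l) k != 0. Proof. by rewrite gt_eqF// poch_gt0 ?mulr_gt0. Qed.
Let phn0 k : poch (l + 1 / 2) k != 0.
Proof. by rewrite gt_eqF// poch_gt0 ?addr_gt0 ?divr_gt0. Qed.
Let s2 k : 2 * l + k%:R != 0. Proof. by rewrite gt_eqF// ltr_wpDr ?mulr_gt0. Qed.
Let sh k : l + 1 / 2 + k%:R != 0.
Proof. by rewrite gt_eqF// ltr_wpDr ?addr_gt0 ?divr_gt0. Qed.

Lemma cross_coef_rec nu k :
  (2 * l + nu) * cross_coef l (nu + 1) k =
  2 * (nu + l) * mul1subX_coef (clausen_coef l nu) k - nu * cross_coef l nu k.
Proof.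
have l0' := l0.
case: k => [|[|k]]; rewrite /mul1subX_coef /cross_coef /clausen_coef; lazy beta iota.
- by rewrite !poch0 fact0; field.
- rewrite !pochS !poch0 !factS fact0; field.
  neq0_conj.
- rewrite (_ : - (nu + 1) = - nu - 1); last by ring.
   rewrite (_ : 1 + (- nu - 1) = - nu); last by ring.
  rewrite (_ : nu + 1 + 2 * l = nu + 2 * l + 1); last by ring.
  rewrite (_ : nu + 1 - 1 + 2 * l = nu + 2 * l); last by ring.
  rewrite [poch (- nu - 1) _]pochSl subrK ![poch (- nu) _]pochSl.
  rewrite ![poch (nu + 2 * l) _]pochSl ![poch (nu - 1 + 2 * l) _]pochSl.
  rewrite (_ : nu - 1 + 2 * l + 1 = nu + 2 * l); last by ring.
  rewrite ![poch (nu + 2 * l) _]pochSl (_ : - nu + 1 = 1 - nu); last by ring.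
  rewrite !pochS !factS !natrM -[k.+2%:R]natr1 -[k.+1%:R]natr1.
  have := fact_neq0 K k; move: (pn0 k) (p2n0 k) (phn0 k) => e1 e2 e3 e4.
  have k0 : 0 <= k%:R :> K by [].
  field.
  neq0_conj.
Qed.

Lemma clausen_coef_rec nu k :
  (2 * l + nu) ^+ 2 * clausen_coef l (nu + 1) k =
  4 * (nu + l) ^+ 2 * mul1subX_coef (clausen_coef l nu) k
  - 4 * (nu + l) * nu * cross_coef l nu k + nu ^+ 2 * clausen_coef l (nu - 1) k.
Proof.
have l0' := l0.
case: k => [|[|k]]; rewrite /mul1subX_coef /cross_coef /clausen_coef; lazy beta iota.
- by rewrite !poch0 fact0; field.
- rewrite !pochS !poch0 !factS fact0; field.
  neq0_conj.
- rewrite (_ : - (nu + 1) = - nu - 1); last by ring.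
  rewrite (_ : - (nu - 1) = 1 - nu); last by ring.
  rewrite (_ : nu + 1 + 2 * l = nu + 2 * l + 1); last by ring.
  rewrite [poch (- nu - 1) _]pochSl subrK ![poch (- nu) _]pochSl.
  rewrite ![poch (nu + 2 * l) _]pochSl ![poch (nu - 1 + 2 * l) _]pochSl.
  rewrite (_ : nu - 1 + 2 * l + 1 = nu + 2 * l); last by ring.
  rewrite ![poch (nu + 2 * l) _]pochSl (_ : - nu + 1 = 1 - nu); last by ring.
  rewrite !pochS !factS !natrM -[k.+2%:R]natr1 -[k.+1%:R]natr1.
  have := fact_neq0 K k; move: (pn0 k) (p2n0 k) (phn0 k) => e1 e2 e3 e4.
  have k0 : 0 <= k%:R :> K by [].
  field.
  neq0_conj.
Qed.

Lemma clausen_coef_eq0 n k : (n < k)%N -> clausen_coef l n%:R k = 0.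
Proof.
move=> nk; rewrite /clausen_coef (_ : poch (- n%:R) k = 0) ?mul0r//.
by apply/eqP/prodf_eq0; exists (Ordinal nk) => //=; rewrite addNr.
Qed.

Lemma cross_coef_eq0 n k : (n.+1 < k)%N -> cross_coef l n.+1%:R k = 0.
Proof.
case: k => // k nk; rewrite /cross_coef.
rewrite (_ : poch (- n.+1%:R) k.+1 = 0); last first.
  by apply/eqP/prodf_eq0; exists (Ordinal nk) => //=; rewrite addNr.
rewrite (_ : poch (1 - n.+1%:R) k = 0); first by rewrite !mul0r subrr mul0r.
apply/eqP/prodf_eq0; have nk' : (n < k)%N by [].
by exists (Ordinal nk') => //=; rewrite -natr1; apply/eqP; ring.
Qed.

End Clausen.

Section Square.
Variables (R : realType) (l : R).
Hypothesis l0 : 0 < l.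

Let A n : R := poch (2 * l) n / n`!%:R.
Let AS n : A n.+1 = A n * ((2 * l + n%:R) / n.+1%:R).
Proof.
rewrite /A pochS factS natrM; have := fact_neq0 R n => h.
have n0 : 0 <= n%:R :> R by [].
by rewrite -[n.+1%:R]natr1; field; neq0_conj.
Qed.

Let square_poly n : {poly R} := \poly_(k < n.+1) (A n ^+ 2 * clausen_coef l n%:R k).
Let cross_poly n : {poly R} := \poly_(k < n.+2) (A n.+1 * A n * cross_coef l n.+1%:R k).

Let square_polyE n k : (square_poly n)`_k = A n ^+ 2 * clausen_coef l n%:R k.
Proof.
rewrite coef_poly; case: ltnP => // nk.
by rewrite clausen_coef_eq0// mulr0.
Qed.

Let cross_polyE n k : (cross_poly n)`_k = A n.+1 * A n * cross_coef l n.+1%:R k.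
Proof.
rewrite coef_poly; case: ltnP => // nk.
by rewrite cross_coef_eq0// mulr0.
Qed.

Let mul1subX_coefE (p : {poly R}) k : ((1 - 'X) * p)`_k = mul1subX_coef (fun i => p`_i) k.
Proof. by rewrite mulrBl mul1r coefB coefXM; case: k. Qed.

Let mul1subX_coefZ a f k : mul1subX_coef (fun i => a * f i) k = a * mul1subX_coef f k :> R.
Proof. by rewrite /mul1subX_coef; case: k => [|k]; ring. Qed.

Let cross_poly_rec n : n.+2%:R *: cross_poly n.+1 =
  (2 * (n.+1%:R + l)) *: ((1 - 'X) * square_poly n.+1) - (n%:R + 2 * l) *: cross_poly n.
Proof.
apply/polyP => k; rewrite coefB !coefZ mul1subX_coefE !cross_polyE.
rewrite (_ : (fun i => _) = (fun i => A n.+1 ^+ 2 * clausen_coef l n.+1%:R i)); last first.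
  by apply/funext => i; exact: square_polyE.
rewrite mul1subX_coefZ AS.
have := cross_coef_rec l0 n.+1%:R k; rewrite natr1 => h.
have n0 : 0 <= n%:R :> R by [].
have n1 : n.+1%:R != 0 :> R by rewrite pnatr_eq0.
transitivity (A n.+1 ^+ 2 * ((2 * l + n.+1%:R) * cross_coef l n.+2%:R k)).
  by move: (cross_coef _ _ _) => X; rewrite -[n.+2%:R]natr1 -[n.+1%:R]natr1; field; neq0_conj.
rewrite h AS -[n.+1%:R]natr1; move: (mul1subX_coef _ _) (cross_coef _ _ _) => X Y.
by field; neq0_conj.
Qed.

Let square_poly_rec n : n.+2%:R ^+ 2 *: square_poly n.+2 =
  (4 * (n.+1%:R + l) ^+ 2) *: ((1 - 'X) * square_poly n.+1)
  - (4 * (n.+1%:R + l) * (n%:R + 2 * l)) *: cross_poly n + (n%:R + 2 * l) ^+ 2 *: square_poly n.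
Proof.
apply/polyP => k; rewrite coefD coefB !coefZ mul1subX_coefE !cross_polyE !square_polyE.
rewrite (_ : (fun i => _) = (fun i => A n.+1 ^+ 2 * clausen_coef l n.+1%:R i)); last first.
  by apply/funext => i; exact: square_polyE.
rewrite mul1subX_coefZ AS.
have := clausen_coef_rec l0 n.+1%:R k; rewrite natr1 => h.
have n0 : 0 <= n%:R :> R by [].
have n1 : n.+1%:R != 0 :> R by rewrite pnatr_eq0.
transitivity (A n.+1 ^+ 2 * ((2 * l + n.+1%:R) ^+ 2 * clausen_coef l n.+2%:R k)).
  by move: (clausen_coef _ _ _) => X; rewrite -[n.+2%:R]natr1 -[n.+1%:R]natr1; field; neq0_conj.
rewrite h AS -[n.+1%:R]natr1 addrK.
move: (mul1subX_coef _ _) (cross_coef _ _ _) (clausen_coef _ _ _) => X Y Z.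
by field; neq0_conj.
Qed.

(** Clausen's formula.  The three-term recurrence of [C_n], squared, or multiplied
    by [x * C_(n+1)], is the same system as [clausen_coef_rec] and
    [cross_coef_rec], and the initial values agree. *)
Lemma gegenbauer_sq n x : (gegenbauer_poly l n).[x] ^+ 2 =
  \sum_(k < n.+1) (poch (2 * l) n / n`!%:R) ^+ 2 * clausen_coef l n%:R k *
     (1 - x ^+ 2) ^+ k.
Proof.
suff : (gegenbauer_poly l n).[x] ^+ 2 = (square_poly n).[1 - x ^+ 2].
  by rewrite horner_poly.
set s := 1 - x ^+ 2; have xs : x ^+ 2 = 1 - s by rewrite /s; ring.
suff [] : [/\ (gegenbauer_poly l n).[x] ^+ 2 = (square_poly n).[s],
  (gegenbauer_poly l n.+1).[x] ^+ 2 = (square_poly n.+1).[s] &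
  x * (gegenbauer_poly l n.+1).[x] * (gegenbauer_poly l n).[x] = (cross_poly n).[s]] by [].
have e2 : 2 * l != 0 by rewrite gt_eqF// mulr_gt0.
have l0' := l0.
elim: n => [|n [IH1 IH2 IH3]].
  rewrite gegenbauer_poly0 gegenbauer_poly1 hornerZ hornerX hornerC.
  rewrite /square_poly /cross_poly !horner_poly !big_ord_recr !big_ord0 /=.
  rewrite /A /clausen_coef /cross_coef; lazy beta iota.
  rewrite !pochS !poch0 !factS !fact0; split.
  - by field; neq0_conj.
  - by rewrite exprMn xs; field; neq0_conj.
  - rewrite [X in _ = X](_ : _ = 2 * l * (1 - s)); last by field; neq0_conj.
    by rewrite -xs; ring.
have n2 : n.+2%:R != 0 :> R by rewrite pnatr_eq0.
have rec := gegenbauer_poly_rec l x n.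
have X1 : (1 - 'X : {poly R}).[s] = 1 - s by rewrite !hornerE.
split => //.
- have n22 : n.+2%:R ^+ 2 != 0 :> R by rewrite expf_neq0.
  apply: (mulfI n22); rewrite -exprMn rec -[RHS]hornerZ square_poly_rec.
  rewrite hornerD hornerD hornerN !hornerZ hornerM X1 -IH1 -IH2 -IH3 -xs.
  by ring.
- apply: (mulfI n2); rewrite -[RHS]hornerZ cross_poly_rec.
  rewrite hornerD hornerN !hornerZ hornerM X1 -IH2 -IH3 -xs.
  transitivity (x * (n.+2%:R * (gegenbauer_poly l n.+2).[x]) * (gegenbauer_poly l n.+1).[x]).
    by ring.
  by rewrite rec; ring.
Qed.

End Square.

(** * The balanced 4F3 as a convolution; uniqueness of the Gegenbauer family *)

(** The sum on the left is the balanced 4F3 produced by Clausen's formula.  Unlike its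
    terms, the two factors of the convolution do not depend on [n]. *)
Lemma clausen_conv (K : realFieldType) (l mu : K) n :
  0 < l -> - (1 / 2) < mu ->
  \sum_(k < n.+1) (poch (2 * l) n / n`!%:R) ^+ 2 * clausen_coef l n%:R k *
     (poch (mu + 1 / 2) k / poch (mu + 1) k) =
  poch (2 * l) n * poch (l + 1 / 2) n / (n`!%:R * poch (mu + 1) n) *
  conv (hyper l (l - mu) (l + 1 / 2)) (hyper l (1 - (l - mu)) (l + 1 / 2)) n.
Proof.
move=> l0 mu0.
have h2l k : poch (2 * l) k != 0 by rewrite gt_eqF// poch_gt0// mulr_gt0.
have hmu k : poch (mu + 1) k != 0 by rewrite gt_eqF// poch_gt0//; lra.
have hl k : poch l k != 0 by rewrite gt_eqF// poch_gt0.
have hlh k : poch (l + 1 / 2) k != 0 by rewrite gt_eqF// poch_gt0//; lra.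
have hf := @fact_neq0 K.
have sg k : (-1) ^+ k != 0 :> K by rewrite expf_neq0// oppr_eq0 oner_eq0.
(* The parameters of [sears_conv] are those for which the reversed symbols of
   index [n - k] rebuild the 4F3 on one side and the convolution on the other.
   The third one, [z], may be negative, but no zero of its symbols has index below
   [n]. *)
pose z := 1 - l - n%:R.
have zi i : (i < n)%N -> z + i%:R != 0.
  move=> i_n; rewrite /z -(subnK i_n) natrD -natr1.
  by rewrite lt_eqF//; have : 0 <= (n - i.+1)%:R :> K by []; lra.
have := @sears_conv _ (n%:R + 2 * l) (mu + 1 / 2) (l + 1 / 2)
  (1 - 2 * l - n%:R) (- mu - n%:R) z n.
rewrite (_ : l + 1 / 2 - (n%:R + 2 * l) = 1 - (l + 1 / 2) - n%:R); last by field.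
rewrite (_ : l + 1 / 2 - (mu + 1 / 2) = l - mu); last by field.
rewrite (_ : z - (1 - 2 * l - n%:R) = l); last by rewrite /z; ring.
rewrite (_ : z - (- mu - n%:R) = 1 - (l - mu)); last by rewrite /z; ring.
move=> /(_ _ _ zi) S.
have {S} : conv (hyper (1 - (l + 1 / 2) - n%:R) (l - mu) (l + 1 / 2))
      (hyper l (1 - (l - mu)) z) n =
    conv (hyper (n%:R + 2 * l) (mu + 1 / 2) (l + 1 / 2))
      (hyper (1 - 2 * l - n%:R) (- mu - n%:R) z) n.
  apply: S; first by field.
  by move=> i _; rewrite gt_eqF//; have : 0 <= i%:R :> K by []; lra.
have zE k : (k <= n)%N ->
    poch z (n - k) = (-1) ^+ (n - k) * poch l n / poch l k.
  move=> kn; apply: (mulIf (hl k)); rewrite divfK//.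
  by rewrite -poch_reflect ?leq_subr// subKn.
rewrite (_ : conv (hyper (1 - (l + 1 / 2) - n%:R) _ _) _ n =
  (-1) ^+ n * poch (l + 1 / 2) n / poch l n *
  conv (hyper l (l - mu) (l + 1 / 2)) (hyper l (1 - (l - mu)) (l + 1 / 2)) n); last first.
  rewrite /conv mulr_sumr; apply: eq_bigr => i _.
  have i_n : (i <= n)%N by rewrite -ltnS.
  have := poch_reflect (l + 1 / 2) i_n.
  rewrite /hyper zE// => /(canRL (mulfK (hlh _))) ->.
  rewrite (_ : (-1) ^+ n = (-1) ^+ i * (-1) ^+ (n - i)); last by rewrite -exprD subnKC.
  have ss : (-1) ^+ (n - i) * (-1) ^+ (n - i) = 1 :> K by rewrite -exprMn mulrNN mulr1 expr1n.
  have := sg (n - i)%N; move: ss; move: ((-1) ^+ (n - i)) => X X2 Xn.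
  rewrite (_ : X * poch l n / poch l i = X^-1 * poch l n / poch l i); last first.
    by congr (_ * _ / _); apply: (mulfI Xn); rewrite X2 divff.
  by field; rewrite !(hf, hl, hlh) ?Xn.
rewrite (_ : conv (hyper (n%:R + 2 * l) _ _) _ n =
  (-1) ^+ n * poch (2 * l) n * poch (mu + 1) n / (poch l n * n`!%:R) *
  \sum_(k < n.+1) clausen_coef l n%:R k * (poch (mu + 1 / 2) k / poch (mu + 1) k)); last first.
  rewrite /conv mulr_sumr; apply: eq_bigr => i _.
  have i_n : (i <= n)%N by rewrite -ltnS.
  have ni := leq_subr i n.
  have := poch_reflect (2 * l) ni; have := poch_reflect (mu + 1) ni.
  have := @poch_reflect K 1 _ _ i_n; rewrite !poch1 subrr sub0r !subKn//.
  rewrite (_ : 1 - (mu + 1) - n%:R = - mu - n%:R); last by ring.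
  rewrite /hyper /clausen_coef zE// => /(canRL (mulfK (hf _))) ->.
  move=> /(canRL (mulfK (hmu _))) -> /(canRL (mulfK (h2l _))) ->.
  rewrite (_ : (-1) ^+ n = (-1) ^+ i * (-1) ^+ (n - i)); last by rewrite -exprD subnKC.
  have ss : (-1) ^+ i * (-1) ^+ i = 1 :> K by rewrite -exprMn mulrNN mulr1 expr1n.
  have := sg i; have := sg (n - i)%N; move: ss; move: ((-1) ^+ (n - i)) ((-1) ^+ i) => X Y Y2 Xn Yn.
  rewrite (_ : Y * n`!%:R / _ = Y^-1 * n`!%:R / (n - i)`!%:R); last first.
    by congr (_ * _ / _); apply: (mulfI Yn); rewrite Y2 divff.
  by field; rewrite !(hf, hl, hlh, hmu, h2l) ?Xn ?Yn.
move=> E.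
set Q := conv _ _ _ in E *; set S := \sum_(k < n.+1) _ in E.
transitivity ((poch (2 * l) n / n`!%:R) ^+ 2 * S).
  by rewrite mulr_sumr; apply: eq_bigr => i _; rewrite [RHS]mulrA.
have -> : Q = poch (2 * l) n * poch (mu + 1) n / (n`!%:R * poch (l + 1 / 2) n) * S.
  apply: (mulfI (mulf_neq0 (mulf_neq0 (sg n) (hlh n)) (invr_neq0 (hl n)))).
  by rewrite E; field; rewrite !(hf, hl, hlh).
by field; rewrite !(hf, hmu, hlh).
Qed.

Lemma sum_expr_le (R : realType) (q : R) n : 0 <= q -> q <= 1 / 2 ->
  \sum_(k < n) q ^+ k <= 2 - 2 * q ^+ n.
Proof.
move=> q0 q2; elim: n => [|n IH]; first by rewrite big_ord0 expr0; lra.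
rewrite big_ord_recr /= exprS; have := exprn_ge0 n q0.
by move: IH; set S := \sum_(_ < _) _; set Q := q ^+ n => IH Q0; nra.
Qed.

(** Only a punctured neighbourhood is assumed, so that a zero constant term can be
    divided out by [z] and the argument repeated. *)
Lemma pseries_eq0_coef0 (R : realType) (c : nat -> R) :
  (\forall z \near (0 : R)^', pseries c z @ \oo --> (0 : R)) -> c 0%N = 0.
Proof.
move=> /nbhs_ballP[e /= e0 ce].
have cz z : 0 < z -> z < e -> pseries c z @ \oo --> (0 : R).
  move=> z0 ze; apply: ce; last by rewrite gt_eqF.
  by rewrite /ball /= sub0r normrN gtr0_norm.
pose r := e / 2; have r0 : 0 < r by rewrite divr_gt0.
have re : r < e by rewrite /r; lra.
have [M [_ MB]] : bounded_fun (fun n => c n * r ^+ n).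
  apply: cvg_seq_bounded; apply/cvg_ex; exists 0.
  by apply: cvg_series_cvg_0; apply/cvg_ex; exists 0; exact: cz.
pose B := Num.max M 0 + 1.
have B0 : 0 < B by rewrite /B ltr_wpDl// le_max lexx orbT.
have {MB} MB n : `|c n * r ^+ n| <= B.
  by apply: MB => //; rewrite /B (@le_lt_trans _ _ (Num.max M 0)) ?le_max ?lexx// ltrDl.
(* At [z = q * r] the terms are at most [B * q^k], so the constant term is the
   opposite of a tail of size [B * q]. *)
have key q : 0 < q -> q <= 1 / 2 -> `|c 0%N| <= B * q * 2.
  move=> q0 q2.
  have zc : pseries c (q * r) @ \oo --> (0 : R).
    apply: cz; first by rewrite mulr_gt0.
    by apply: le_lt_trans re; nra.
  have : (fun n => `|c 0%N - pseries c (q * r) n.+1|) @ \oo --> `|c 0%N - 0|.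
    by apply: cvg_norm; apply: cvgB; [exact: cvg_cst|rewrite cvg_shiftS].
  rewrite subr0 => cc; rewrite -(cvg_lim _ cc)//.
  apply: limr_le; first by apply/cvg_ex; exists `|c 0%N|.
  apply: nearW => n /=.
  rewrite /pseries /series /= big_nat_recl//= expr0 mulr1 opprD addNKr normrN.
  rewrite big_mkord (le_trans (ler_norm_sum _ _ _))//.
  apply: (@le_trans _ _ (\sum_(k < n) B * q * q ^+ k)).
    apply: ler_sum => k _; rewrite exprMn [q ^+ _ * _]mulrC mulrA normrM.
    rewrite [`|q ^+ _|]ger0_norm ?(exprn_ge0 _ (ltW q0))// -[B * q * _]mulrA -exprS.
    by apply: ler_wpM2r; [rewrite exprn_ge0// ltW|exact: MB].
  rewrite -mulr_sumr; apply: ler_wpM2l; first by rewrite mulr_ge0// ltW.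
  apply: ltW; apply: (le_lt_trans (sum_expr_le n (ltW q0) q2)).
  by rewrite ltrBlDl ltrDr mulr_gt0 ?exprn_gt0.
apply/eqP; rewrite -normr_eq0 -[_ == 0]negbK; apply/negP => c0.
have c0' : 0 < `|c 0%N| by rewrite lt0r c0 normr_ge0.
pose q := Num.min (1 / 2) (`|c 0%N| / (4 * B)).
have q0 : 0 < q by rewrite lt_min; apply/andP; split; [lra|rewrite divr_gt0 ?mulr_gt0].
have := key q q0; rewrite ge_min lexx => /(_ isT).
have : q <= `|c 0%N| / (4 * B) by rewrite ge_min lexx orbT.
rewrite ler_pdivlMr ?mulr_gt0// => h1 h2; nra.
Qed.

Lemma pseries_coef_inj (R : realType) (c : nat -> R) :
  (\forall z \near (0 : R), pseries c z @ \oo --> (0 : R)) -> forall n, c n = 0.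
Proof.
move=> cz n.
have {}cz : \forall z \near (0 : R)^', pseries c z @ \oo --> (0 : R).
  exact: nbhs_dnbhs.
elim: n c cz => [|n IH] c cz; first exact: pseries_eq0_coef0.
apply: (IH (fun n => c n.+1)).
have c0 := pseries_eq0_coef0 cz.
near=> z.
have z0 : z != 0 by near: z; exact: nbhs_dnbhs_neq.
have : pseries c z @ \oo --> (0 : R) by near: z.
rewrite -cvg_shiftS (_ : (fun n => _) = (fun n => z * pseries (fun k => c k.+1) z n)).
  move=> h; rewrite (_ : pseries _ z = (fun n => z^-1 * (z * pseries (fun k => c k.+1) z n))).
    by rewrite -(mulr0 z^-1); exact: cvgMl_tmp.
  by apply/funext => m; rewrite mulKf.
apply/funext => m; rewrite /pseries /series /= big_nat_recl// c0 mul0r add0r.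
by rewrite mulr_sumr; apply: eq_bigr => i _; rewrite /= exprS mulrCA.
Unshelve. all: by end_near. Qed.

(** This transfers the three-term recurrence to an arbitrary Gegenbauer family. *)
Lemma gegenbauer_family_unique (R : realType) (l : R) C : 0 < l ->
  gegenbauer_family l C -> forall n x, (C n).[x] = (gegenbauer_poly l n).[x].
Proof.
move=> l0 hC n x.
apply/eqP; rewrite -subr_eq0 -mulN1r; apply/eqP.
move: n; apply: (@pseries_coef_inj R (fun n => (C n).[x] + -1 * (gegenbauer_poly l n).[x])).
have := hC x; have := gegenbauer_poly_family l0 x; apply: filterS2 => z h1 h2.
have := @cvg_lin_pseries R (fun n => (C n).[x]) (fun n => (gegenbauer_poly l n).[x]) z _ _ (-1) h2 h1.
by rewrite mulN1r subrr.
Qed.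

(** * Improper integrals of derivatives *)

Section ImproperFTC.
Variable R : realType.
Notation mu := (@lebesgue_measure R).

(** The two integrals may be improper at both ends, and either may be infinite;
    stating the result for [f] and [g] separately, in the extended reals, lets a
    functional equation be proved before its integrals are known to converge. *)
Lemma FTC_ge0_exhaustion (f g F : R -> R) (a b : nat -> R) (D : set R) (L : R) :
  (forall n, a n < b n) ->
  (forall n, a n.+1 <= a n) -> (forall n, b n <= b n.+1) ->
  D = \bigcup_n `[a n, b n]%classic ->
  (forall x, D x -> 0 <= f x) -> (forall x, D x -> 0 <= g x) ->
  (forall x, D x -> {for x, continuous f}) ->
  (forall x, D x -> {for x, continuous g}) ->
  (forall x, D x -> is_derive x (1 : R) F (f x - g x)) ->
  F (b n) - F (a n) @[n --> \oo] --> L ->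
  (\int[mu]_(x in D) (f x)%:E = \int[mu]_(x in D) (g x)%:E + L%:E)%E.
Proof.
move=> ab ai bi DE f0 g0 fc gc dF FL.
pose I n : set R := `[a n, b n]%classic.
have ID n x : I n x -> D x by move=> Ix; rewrite DE; exists n.
have wc (h : R -> R) n : (forall x, D x -> {for x, continuous h}) -> {within I n, continuous h}.
  move=> hc; apply: (@continuous_in_subspaceT _ _ (I n) h); move=> x; rewrite inE => Ix.
  exact: hc (ID _ _ Ix).
have ndI : nondecreasing_seq I.
  apply/nondecreasing_seqP => n; rewrite subsetEset => x /=.
  rewrite /I /= !in_itv /= => /andP[ax xb].
  by rewrite (le_trans (ai n) ax) (le_trans xb (bi n)).
have intI (h : R -> R) n : (forall x, D x -> {for x, continuous h}) ->
    mu.-integrable (I n) (EFin \o h).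
  move=> hc; apply: continuous_compact_integrable; first exact: segment_compact.
  exact: wc.
have cvI (h : R -> R) : (forall x, D x -> 0 <= h x) -> (forall x, D x -> {for x, continuous h}) ->
    (\int[mu]_(x in I n) (h x)%:E)%E @[n --> \oo] --> (\int[mu]_(x in D) (h x)%:E)%E.
  move=> h0 hc; rewrite DE.
  apply: ge0_nondecreasing_set_cvg_integral => //.
  - by move=> n; exact: measurable_itv.
  - move=> n; apply: measurable_int; exact: (intI h n hc).
  - by move=> n x Ix; rewrite lee_fin; apply: h0; exact: ID Ix.
have step n : (\int[mu]_(x in I n) (f x)%:E =
   \int[mu]_(x in I n) (g x)%:E + (F (b n) - F (a n))%:E)%E.
  have := @continuous_FTC2 R (fun x => f x - g x) F (a n) (b n) (ab n) _ _ _.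
  have dFI x : I n x -> derivable F x 1 by move=> /ID /dF [].
  have cF x : I n x -> F y @[y --> x] --> F x.
    by move=> /dFI /derivable1_diffP /differentiable_continuous.
  have aI : I n (a n) by rewrite /I /= in_itv /= lexx ltW.
  have bI : I n (b n) by rewrite /I /= in_itv /= lexx ltW.
  have -> : (\int[mu]_(x in `[a n, b n]) ((f x - g x)%:E))%E =
    (\int[mu]_(x in I n) (f x)%:E - \int[mu]_(x in I n) (g x)%:E)%E.
    rewrite -integralB_EFin//; [exact: measurable_itv|exact: intI|exact: intI].
  move=> E; rewrite EFinB -E; last first.
  - move=> x xI; have xI' : I n x by rewrite /I /= (subset_itv_oo_cc xI).
    by rewrite derive1E; have [_ ->] := dF _ (ID _ _ xI').
  - split.
    + by move=> x xI; apply: dFI; exact: subset_itv_oo_cc.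
    + apply: cvg_at_right_filter; exact: cF.
    + apply: cvg_at_left_filter; exact: cF.
  - apply: wc => x Dx; apply: cvgB; [exact: fc|exact: gc].
  - rewrite addeC subeK//.
    by apply: (integrable_fin_num _ (intI g n gc)); exact: measurable_itv.
apply: (@cvg_unique _ (@ereal_hausdorff R) ((\int[mu]_(x in I n) (f x)%:E)%E @[n --> \oo])).
  exact: cvI f0 fc.
rewrite (_ : (fun n => _) = (fun n => \int[mu]_(x in I n) (g x)%:E +
   (F (b n) - F (a n))%:E)%E); last by apply/funext.
apply: cvgeD; [|exact: cvI g0 gc|]; last first.
  by apply: cvg_EFin => //; exact: nearW.
by rewrite fin_num_adde_defl.
Qed.

End ImproperFTC.

(** * The Gamma function on the positive half-line *)

Section GammaFun.
Variable R : realType.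
Notation mu := (@lebesgue_measure R).
Implicit Types x s t : R.

Definition gamma_integrand x t := t `^ (x - 1) * expR (- t).

Local Notation gf := gamma_integrand.
Local Notation D := (`]0, +oo[%classic : set R).

Lemma itv0y_exhaustion : D = \bigcup_n `[n.+2%:R^-1 : R, n.+2%:R]%classic.
Proof.
apply/seteqP; split=> t /=; rewrite in_itv /= andbT.
  move=> t0; have tV0 : 0 < t^-1 by rewrite invr_gt0.
  exists (Num.truncn t + Num.truncn t^-1)%N => //=.
  have h1 := truncnS_gt t; have h2 := truncnS_gt t^-1.
  rewrite in_itv /= -[X in _ <= X]invrK lef_pV2 ?posrE ?ltr0n ?invr_gt0//.
  apply/andP; split.
    by rewrite (le_trans (ltW h2))// ler_nat leqW// ltnS leq_addl.
  by rewrite (le_trans (ltW h1))// ler_nat leqW// ltnS leq_addr.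
by case=> n _ /=; rewrite in_itv /= => /andP[h _]; apply: lt_le_trans h; rewrite invr_gt0.
Qed.

Lemma gamma_integrand_ge0 x t : 0 <= gf x t.
Proof. by rewrite mulr_ge0 ?powR_ge0 ?expR_ge0. Qed.

Lemma continuous_powR x t : 0 < t -> {for t, continuous (fun u => u `^ x)}.
Proof.
move=> t0; have [d _] := is_derive1_powR x t0.
exact/differentiable_continuous/derivable1_diffP.
Qed.

Lemma continuous_gamma_integrand x t : 0 < t -> {for t, continuous (gf x)}.
Proof.
move=> t0; apply: continuousM; first exact: continuous_powR.
apply: continuous_comp; first exact: opp_continuous.
exact: continuous_expR.
Qed.

Lemma measurable_gamma_integrand x : measurable_fun D (EFin \o gf x).
Proof.
apply/measurable_EFinP/measurable_funTS.
apply: measurable_funM; first exact: measurable_powR.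
by apply: measurableT_comp => //; exact: measurable_expR.
Qed.

Lemma is_derive_powR_expRN x t : 0 < t ->
  is_derive t (1 : R) (fun u => u `^ x * expR (- u)) (x * gf x t - gf (x + 1) t).
Proof.
move=> t0.
have d1 := is_derive1_powR x t0.
have dN : is_derive t (1 : R) (fun u : R => - u) (-1).
  have := @is_deriveN _ _ _ (@id R) t 1 1 (is_derive_id _ _); exact.
have d2 := is_derive1_comp (is_derive_expR (- t)) dN.
have := is_deriveM d1 d2 => /is_derive_eq; apply.
by rewrite /gf addrK /GRing.scale /=; ring.
Qed.

Lemma cvg_invn_at_right : (n.+2%:R^-1 : R) @[n --> \oo] --> 0^'+.
Proof.
move=> P hP; rewrite /at_right in hP.
have : (n.+2%:R^-1 : R) @[n --> \oo] --> (0 : R).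
  by have := @cvg_harmonic R; rewrite -cvg_shiftS.
move=> /(_ _ hP) h.
have {}h : \forall n \near \oo, 0 < n.+2%:R^-1 :> R -> P n.+2%:R^-1 := h.
change (\forall n \near \oo, P n.+2%:R^-1).
by apply: filterS h => n; apply; rewrite invr_gt0.
Qed.

Lemma powR_expRN_cvg0 x : (n.+2%:R `^ x * expR (- n.+2%:R) : R) @[n --> \oo] --> (0 : R).
Proof.
pose N := Num.truncn x; have xN : x <= N.+1%:R by rewrite ltW// truncnS_gt.
apply: (@squeeze_cvgr _ _ _ _ (fun=> 0) (fun n => N.+2`!%:R * n.+2%:R^-1)).
- apply: nearW => n; rewrite mulr_ge0 ?powR_ge0 ?expR_ge0//=.
  have n1 : 1 <= n.+2%:R :> R by rewrite ler1n.
  have n0 : 0 < n.+2%:R :> R by [].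
  apply: (@le_trans _ _ (n.+2%:R ^+ N.+1 * expR (- n.+2%:R))).
    by rewrite ler_wpM2r ?expR_ge0// -powR_mulrn ?ler_powR.
  rewrite expRN ler_pdivrMr ?expR_gt0// mulrAC ler_pdivlMr//.
  rewrite -exprSr -ler_pdivrMl ?ltr0n ?fact_gt0// mulrC.
  apply: le_trans (expR_ge1Dxn N.+1 (ltW n0)).
  by rewrite lerDr.
- exact: cvg_cst.
- rewrite -[X in _ --> X](mulr0 N.+2`!%:R); apply: cvgMl_tmp.
  by have := @cvg_harmonic R; rewrite -cvg_shiftS.
Qed.

Lemma gamma_integral_rec x : 0 < x ->
  (\int[mu]_(t in D) (gf (x + 1) t)%:E = x%:E * \int[mu]_(t in D) (gf x t)%:E)%E.
Proof.
move=> x0.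
have Dgt t : D t -> 0 < t by rewrite /= in_itv /= andbT.
have dF t : D t -> is_derive t (1 : R) (fun u => u `^ x * expR (- u))
    (x * gf x t - gf (x + 1) t).
  by move=> /Dgt; exact: is_derive_powR_expRN.
have -> : (\int[mu]_(t in D) (gf (x + 1) t)%:E = \int[mu]_(t in D) (x * gf x t)%:E)%E.
  rewrite (@FTC_ge0_exhaustion R (fun t => x * gf x t) (gf (x + 1))
    (fun u => u `^ x * expR (- u)) (fun n => n.+2%:R^-1) (fun n => n.+2%:R) D 0
    _ _ _ itv0y_exhaustion _ _ _ _ dF _) ?adde0//.
- move=> n; apply: (@lt_trans _ _ 1); last by rewrite ltr1n.
  by rewrite invf_lt1// ltr1n.
- by move=> n; rewrite lef_pV2 ?posrE// ler_nat.
- by move=> n; rewrite ler_nat.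
- by move=> t _; rewrite mulr_ge0 ?gamma_integrand_ge0// ltW.
- by move=> t _; exact: gamma_integrand_ge0.
- move=> t /Dgt t0; apply: continuousM; first exact: cst_continuous.
  exact: continuous_gamma_integrand.
- by move=> t /Dgt; exact: continuous_gamma_integrand.
- rewrite -[X in _ --> X](subr0 0); apply: cvgB; first exact: powR_expRN_cvg0.
  apply: (@squeeze_cvgr _ _ _ _ (fun=> 0) (fun n => n.+2%:R^-1 `^ x)).
  + apply: nearW => n; rewrite mulr_ge0 ?powR_ge0 ?expR_ge0//= ler_piMr ?powR_ge0//.
  + exact: cvg_cst.
  + by have := cvg_comp _ _ cvg_invn_at_right (powR_cvg0 x0).
rewrite -ge0_integralZl_EFin//; last exact: ltW.
  by move=> t _; rewrite lee_fin gamma_integrand_ge0.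
exact: measurable_gamma_integrand.
Qed.

Lemma gamma_integral1 : (\int[mu]_(t in D) (gf 1 t)%:E = 1)%E.
Proof.
have Dgt t : D t -> 0 < t by rewrite /= in_itv /= andbT.
have dF t : D t -> is_derive t (1 : R) (fun u => - expR (- u)) (gf 1 t - 0).
  move=> _; have dN : is_derive t (1 : R) (fun u : R => - u) (-1).
    have := @is_deriveN _ _ _ (@id R) t 1 1 (is_derive_id _ _); exact.
  have := is_deriveN (is_derive1_comp (is_derive_expR (- t)) dN) => /is_derive_eq; apply.
  by rewrite /gf subrr powRr0; ring.
rewrite (@FTC_ge0_exhaustion R (gf 1) (fun=> 0)
  (fun u => - expR (- u)) (fun n => n.+2%:R^-1) (fun n => n.+2%:R) D 1
  _ _ _ itv0y_exhaustion _ _ _ _ dF _); first by rewrite integral0 add0e.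
- move=> n; apply: (@lt_trans _ _ 1); last by rewrite ltr1n.
  by rewrite invf_lt1// ltr1n.
- by move=> n; rewrite lef_pV2 ?posrE// ler_nat.
- by move=> n; rewrite ler_nat.
- by move=> t _; exact: gamma_integrand_ge0.
- by [].
- by move=> t /Dgt; exact: continuous_gamma_integrand.
- by move=> t _; exact: cst_continuous.
- rewrite (_ : (fun n => _) = (fun n => - (n.+2%:R `^ 0 * expR (- n.+2%:R)) + expR (- n.+2%:R^-1))).
    rewrite -[X in _ --> X]add0r; apply: cvgD.
      by rewrite -oppr0; apply: cvgN; exact: powR_expRN_cvg0.
    have : expR (- n.+2%:R^-1) @[n --> \oo] --> expR (0 : R).
      apply: continuous_cvg; first exact: continuous_expR.
      rewrite -[X in _ --> X]oppr0; apply: cvgN.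
      by have := @cvg_harmonic R; rewrite -cvg_shiftS.
    by rewrite expR0.
  by apply/funext => n; rewrite powRr0 mul1r opprK.
Qed.

(** Finiteness spreads from the positive integers to [x >= 1], by
    [t^(x-1) <= 1 + t^N], and to [0 < x < 1] by the functional equation. *)
Lemma gamma_integral_lty x : 0 < x -> (\int[mu]_(t in D) (gf x t)%:E < +oo)%E.
Proof.
have E0 y : (0 <= \int[mu]_(t in D) (gf y t)%:E)%E.
  by apply: integral_ge0 => t _; rewrite lee_fin gamma_integrand_ge0.
have nat n : (\int[mu]_(t in D) (gf n.+1%:R t)%:E < +oo)%E.
  elim: n => [|n IH]; first by rewrite gamma_integral1 ltry.
  rewrite -natr1 gamma_integral_rec//.
  by rewrite -ge0_fin_numE ?fin_numM// ?ge0_fin_numE// mule_ge0.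
have ge1 y : 1 <= y -> (\int[mu]_(t in D) (gf y t)%:E < +oo)%E.
  move=> y1; pose N := Num.truncn y.
  have yN : y <= N.+1%:R by rewrite ltW// truncnS_gt.
  apply: (@le_lt_trans _ _ (\int[mu]_(t in D) ((gf 1 t)%:E + (gf N.+1%:R t)%:E))%E).
    apply: ge0_le_integral => //.
    - by move=> t _; rewrite lee_fin gamma_integrand_ge0.
    - exact: measurable_gamma_integrand.
    - by apply: emeasurable_funD; exact: measurable_gamma_integrand.
    - move=> t /=; rewrite in_itv /= andbT => t0.
      rewrite -EFinD lee_fin /gf -mulrDl ler_wpM2r ?expR_ge0// subrr powRr0.
      have [t1|t1] := leP 1 t.
        by rewrite ler_wpDl// ler_powR// lerB.
      apply: (@le_trans _ _ 1); last by rewrite lerDl powR_ge0.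
      rewrite -[X in _ <= X](powRr0 t); apply: ger_powR; first by rewrite t0 ltW.
      by rewrite subr_ge0.
  rewrite ge0_integralD//; last 4 first.
  - by move=> t _; rewrite lee_fin gamma_integrand_ge0.
  - exact: measurable_gamma_integrand.
  - by move=> t _; rewrite lee_fin gamma_integrand_ge0.
  - exact: measurable_gamma_integrand.
  by rewrite lte_add_pinfty// gamma_integral1 ltry.
move=> x0; have := ge1 (x + 1); rewrite lerDr ltW// => /(_ isT).
rewrite gamma_integral_rec//; have := E0 x; case: (\int[mu]_(t in D) _)%E => //.
  by move=> r _ _; rewrite ltry.
by rewrite gt0_muley ?lte_fin// ltxx.
Qed.

Lemma integrable_gamma_integrand x : 0 < x -> mu.-integrable D (EFin \o gf x).
Proof.
move=> x0; apply/integrableP; split; first exact: measurable_gamma_integrand.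
under eq_integral do rewrite /= ger0_norm ?gamma_integrand_ge0//.
exact: gamma_integral_lty.
Qed.

Lemma GammaD1 x : 0 < x -> Gamma (x + 1) = x * Gamma x.
Proof.
move=> x0; rewrite /Gamma /Rintegral gamma_integral_rec// fineM//.
by rewrite ge0_fin_numE ?gamma_integral_lty// integral_ge0// => t _;
  rewrite lee_fin gamma_integrand_ge0.
Qed.

Lemma Gamma1 : Gamma (1 : R) = 1.
Proof. by rewrite /Gamma /Rintegral gamma_integral1. Qed.

(** A concave function lies below its tangent, here at [t = x]. *)
Lemma powR_le_tangent x s t : 0 < x -> 0 <= s <= 1 -> 0 < t ->
  t `^ s <= x `^ s * (1 - s + s / x * t).
Proof.
move=> x0 /andP[s0 s1] t0.
have tx : 0 < t / x by rewrite divr_gt0.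
have -> : t `^ s = x `^ s * (t / x) `^ s.
  by rewrite -powRM ?ltW// mulrC divfK// gt_eqF.
have -> : s / x * t = s * (t / x) by rewrite mulrAC mulrA.
apply: ler_wpM2l; first exact: powR_ge0.
move: (t / x) tx => y y0.
(* [m] is the weighted mean of 1 and [y]; concavity of [ln] at [m] follows from
   [ln z <= z - 1] at [1 / m] and [y / m]. *)
pose m := 1 - s + s * y.
have m0 : 0 < m by rewrite /m; nra.
have lnm (z : R) : 0 < z -> ln z <= z - 1.
  by move=> z0; have := @le_ln1Dx R (z - 1); rewrite [1 + _]addrC subrK; apply; lra.
rewrite -/m /powR gt_eqF// -[leRHS](lnK m0) ler_expR.
have mV0 : 0 < m^-1 by rewrite invr_gt0.
have h1 := lnm _ mV0.
have h2 := lnm (y / m) (divr_gt0 y0 m0).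
rewrite lnV ?posrE// in h1; rewrite ln_div ?posrE// in h2.
have h3 : (1 - s) * (m^-1 - 1) + s * (y / m - 1) = 0.
  by rewrite /m; field; rewrite gt_eqF.
have s1' : 0 <= 1 - s by lra.
have := lerD (ler_wpM2l s1' h1) (ler_wpM2l s0 h2).
by rewrite h3; nra.
Qed.

(** Integrating the tangent bound at [t = x] against the density of [Gamma x] loses
    nothing in the linear term, since the mean of that density is [x]. *)
Lemma Gamma_le_powR x s : 0 < x -> 0 <= s <= 1 -> Gamma (x + s) <= x `^ s * Gamma x.
Proof.
move=> x0 s01; have /andP[s0 s1] := s01.
have xs0 : 0 < x + s by lra.
have x10 : 0 < x + 1 by lra.
have i1 : mu.-integrable D (EFin \o (fun t => (1 - s) * gf x t)).
  by apply: (@integrableZl _ _ _ mu D _ (1 - s) (EFin \o gf x)) => //; exact: integrable_gamma_integrand.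
have i2 : mu.-integrable D (EFin \o (fun t => s / x * gf (x + 1) t)).
  by apply: (@integrableZl _ _ _ mu D _ (s / x) (EFin \o gf (x + 1))) => //; exact: integrable_gamma_integrand.
have i12 : mu.-integrable D (EFin \o (fun t => (1 - s) * gf x t + s / x * gf (x + 1) t)).
  by have := integrableD _ i1 i2; apply; exact: measurable_itv.
have -> : Gamma x = \int[mu]_(t in D) ((1 - s) * gf x t + s / x * gf (x + 1) t).
  rewrite RintegralD// !RintegralZl//; try exact: integrable_gamma_integrand.
  rewrite -/(Gamma x) -/(Gamma (x + 1)) GammaD1//.
  by field; rewrite gt_eqF.
rewrite -RintegralZl//; apply: le_Rintegral => //.
- exact: integrable_gamma_integrand.
- by apply: (@integrableZl _ _ _ mu D _ (x `^ s)) i12.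
- move=> t /=; rewrite in_itv /= andbT => t0.
  have nz (r : R) : (r == 0) ==> (t != 0) by rewrite (gt_eqF t0) implybT.
  have := powR_le_tangent x0 s01 t0; rewrite /gf addrK.
  have -> : t `^ (x + s - 1) = t `^ (x - 1) * t `^ s.
    by rewrite -powRD; [congr (_ `^ _); ring|exact: nz].
  have -> : t `^ x = t `^ (x - 1) * t.
    by rewrite -[X in _ * X](powRr1 (ltW t0)) -powRD ?subrK//; exact: nz.
  have p0 : 0 <= t `^ (x - 1) * expR (- t) by rewrite mulr_ge0 ?powR_ge0 ?expR_ge0.
  move=> /(ler_wpM2l p0); move: (t `^ _) (expR _) (t `^ s) => A B C h.
  by apply: le_trans (le_trans h _); rewrite ?le_eqVlt; apply/orP; left; apply/eqP; ring.
Qed.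

Lemma Gamma_nat n : Gamma (n.+1%:R : R) = n`!%:R.
Proof.
elim: n => [|n IH]; first by rewrite Gamma1.
by rewrite -natr1 GammaD1// IH factS natrM.
Qed.

(** If [Gamma x] vanished, [Gamma_le_powR] would make [Gamma] vanish at the next
    integer. *)
Lemma Gamma_gt0 x : 0 < x -> 0 < Gamma x.
Proof.
move=> x0; have G0 : 0 <= Gamma x.
  by apply: Rintegral_ge0 => t _; exact: gamma_integrand_ge0.
rewrite lt0r G0 andbT; apply/eqP => Gx.
have /andP[h1 h2] := truncn_itv (ltW x0).
set n := Num.truncn x in h1 h2.
have s01 : 0 <= n.+1%:R - x <= 1 by rewrite -natr1 in h2 *; apply/andP; split; lra.
have := Gamma_le_powR x0 s01.
rewrite Gx mulr0 (_ : x + (n.+1%:R - x) = n.+1%:R); last by ring.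
by rewrite Gamma_nat leNgt ltr0n fact_gt0.
Qed.

End GammaFun.

(** * Asymptotic bounds and ratios of Gamma values *)

Definition Oh (R : realType) (u w : nat -> R) : Prop :=
  exists2 K, 0 <= K & \forall n \near \oo, `|u n| <= K * `|w n|.

(** Convergence at rate [1/n]. *)
Definition rate1 (R : realType) (q : nat -> R) (L : R) : Prop :=
  Oh (fun n => q n - L) (fun n => n%:R^-1).

Section Oh.
Variable R : realType.
Implicit Types (u v w q : nat -> R) (K L c : R).

Lemma Oh_refl u : Oh u u.
Proof. by exists 1 => //; apply: nearW => n; rewrite mul1r. Qed.

Lemma Oh_near u u' w w' : (\forall n \near \oo, u n = u' n) ->
  (\forall n \near \oo, w n = w' n) -> Oh u w -> Oh u' w'.
Proof.
move=> uu ww [K K0 h]; exists K => //.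
by apply: filterS3 uu ww h => n -> ->.
Qed.

Lemma Oh_eq u u' w : (\forall n \near \oo, u n = u' n) -> Oh u w -> Oh u' w.
Proof. by move=> uu; apply: Oh_near => //; exact: nearW. Qed.

Lemma OhD u v w : Oh u w -> Oh v w -> Oh (fun n => u n + v n) w.
Proof.
move=> [K K0 h] [M M0 k]; exists (K + M); first exact: addr_ge0.
by apply: filterS2 h k => n h k; rewrite mulrDl (le_trans (ler_normD _ _))// lerD.
Qed.

Lemma OhM u v w w' : Oh u w -> Oh v w' -> Oh (fun n => u n * v n) (fun n => w n * w' n).
Proof.
move=> [K K0 h] [M M0 k]; exists (K * M); first exact: mulr_ge0.
by apply: filterS2 h k => n h k; rewrite !normrM mulrACA ler_pM.
Qed.

Lemma Oh_trans u v w : Oh u v -> Oh v w -> Oh u w.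
Proof.
move=> [K K0 h] [M M0 k]; exists (K * M); first exact: mulr_ge0.
apply: filterS2 h k => n h k; rewrite (le_trans h)// -mulrA.
exact: ler_wpM2l.
Qed.

Lemma OhZ c u w : Oh u w -> Oh (fun n => c * u n) w.
Proof.
move=> [K K0 h]; exists (`|c| * K); first by rewrite mulr_ge0.
by apply: filterS h => n h; rewrite normrM -mulrA ler_wpM2l.
Qed.

Lemma Oh_le u w : (\forall n \near \oo, `|u n| <= w n) -> Oh u w.
Proof.
move=> h; exists 1 => //; apply: filterS h => n h.
by rewrite mul1r (le_trans h)// ler_norm.
Qed.

Lemma Oh_all u w : (forall n, 0 < w n) -> Oh u w ->
  exists2 K, 0 <= K & forall n, `|u n| <= K * w n.
Proof.
move=> w0 [K K0 [N _ h]].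
have t0 k : 0 <= `|u k| / w k by rewrite divr_ge0// ltW.
have S0 (P : pred 'I_N) : 0 <= \sum_(k < N | P k) `|u k| / w k by apply: sumr_ge0.
exists (K + \sum_(k < N) `|u k| / w k) => [|n]; first exact: addr_ge0.
have wn := ltW (w0 n).
have [nN|Nn] := ltnP n N; last first.
  have := h n Nn; rewrite (gtr0_norm (w0 n)) => /le_trans; apply.
  by rewrite ler_wpM2r// lerDl.
rewrite mulrDl ler_wpDl//; first exact: mulr_ge0.
rewrite (bigD1 (Ordinal nN))//= mulrDl divfK ?gt_eqF// lerDl.
by apply: mulr_ge0.
Qed.

Lemma Oh_bounded_rate1 q L : rate1 q L -> Oh q (fun=> 1).
Proof.
move=> [K K0 h]; exists (K + `|L|); first by rewrite addr_ge0.
near=> n; rewrite normr1 mulr1 -[q n](subrK L) (le_trans (ler_normD _ _))// lerD2r.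
have n0 : (0 < n)%N by near: n; exact: nbhs_infty_gt.
have : `|q n - L| <= K * `|n%:R^-1| by near: n.
move=> /le_trans; apply; rewrite ler_piMr// ger0_norm// invf_le1 ?ler1n// ltr0n.
by [].
Unshelve. all: by end_near. Qed.

Lemma rate1_cvg q L : rate1 q L -> q n @[n --> \oo] --> L.
Proof.
move=> [K K0 h]; apply/cvgrPdist_le => e e0.
near=> n; rewrite distrC.
have n0 : (0 < n)%N by near: n; exact: nbhs_infty_gt.
have : `|q n - L| <= K * `|n%:R^-1| by near: n.
move=> /le_trans; apply; rewrite ger0_norm// ler_pdivrMr ?ltr0n//.
rewrite -ler_pdivrMl// mulrC.
by near: n; exact: nbhs_infty_ger.
Unshelve. all: by end_near. Qed.

Lemma rate1_eq q q' L : (\forall n \near \oo, q n = q' n) -> rate1 q L -> rate1 q' L.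
Proof. by move=> qq; apply: Oh_eq; apply: filterS qq => n ->. Qed.

Lemma rate1_cst c : rate1 (fun=> c) c.
Proof. by exists 0 => //; apply: nearW => n; rewrite subrr normr0 mul0r. Qed.

Lemma rate1D q q' L L' : rate1 q L -> rate1 q' L' -> rate1 (fun n => q n + q' n) (L + L').
Proof.
move=> h k; have := OhD h k; apply: Oh_eq; apply: nearW => n.
by rewrite opprD addrACA.
Qed.

Lemma rate1M q q' L L' : rate1 q L -> rate1 q' L' -> rate1 (fun n => q n * q' n) (L * L').
Proof.
move=> h k; have h' : Oh (fun n => (q n - L) * q' n) (fun n => n%:R^-1).
  apply: Oh_near (OhM h (Oh_bounded_rate1 k)); apply: nearW => n //.
  by rewrite mulr1.
have := OhD h' (OhZ L k); apply: Oh_eq; apply: nearW => n; ring.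
Qed.

Lemma rate1V q L : L != 0 -> rate1 q L -> rate1 (fun n => (q n)^-1) L^-1.
Proof.
move=> L0 h.
have L2 : 0 < `|L| / 2 by rewrite divr_gt0// normr_gt0.
have qL : \forall n \near \oo, `|L| / 2 <= `|q n|.
  have /cvgrPdist_le /(_ _ L2) := rate1_cvg h; apply: filterS => n hn.
  have := ler_normD (L - q n) (q n); rewrite subrK; lra.
have bV : Oh (fun n => (q n)^-1) (fun=> 1).
  exists (`|L| / 2)^-1; first by rewrite invr_ge0 ltW.
  apply: filterS qL => n hn; rewrite normr1 mulr1 normfV lef_pV2//.
  by rewrite posrE (lt_le_trans L2).
have : Oh (fun n => (q n - L) * (q n)^-1) (fun n => n%:R^-1).
  apply: Oh_near (OhM h bV); apply: nearW => n //.
  by rewrite mulr1.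
move=> /(OhZ (- L^-1)); apply: Oh_eq; apply: filterS qL => n hn.
have q0 : q n != 0 by rewrite -normr_gt0 (lt_le_trans L2).
by field; rewrite q0 L0.
Qed.

End Oh.

Local Opaque Gamma.

Section GammaRatio.
Variable R : realType.
Implicit Types (x y s : R).

Definition gamma_ratio x n : R := Gamma (x + n%:R) / (Gamma n%:R * n%:R `^ x).

(** [Gamma_le_powR] from [n] to [n + s] gives one side; from [n + s] to [n + 1],
    with exponent [1 - s], it gives the other. *)
Lemma gamma_ratio_rate01 s : 0 <= s <= 1 -> rate1 (gamma_ratio s) 1.
Proof.
move=> s01; have /andP[s0 s1] := s01.
apply: Oh_le; near=> n.
have n0 : 0 < n%:R :> R by rewrite ltr0n; near: n; exact: nbhs_infty_gt.
have Gn := Gamma_gt0 n0.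
have Gsn : 0 < Gamma (s + n%:R) by apply: Gamma_gt0; lra.
have ps : 0 < n%:R `^ s by rewrite powR_gt0.
have ns0 : 0 < n%:R + s by rewrite ltr_wpDr.
have up : gamma_ratio s n <= 1.
  rewrite /gamma_ratio ler_pdivrMr; last exact: mulr_gt0.
  rewrite mul1r [Gamma _ * _]mulrC [s + _]addrC; exact: Gamma_le_powR.
have lo : n%:R / (n%:R + s) <= gamma_ratio s n.
  have s01' : 0 <= 1 - s <= 1 by rewrite subr_ge0 s1 lerBlDr lerDl.
  have := Gamma_le_powR ns0 s01'.
  rewrite (_ : n%:R + s + (1 - s) = n%:R + 1); last by ring.
  rewrite GammaD1; last exact: n0.
  have : (n%:R + s) `^ (1 - s) * n%:R `^ s <= n%:R + s.
    apply: (@le_trans _ _ ((n%:R + s) `^ (1 - s) * (n%:R + s) `^ s)).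
      apply: ler_wpM2l; first exact: powR_ge0.
      have le1 : n%:R <= n%:R + s by rewrite lerDl.
      by apply: (ge0_ler_powR s0 _ _ le1); rewrite nnegrE; exact: ltW.
    rewrite -powRD; last by rewrite (gt_eqF ns0) implybT.
    by rewrite subrK powRr1// ltW.
  rewrite /gamma_ratio [s + n%:R]addrC; rewrite [s + n%:R]addrC in Gsn.
  move: Gn Gsn ps (powR_ge0 (n%:R + s) (1 - s)) ns0.
  move: (n%:R + s) (Gamma n%:R) (Gamma (n%:R + s)) (n%:R `^ s) ((n%:R + s) `^ (1 - s)) => N g A p P.
  move=> g0 A0 p0 P0 N0 h1 h2.
  rewrite ler_pdivlMr; last exact: mulr_gt0.
  rewrite mulrAC ler_pdivrMr; last exact: N0.
  rewrite mulrA (le_trans (ler_wpM2r (ltW p0) h2))//.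
  by rewrite [P * A]mulrC -mulrA ler_wpM2l// ltW.
have : 1 - s / n%:R <= n%:R / (n%:R + s).
  rewrite ler_pdivlMr; last exact: ns0.
  rewrite mulrDl mul1r mulNr mulrDr divfK; last by rewrite gt_eqF.
  have : 0 <= s / n%:R * s by rewrite mulr_ge0// divr_ge0// ltW.
  by move: (s / n%:R * s) (n%:R) => X N; lra.
have sn : s / n%:R <= n%:R^-1 by rewrite ler_piMl// invr_ge0 ltW.
rewrite ler_norml => lo'.
move: up lo lo' sn; move: (n%:R^-1) (gamma_ratio s n) (n%:R / (n%:R + s)) (s / n%:R) => Z G X Y.
by move=> *; apply/andP; split; lra.
Unshelve. all: by end_near. Qed.

Lemma gamma_ratioD1 x n : (0 < n)%N -> 0 <= x ->
  gamma_ratio (x + 1) n = gamma_ratio x n * (1 + x * n%:R^-1).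
Proof.
rewrite -(ltr0n R) => n0 x0; rewrite /gamma_ratio addrAC GammaD1; last by lra.
rewrite powRD; last by rewrite (gt_eqF n0) implybT.
rewrite powRr1; last exact: ltW.
have Gxn : 0 < Gamma (x + n%:R) by apply: Gamma_gt0; exact: ltr_wpDl.
move: n0 Gxn (Gamma_gt0 n0) (powR_gt0 x n0).
move: (n%:R) (Gamma (x + n%:R)) (Gamma n%:R) (n%:R `^ x) => d a b c d0 a0 b0 c0.
by clear -a0 b0 c0 d0; field; rewrite !gt_eqF.
Qed.

Lemma gamma_ratio_rate x : 0 <= x -> rate1 (gamma_ratio x) 1.
Proof.
move=> x0; have /andP[h1 h2] := truncn_itv x0.
move: h1 h2; set m := Num.truncn x => h1 h2; pose s := x - m%:R.
have s01 : 0 <= s <= 1 by rewrite /s -natr1 in h2 *; apply/andP; split; lra.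
have -> : x = s + m%:R by rewrite /s subrK.
move: {h1 h2} (m) => k; elim: k => [|k IH]; first by rewrite addr0; exact: gamma_ratio_rate01.
have /andP[s0 _] := s01.
have sk0 : 0 <= s + k%:R by apply: (addr_ge0 s0).
apply: (@rate1_eq _ (fun n => gamma_ratio (s + k%:R) n * (1 + (s + k%:R) * n%:R^-1))).
  near=> n; rewrite -natr1 addrA gamma_ratioD1; [by []| |exact: sk0].
  by near: n; exact: nbhs_infty_gt.
rewrite -[X in rate1 _ X](mulr1 1); apply: rate1M => //.
rewrite -[X in rate1 _ X](addr0 1); apply: rate1D; first exact: rate1_cst.
have : Oh (fun n => (s + k%:R) * n%:R^-1 : R) (fun n => n%:R^-1) by apply: OhZ; exact: Oh_refl.
by apply: Oh_eq; apply: nearW => n; rewrite subr0.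
Unshelve. all: by end_near. Qed.

Lemma pochE_Gamma x n : 0 < x -> poch x n = Gamma (x + n%:R) / Gamma x.
Proof.
move=> x0; have Gx := Gamma_gt0 x0.
elim: n => [|n IH]; first by rewrite poch0 addr0 divff// gt_eqF.
rewrite pochS IH -natr1 addrA GammaD1; last by rewrite ltr_wpDr.
by rewrite mulrC mulrA.
Qed.

Lemma poch_ratio_rate x y : 0 < x -> 0 < y ->
  rate1 (fun n => poch x n / poch y n * n%:R `^ (y - x)) (Gamma y / Gamma x).
Proof.
move=> x0 y0; have Gx := Gamma_gt0 x0; have Gy := Gamma_gt0 y0.
apply: (@rate1_eq _ (fun n => Gamma y / Gamma x * (gamma_ratio x n * (gamma_ratio y n)^-1))).
  near=> n.
  have n0 : 0 < n%:R :> R by rewrite ltr0n; near: n; exact: nbhs_infty_gt.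
  have Gn := Gamma_gt0 n0.
  have Gxn : 0 < Gamma (x + n%:R) by apply: Gamma_gt0; exact: addr_gt0.
  have Gyn : 0 < Gamma (y + n%:R) by apply: Gamma_gt0; exact: addr_gt0.
  rewrite !pochE_Gamma; [|exact: y0|exact: x0]; rewrite /gamma_ratio.
  rewrite powRB; last by rewrite (gt_eqF n0) implybT.
  have px := powR_gt0 x n0; have py := powR_gt0 y n0.
  move: Gn Gxn Gyn px py Gx Gy.
  move: (Gamma n%:R) (Gamma (x + n%:R)) (Gamma (y + n%:R)) (n%:R `^ x) (n%:R `^ y) (Gamma x) (Gamma y).
  move=> a b c d e f g a0 b0 c0 d0 e0 f0 g0; clear -a0 b0 c0 d0 e0 f0 g0.
  by field; rewrite !gt_eqF.
rewrite -[X in rate1 _ X]mulr1; apply: rate1M; first exact: rate1_cst.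
rewrite -[X in rate1 _ X](mulr1 1) -[X in rate1 _ (_ * X)]invr1; apply: rate1M.
  exact: gamma_ratio_rate (ltW x0).
by apply: rate1V; [rewrite oner_eq0|exact: gamma_ratio_rate (ltW y0)].
Unshelve. all: by end_near. Qed.

Definition duplication_ratio x : R := 2 `^ (2 * x) * Gamma x * Gamma (x + 1 / 2) / Gamma (2 * x).

Lemma duplication_ratioD1 x : 0 < x -> duplication_ratio (x + 1) = duplication_ratio x.
Proof.
move=> x0; have Gx := Gamma_gt0 x0.
have x2 : 0 < 2 * x by lra.
have xh : 0 < x + 1 / 2 by lra.
have x21 : 0 < 2 * x + 1 by lra.
have Gh := Gamma_gt0 xh.
have G2 := Gamma_gt0 x2.
rewrite /duplication_ratio (_ : 2 * (x + 1) = 2 * x + 1 + 1); last by ring.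
rewrite (_ : x + 1 + 1 / 2 = x + 1 / 2 + 1); last by ring.
rewrite (GammaD1 x0) (GammaD1 xh) (GammaD1 x21) (GammaD1 x2).
rewrite -!addrA powRD ?(pnatr_eq0 R 2) ?implybT// (_ : 1 + 1 = 2%:R)// powR_mulrn//.
move: G2 x0; move: (Gamma x) (Gamma (2 * x)) (Gamma (x + 1 / 2)) (2 `^ (2 * x)) => b a c d a0 x0.
by clear -a0 x0; field; rewrite (gt_eqF a0) /=; lra.
Qed.

Lemma duplication_ratioDn x n : 0 < x -> duplication_ratio (x + n%:R) = duplication_ratio x.
Proof.
move=> x0; elim: n => [|n IH]; first by rewrite addr0.
rewrite -natr1 addrA duplication_ratioD1; first exact: IH.
exact: ltr_wpDr.
Qed.

(** The ratio has period 1, and along [z + n] it is asymptotic to an expression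
    that does not involve [z]. *)
Lemma duplication_ratio_eq x y : 0 < x -> 0 < y -> duplication_ratio x = duplication_ratio y.
Proof.
(* The common limit, in which [z] does not occur. *)
pose T n : R := 2 `^ (2 * n%:R) * Gamma n%:R ^+ 2 * n%:R `^ (1 / 2) / Gamma (2 * n%:R).
suff cT z : 0 < z -> T n @[n --> \oo] --> duplication_ratio z.
  by move=> x0 y0; exact: cvg_unique (cT _ x0) (cT _ y0).
move=> z0; have z2 : 0 < 2 * z by lra.
have zh : 0 < z + 1 / 2 by lra.
pose q n := gamma_ratio z n * gamma_ratio (z + 1 / 2) n * (gamma_ratio (2 * z) (2 * n))^-1.
have q1 : q n @[n --> \oo] --> (1 : R).
  rewrite (_ : 1 = 1 * 1 * 1^-1 :> R); last by rewrite invr1 !mulr1.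
  apply: cvgM.
    by apply: cvgM; apply: rate1_cvg; apply: gamma_ratio_rate; exact: ltW.
  apply: cvgV; first by rewrite oner_eq0.
  have c2 := rate1_cvg (gamma_ratio_rate (ltW z2)).
  apply: (cvg_comp (fun n => (2 * n)%N) _ _ c2).
  apply/cvgnyPge => N; near=> n.
  by rewrite (@leq_trans n)// ?leq_pmull//; near: n; exact: nbhs_infty_ge.
have : duplication_ratio z * (q n)^-1 @[n --> \oo] --> duplication_ratio z.
  rewrite [X in _ --> X](_ : _ = duplication_ratio z * 1^-1); last by rewrite invr1 mulr1.
  apply: cvgMl_tmp.
  by apply: cvgV => //; rewrite oner_eq0.
apply: cvg_trans; apply: near_eq_cvg; near=> n.
have n0 : 0 < n%:R :> R by rewrite ltr0n; near: n; exact: nbhs_infty_gt.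
rewrite -(duplication_ratioDn n z0) /duplication_ratio /q /T /gamma_ratio natrM.
rewrite (_ : z + n%:R + 1 / 2 = z + 1 / 2 + n%:R); last by rewrite addrAC.
rewrite mulrDr.
have n20 : 0 < 2 * n%:R :> R by rewrite mulr_gt0.
have nz (a : R) (r : R) : 0 < a -> (r == 0) ==> (a != 0) by move=> a0; rewrite (gt_eqF a0) implybT.
rewrite (powRM _ (ler0n R 2) (ltW n0)) powRD; last exact: nz.
rewrite [n%:R `^ (z + 1 / 2)]powRD; last exact: nz.
rewrite (_ : n%:R `^ (2 * z) = n%:R `^ z * n%:R `^ z); last first.
  by rewrite -powRD; [congr (_ `^ _); ring|exact: nz].
have g1 : 0 < Gamma (z + n%:R) by apply: Gamma_gt0; exact: addr_gt0.
have g2 : 0 < Gamma (z + 1 / 2 + n%:R) by apply: Gamma_gt0; exact: addr_gt0.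
have g3 : 0 < Gamma (2 * z + 2 * n%:R) by apply: Gamma_gt0; exact: addr_gt0.
have g4 := Gamma_gt0 n0; have g5 := Gamma_gt0 n20.
have p1 := powR_gt0 z n0; have p2 := powR_gt0 (1 / 2) n0.
have p3 : 0 < 2 `^ (2 * z) :> R by rewrite powR_gt0.
have p4 : 0 < 2 `^ (2 * n%:R) :> R by rewrite powR_gt0.
move: g1 g2 g3 g4 g5 p1 p2 p3 p4.
move: (Gamma (z + n%:R)) (Gamma (z + 1 / 2 + n%:R)) (Gamma (2 * z + 2 * n%:R)) (Gamma n%:R)
  (Gamma (2 * n%:R)) (n%:R `^ z) (n%:R `^ (1 / 2)) (2 `^ (2 * z)) (2 `^ (2 * n%:R)).
move=> a b c d e f g h i a0 b0 c0 d0 e0 f0 g0 h0 i0; clear -a0 b0 c0 d0 e0 f0 g0 h0 i0.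
by field; rewrite !gt_eqF.
Unshelve. all: by end_near. Qed.

End GammaRatio.

(** * The digamma function as a limit of harmonic sums *)

Definition harmonic_sum (R : realType) (x : R) n : R := \sum_(k < n) (x + k%:R)^-1.

Section Digamma.
Variable R : realType.
Implicit Types (x y s h a b : R).

Local Notation H := harmonic_sum.

Lemma ln_le_subr1 a : 0 < a -> ln a <= a - 1.
Proof.
by move=> a0; have := @le_ln1Dx R (a - 1); rewrite [1 + _]addrC subrK; apply; lra.
Qed.

Lemma ln_sub_le a b : 0 < a -> 0 < b -> ln b - ln a <= (b - a) / a.
Proof.
move=> a0 b0; rewrite -ln_div ?posrE// mulrBl divff ?gt_eqF//.
by apply: ln_le_subr1; exact: divr_gt0.
Qed.

Lemma ln_sub_ge a b : 0 < a -> 0 < b -> (b - a) / b <= ln b - ln a.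
Proof.
move=> a0 b0; have := ln_sub_le b0 a0; rewrite -(opprB b a) mulNr.
by rewrite -[ln a - _]opprB lerN2.
Qed.

(** [ln (x + n) - harmonic_sum x n] decreases and becomes increasing when one more
    reciprocal is subtracted; such adjacent sequences have a common limit, at
    distance at most [1 / (x + n)]. *)
Lemma harmonic_sum_cvg x : 0 < x ->
  exists l, forall n, `|ln (x + n%:R) - H x n - l| <= (x + n%:R)^-1.
Proof.
move=> x0; pose S n := ln (x + n%:R) - H x n.
pose T n := S n - (x + n%:R)^-1.
have xn n : 0 < x + n%:R by rewrite ltr_wpDr.
have E n : x + n.+1%:R - (x + n%:R) = 1 by rewrite -natr1; ring.
have Sd n : S n.+1 <= S n.
  have := ln_sub_le (xn n) (xn n.+1); rewrite E mul1r /S /H big_ord_recr /=.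
  by move: (\sum_(_ < _) _) (ln _) (ln _) (_^-1) => A B C D; lra.
have Ti n : T n <= T n.+1.
  have := ln_sub_ge (xn n) (xn n.+1); rewrite E mul1r /T /S /H big_ord_recr /=.
  move: (\sum_(_ < _) _) (ln _) (ln _) => A B C.
  by move: ((x + n%:R)^-1) ((x + n.+1%:R)^-1) => D F; lra.
have TS n : T n <= S n by rewrite /T gerBl invr_ge0 (ltW (xn n)).
have Sm := (nonincreasing_seqP S).1 Sd; have Tm := (nondecreasing_seqP T).1 Ti.
have TSm m n : T m <= S n.
  have [mn|/ltnW nm] := leqP m n; first exact: le_trans (Tm _ _ mn) (TS _).
  exact: le_trans (TS _) (Sm _ _ nm).
have Sc : cvgn S.
  by apply: nonincreasing_is_cvgn => //; exists (T 0%N) => _ [n _ <-]; exact: TSm.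
exists (limn S) => n; rewrite -/(S n).
have h1 := nonincreasing_cvgn_ge Sm Sc n.
have h2 : T n <= limn S by apply: limr_ge => //; apply: nearW => m; exact: TSm.
rewrite /T lerBlDr in h2.
by rewrite ger0_norm ?subr_ge0// lerBlDl.
Qed.

Definition lnGamma x : R := ln (Gamma x).

Lemma lnGammaD1 x : 0 < x -> lnGamma (x + 1) = ln x + lnGamma x.
Proof. by move=> x0; rewrite /lnGamma GammaD1// lnM ?posrE ?Gamma_gt0. Qed.

Lemma lnGammaDn x n : 0 < x ->
  lnGamma (x + n%:R) = lnGamma x + \sum_(k < n) ln (x + k%:R).
Proof.
move=> x0; elim: n => [|n IH]; first by rewrite addr0 big_ord0 addr0.
rewrite -natr1 addrA lnGammaD1; last exact: ltr_wpDr.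
rewrite IH big_ord_recr /= addrCA; congr (_ + _); exact: addrC.
Qed.

Lemma lnGamma_le y s : 0 < y -> 0 <= s <= 1 ->
  lnGamma (y + s) <= s * ln y + lnGamma y.
Proof.
move=> y0 s01; have /andP[s0 s1] := s01.
have G1 : 0 < Gamma (y + s) by apply: Gamma_gt0; exact: ltr_wpDr.
have G2 := Gamma_gt0 y0; have p := powR_gt0 s y0.
rewrite -ln_powR /lnGamma -lnM; [|exact: p|exact: G2].
rewrite ler_ln; [exact: Gamma_le_powR|exact: G1|].
by rewrite posrE; exact: mulr_gt0.
Qed.

(** Wendel's inequalities. *)
Lemma lnGamma_wendel y s : 0 < y -> 0 <= s <= 1 ->
  `|lnGamma (y + s) - lnGamma y - s * ln y| <= s / y.
Proof.
move=> y0 s01; have /andP[s0 s1] := s01.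
have ys0 : 0 < y + s by rewrite ltr_wpDr.
have up := lnGamma_le y0 s01.
have s01' : 0 <= 1 - s <= 1 by rewrite subr_ge0 s1 lerBlDr lerDl.
have lo : lnGamma y + ln y <= (1 - s) * ln (y + s) + lnGamma (y + s).
  have := lnGamma_le ys0 s01'; rewrite (_ : y + s + (1 - s) = y + 1); last by ring.
  by rewrite lnGammaD1 1?[ln y + _]addrC.
have := ln_sub_le y0 ys0; have := ln_sub_ge y0 ys0.
rewrite [y + s]addrC addrK; rewrite [y + s]addrC in up lo.
have : 0 <= s / (s + y) by rewrite divr_ge0// addr_ge0// ltW.
have : 0 <= s / y by rewrite divr_ge0// ltW.
move: up lo; move: (lnGamma y) (lnGamma (s + y)) (ln y) (ln (s + y)) (s / y) (s / (s + y)).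
move=> A B C D E F h1 h2 h3 h4 h5 h6; clear - s0 s1 h1 h2 h3 h4 h5 h6.
rewrite ler_norml; apply/andP; split; nra.
Qed.

(** The two-sided version; a negative increment is a positive one from [y + h], and
    [y - 1] bounds [y + h] from below. *)
Lemma lnGamma_step y h : 1 < y -> `|h| <= 1 ->
  `|lnGamma (y + h) - lnGamma y - h * ln y| <= 2 * `|h| / (y - 1).
Proof.
move=> y1 h1; have y0 : 0 < y by apply: lt_trans y1.
have y10 : 0 < y - 1 by rewrite subr_gt0.
have [h0|h0] := leP 0 h.
  rewrite ger0_norm// in h1; rewrite [`|h|]ger0_norm//.
  have s01 : 0 <= h <= 1 by rewrite h0 h1.
  apply: le_trans (lnGamma_wendel y0 s01) _.
  rewrite ler_pdivrMr// mulrAC ler_pdivlMr//.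
  by clear - h0 y1; nra.
have hN : 0 <= - h by rewrite oppr_ge0 ltW.
rewrite ltr0_norm// in h1; rewrite [`|h|]ltr0_norm//.
have yh : 0 < y + h by clear - y1 h1; lra.
have s01 : 0 <= - h <= 1 by rewrite hN h1.
have := lnGamma_wendel yh s01; rewrite addrK => b1.
have b2 : - h * (ln y - ln (y + h)) <= - h / (y + h).
  rewrite ler_wpM2l//; apply: le_trans (ln_sub_le yh y0) _.
  rewrite opprD addrA subrr sub0r -[leRHS]mul1r.
  by apply: ler_wpM2r; [rewrite invr_ge0 ltW|exact: h1].
have b3 : 0 <= - h * (ln y - ln (y + h)).
  by rewrite mulr_ge0// subr_ge0 ler_ln ?posrE//; clear - h0; lra.
have b4 : - h / (y + h) <= - h / (y - 1).
  rewrite ler_wpM2l// lef_pV2 ?posrE//; clear - h1; lra.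
rewrite -[2 * - h / _]mulrA.
move: b1 b2 b3 b4; rewrite ler_norml => /andP[].
move: (lnGamma y) (lnGamma (y + h)) (ln y) (ln (y + h)) (- h / (y + h)) (- h / (y - 1)).
move=> A B C D E F c1 c2 c3 c4 c5; clear - c1 c2 c3 c4 c5.
rewrite ler_norml; apply/andP; split; nra.
Qed.

Lemma ln_sub_taylor a h : 0 < a -> `|h| <= a / 2 ->
  `|ln (a + h) - ln a - h / a| <= 2 * h ^+ 2 / a ^+ 2.
Proof.
move=> a0; rewrite ler_norml => /andP[h1 h2].
have ah : 0 < a + h by clear - a0 h1; lra.
have up := ln_sub_le a0 ah; have lo := ln_sub_ge a0 ah.
rewrite [a + h]addrC addrK in up lo.
have b1 : h / a - h / (h + a) <= 2 * h ^+ 2 / a ^+ 2.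
  have -> : h / a - h / (h + a) = h ^+ 2 / (a * (h + a)).
    by field; rewrite !gt_eqF// addrC.
  rewrite ler_pdivrMr ?mulr_gt0 1?addrC// mulrAC ler_pdivlMr ?exprn_gt0//.
  have : 0 <= h ^+ 2 by exact: sqr_ge0.
  move: (h ^+ 2) => H2 H0; rewrite [2 * H2]mulrC -[H2 * 2 * _]mulrA.
  apply: ler_wpM2l => //; rewrite expr2; clear - a0 h1; nra.
have b2 : 0 <= 2 * h ^+ 2 / a ^+ 2 by apply: divr_ge0; [apply: mulr_ge0 => //|]; exact: sqr_ge0.
rewrite [a + h]addrC.
move: b1 b2 up lo; move: (ln _) (ln _) (h / a) (h / (h + a)) (2 * _ / _).
move=> A B C D E b1 b2 up lo; clear - b1 b2 up lo.
rewrite ler_norml; apply/andP; split; lra.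
Qed.

(** The functional equation moves the increment quotient from [x] to [x + n], where
    Wendel's inequalities determine it up to [O(1/n)], at the price of finitely
    many logarithms, which are differentiable. *)
Lemma is_derive_lnGamma x l : 0 < x ->
  (forall n, `|ln (x + n%:R) - H x n - l| <= (x + n%:R)^-1) ->
  is_derive x (1 : R) lnGamma l.
Proof.
move=> x0 hl.
(* The error [1/n] comes from the far increment, the one in [h] from the
   logarithms; so [n] is chosen before [h]. *)
have main (n : nat) h : (0 < n)%N -> `|h| <= 1 -> `|h| <= x / 2 ->
    `|lnGamma (x + h) - lnGamma x - h * l| <=
      `|h| * (3 / n%:R + n.+1%:R * (2 / x ^+ 2) * `|h|).
  move=> n0 h1 hx; pose y := x + n.+1%:R.
  have n0' : 0 < n%:R :> R by rewrite ltr0n.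
  have yn : n%:R <= y - 1 by rewrite /y -natr1 addrA addrK lerDr ltW.
  have y1 : 1 < y by rewrite -subr_gt0 (lt_le_trans n0').
  have y0 : 0 < y by apply: lt_trans y1.
  have xh : 0 < x + h.
    by move: hx; rewrite ler_norml => /andP[hx _]; clear - x0 hx; lra.
  have s1 := lnGamma_step y1 h1.
  have s2 : `|h * (ln y - H x n.+1 - l)| <= `|h| * n%:R^-1.
    rewrite normrM ler_wpM2l//; apply: le_trans (hl n.+1) _.
    rewrite -/y lef_pV2 ?posrE//; apply: le_trans yn _.
    by rewrite gerBl.
  have s3 : `|\sum_(k < n.+1) (ln (x + k%:R + h) - ln (x + k%:R) - h / (x + k%:R))|
     <= n.+1%:R * (2 / x ^+ 2) * `|h| * `|h|.
    apply: le_trans (ler_norm_sum _ _ _) _.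
    apply: (@le_trans _ _ (\sum_(k < n.+1) 2 / x ^+ 2 * `|h| * `|h|)); last first.
      by rewrite sumr_const card_ord -[_ *+ n.+1]mulr_natl !mulrA.
    apply: ler_sum => k _.
    have xk : x <= x + k%:R by rewrite lerDl.
    have xk0 : 0 < x + k%:R by apply: lt_le_trans xk.
    apply: (@le_trans _ _ (2 * h ^+ 2 / (x + k%:R) ^+ 2)).
      apply: ln_sub_taylor => //; apply: le_trans hx _.
      by rewrite ler_wpM2r// invr_ge0.
    have hh : `|h| * `|h| = h ^+ 2 by rewrite -expr2 real_normK// num_real.
    rewrite -[2 / x ^+ 2 * _ * _]mulrA hh mulrAC.
    apply: ler_wpM2r; first exact: sqr_ge0.
    apply: ler_wpM2l => //; rewrite lef_pV2 ?posrE ?exprn_gt0//.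
    by rewrite ler_sqr ?nnegrE// ltW.
  have E : lnGamma (x + h) - lnGamma x - h * l =
     (lnGamma (y + h) - lnGamma y - h * ln y) + h * (ln y - H x n.+1 - l)
     - \sum_(k < n.+1) (ln (x + k%:R + h) - ln (x + k%:R) - h / (x + k%:R)).
    have e1 := lnGammaDn n.+1 xh; have e2 := lnGammaDn n.+1 x0.
    rewrite -/y in e2; rewrite (_ : x + h + n.+1%:R = y + h) in e1; last by rewrite /y addrAC.
    rewrite e1 e2 !sumrB -mulr_sumr -/(H x n.+1).
    rewrite (_ : \sum_(k < n.+1) ln (x + h + k%:R) = \sum_(k < n.+1) ln (x + k%:R + h)).
      move: (lnGamma x) (lnGamma (x + h)) (\sum_(k < _) _) (\sum_(k < _) _) (ln y) (H _ _).
      by move=> A B C D E F; clear; ring.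
    by apply: eq_bigr => k _; rewrite addrAC.
  rewrite E; apply: le_trans (ler_normB _ _) _.
  have s12 : 2 * `|h| / (y - 1) <= `|h| * (2 / n%:R).
    rewrite [2 * _]mulrC -mulrA ler_wpM2l// ler_wpM2l// lef_pV2 ?posrE//.
    exact: lt_le_trans yn.
  apply: le_trans (lerD (ler_normD _ _) s3) _.
  apply: le_trans (lerD (lerD (le_trans s1 s12) s2) (lexx _)) _.
  rewrite le_eqVlt; apply/orP; left; apply/eqP; field.
  by rewrite !gt_eqF.
have lim : h^-1 *: (lnGamma (h *: 1 + x) - lnGamma x) @[h --> 0^'] --> l.
  apply/cvgrPdist_le => e e0.
  have [n ne] : exists n, 6 / e <= n.+1%:R.
    by exists (Num.truncn (6 / e)); rewrite ltW// truncnS_gt.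
  pose c := n.+2%:R * (2 / x ^+ 2).
  have c0 : 0 < c by rewrite mulr_gt0// divr_gt0// exprn_gt0.
  near=> h.
  have h0 : h != 0 by near: h; exact: nbhs_dnbhs_neq.
  have h1 : `|h| <= 1 by near: h; exact: dnbhs0_le.
  have h2 : `|h| <= x / 2.
    by near: h; apply: dnbhs0_le; rewrite divr_gt0.
  have h3 : `|h| <= e / (2 * c).
    by near: h; apply: dnbhs0_le; rewrite divr_gt0// mulr_gt0.
  have := main n.+1 h isT h1 h2.
  rewrite [h *: 1]mulr1 [h + x]addrC.
  have hn0 : 0 < `|h| by rewrite normr_gt0.
  have -> : l - h^-1 *: (lnGamma (x + h) - lnGamma x) =
     - h^-1 * (lnGamma (x + h) - lnGamma x - h * l).
    rewrite /GRing.scale /=; move: (lnGamma _) (lnGamma _) => A B.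
    by clear - h0; field.
  move=> b; rewrite normrM normrN normfV mulrC ler_pdivrMr// [e * _]mulrC.
  apply: le_trans b _; apply: ler_wpM2l => //.
  have t1 : 3 / n.+1%:R <= e / 2.
    rewrite ler_pdivrMr//; move: ne; rewrite ler_pdivrMr//.
    by move: (n.+1%:R) => N ne; clear - ne; nra.
  have t2 : c * `|h| <= e / 2.
    rewrite mulrC -ler_pdivlMr//; apply: le_trans h3 _.
    by rewrite invfM mulrA.
  by rewrite [e]splitr; exact: lerD t1 t2.
apply: DeriveDef; first by apply/cvg_ex; exists l.
by apply: cvg_lim.
Unshelve. all: by end_near. Qed.

Lemma harmonic_sum_digamma x : 0 < x ->
  rate1 (fun n => H x n - ln n%:R) (- digamma x).
Proof.
move=> x0; have [l hl] := harmonic_sum_cvg x0.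
have dl := is_derive_lnGamma x0 hl.
have Gx := Gamma_gt0 x0.
have dG : is_derive x (1 : R) (@Gamma R) (Gamma x * l).
  have d := is_derive1_comp (is_derive_expR (lnGamma x)) dl.
  have e : expR (lnGamma x) = Gamma x by rewrite lnK// posrE.
  rewrite e in d; apply: near_eq_is_derive d.
  near=> y; have y0 : 0 < y by near: y; exact: lt_nbhsr.
  by rewrite /= lnK// posrE Gamma_gt0.
have -> : digamma x = l.
  rewrite /digamma derive1E; case: dG => _ ->.
  by rewrite mulrC mulKf// gt_eqF.
apply: (@Oh_trans _ _ (fun n => (x + 1) * n%:R^-1)); last first.
  by apply: OhZ; exact: Oh_refl.
apply: Oh_le; near=> n.
have n0 : 0 < n%:R :> R by rewrite ltr0n; near: n; exact: nbhs_infty_gt.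
have xn : 0 < x + n%:R by apply: addr_gt0.
have := hl n; have := ln_sub_le n0 xn.
have : 0 <= ln (x + n%:R) - ln n%:R.
  by rewrite subr_ge0 ler_ln ?posrE// lerDr ltW.
rewrite [x + n%:R - n%:R]addrK.
have : (x + n%:R)^-1 <= n%:R^-1 by rewrite lef_pV2 ?posrE// lerDr ltW.
move: (H x n) (ln _) (ln _) ((x + n%:R)^-1) => A B C D.
rewrite mulrDl mul1r; move: (x / n%:R) (n%:R^-1) => E F.
rewrite !ler_norml => h1 h2 h3 /andP[h4 h5]; clear - h1 h2 h3 h4 h5.
by apply/andP; split; lra.
Unshelve. all: by end_near. Qed.

End Digamma.

(** * The total mass of the weight *)

Section WeightIntegral.
Variable R : realType.
Notation mu := (@lebesgue_measure R).
Implicit Types s x y : R.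

Definition weight s x : R := (1 - x ^+ 2) `^ (s - 1 / 2).

(** The parameter is shifted by [1 / 2] so as to match the weight of
    [weighted_sq_integral]. *)
Definition weight_integral s : R := \int[mu]_(x in `[-1, 1]%classic) weight s x.

Local Notation B := (`](-1)%R, 1%R[%classic : set R).
Local Notation Bc := (`[(-1)%R, 1%R]%classic : set R).
Local Notation bd n := (1 - n.+2%:R^-1 : R).

Lemma sqr_lt1_itv x : B x -> 0 < 1 - x ^+ 2.
Proof. by rewrite /= in_itv /= => /andP[h1 h2]; nra. Qed.

Lemma itvN11_exhaustion : B = \bigcup_n `[- bd n, bd n]%classic.
Proof.
apply/seteqP; split=> x /=.
  rewrite in_itv /= => xB; have x1 : 0 < 1 - `|x| by rewrite subr_gt0 ltr_norml.
  pose t := (1 - `|x|)^-1; have t0 : 0 < t by rewrite invr_gt0.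
  exists (Num.truncn t) => //=; rewrite in_itv /= -ler_norml.
  rewrite lerBrDr -lerBrDl -[leRHS]invrK lef_pV2 ?posrE ?ltr0n//.
  by rewrite (le_trans (ltW (truncnS_gt t)))// ler_nat.
case=> n _ /=; rewrite !in_itv /= => /andP[h1 h2].
have : 0 < n.+2%:R^-1 :> R by rewrite invr_gt0.
by move: (n.+2%:R^-1) h1 h2 => d h1 h2 h; apply/andP; split; lra.
Qed.

Lemma weight_ge0 s x : 0 <= weight s x. Proof. exact: powR_ge0. Qed.

Lemma weight_half x : weight (1 / 2) x = 1.
Proof. by rewrite /weight subrr powRr0. Qed.

Lemma weightD1 s x : B x -> weight (s + 1) x = weight s x * (1 - x ^+ 2).
Proof.
move=> /sqr_lt1_itv h; rewrite /weight -{3}(powRr1 (ltW h)).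
by rewrite -powRD; [congr (_ `^ _); ring|rewrite (gt_eqF h) implybT].
Qed.

Lemma continuous_weight s x : B x -> {for x, continuous (weight s)}.
Proof.
move=> /sqr_lt1_itv h; apply: (@continuous_comp _ _ _ (fun x => 1 - x ^+ 2) (fun u => u `^ (s - 1 / 2))).
  apply: cvgB; [exact: cvg_cst|exact: exprn_continuous].
exact: continuous_powR.
Qed.

Lemma measurable_weight s (D : set R) : measurable_fun D (EFin \o weight s).
Proof.
apply/measurable_EFinP/measurable_funTS.
apply: (@measurableT_comp _ _ _ _ _ _ (fun u : R => u `^ (s - 1 / 2))).
  exact: measurable_powR.
by apply: measurable_funB.
Qed.

Lemma weight_itv s : (\int[mu]_(x in Bc) (weight s x)%:E =
  \int[mu]_(x in B) (weight s x)%:E)%E.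
Proof. by rewrite integral_itv_bndoo//; exact: measurable_weight. Qed.

Lemma weight_integralZ c s : 0 <= c ->
  (\int[mu]_(x in B) (c * weight s x)%:E = c%:E * \int[mu]_(x in B) (weight s x)%:E)%E.
Proof.
move=> c0; rewrite -ge0_integralZl_EFin; [by []|exact: measurable_itv| | |exact: c0].
- by move=> x _; rewrite lee_fin weight_ge0.
- exact: measurable_weight.
Qed.

(** The derivative of [x (1 - x^2)^(s + 1/2)], which vanishes at both ends, is the
    difference of the two integrands. *)
Lemma weight_integral_recE s : - (1 / 2) < s ->
  ((2 * s + 2)%:E * \int[mu]_(x in B) (weight (s + 1) x)%:E =
   (2 * s + 1)%:E * \int[mu]_(x in B) (weight s x)%:E)%E.
Proof.
move=> s0; have c2 : 0 <= 2 * s + 2 by lra.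
have c1 : 0 <= 2 * s + 1 by lra.
have ph : 0 < s + 1 / 2 by lra.
have dF x : B x -> is_derive x (1 : R) (fun y => y * (1 - y ^+ 2) `^ (s + 1 / 2))
    ((2 * s + 2) * weight (s + 1) x - (2 * s + 1) * weight s x).
  move=> Bx; have x0 := sqr_lt1_itv Bx.
  have dp : is_derive x (1 : R) (fun y : R => 1 - y ^+ 2) (- (2 * x)).
    pose p : {poly R} := 1 - 'X ^+ 2.
    have -> : (fun y : R => 1 - y ^+ 2) = horner p by apply/funext => y; rewrite /p !hornerE.
    have := is_derive_poly p x => /is_derive_eq; apply.
    by rewrite /p !poly.derivE !hornerE /=; ring.
  have d1 := @is_derive1_comp R (fun u => u `^ (s + 1 / 2)) (fun y => 1 - y ^+ 2) x _ _
    (is_derive1_powR (s + 1 / 2) x0) dp.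
  have d2 := is_deriveM (is_derive_id x (1 : R)) d1.
  apply: (is_derive_eq d2); rewrite /GRing.scale /= weightD1// /weight.
  rewrite (_ : s + 1 / 2 - 1 = s - 1 / 2); last by field.
  have -> : (1 - x ^+ 2) `^ (s + 1 / 2) = (1 - x ^+ 2) `^ (s - 1 / 2) * (1 - x ^+ 2).
    rewrite -{3}(powRr1 (ltW x0)) -powRD; last by rewrite (gt_eqF x0) implybT.
    by congr (_ `^ _); field.
  by move: (_ `^ _) => W; field.
rewrite -!weight_integralZ; [|exact: c1|exact: c2].
rewrite -[RHS]adde0.
apply: (@FTC_ge0_exhaustion R (fun x => (2 * s + 2) * weight (s + 1) x)
   (fun x => (2 * s + 1) * weight s x) (fun y => y * (1 - y ^+ 2) `^ (s + 1 / 2))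
   (fun n => - bd n) (fun n => bd n) B 0 _ _ _ itvN11_exhaustion _ _ _ _ dF).
- move=> n; have : n.+2%:R^-1 < 1 :> R by rewrite invf_lt1// ltr1n.
  by move: (n.+2%:R^-1) => d; lra.
- by move=> n; rewrite lerN2 lerD2l lerN2 lef_pV2 ?posrE// ler_nat.
- by move=> n; rewrite lerD2l lerN2 lef_pV2 ?posrE// ler_nat.
- by move=> x _; rewrite mulr_ge0 ?weight_ge0.
- by move=> x _; rewrite mulr_ge0 ?weight_ge0.
- by move=> x Bx; apply: continuousM; [exact: cst_continuous|exact: continuous_weight].
- by move=> x Bx; apply: continuousM; [exact: cst_continuous|exact: continuous_weight].
- apply: (@squeeze_cvgr _ _ _ _ (fun=> 0) (fun n => 2 * 2 `^ (s + 1 / 2) * n.+2%:R^-1 `^ (s + 1 / 2))).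
  + apply: nearW => n; have n1 : n.+2%:R^-1 <= 1 :> R by rewrite invf_le1// ler1n.
    have n0 : 0 < n.+2%:R^-1 :> R by rewrite invr_gt0.
    rewrite sqrrN mulNr opprK.
    move: (n.+2%:R^-1) n0 n1 => d d0 d1.
    have dd : 0 <= 1 - (1 - d) ^+ 2 by clear - d0 d1; nra.
    have W0 := powR_ge0 (1 - (1 - d) ^+ 2) (s + 1 / 2).
    have W1 : (1 - (1 - d) ^+ 2) `^ (s + 1 / 2) <= 2 `^ (s + 1 / 2) * d `^ (s + 1 / 2).
      rewrite -powRM//; last exact: ltW.
      apply: ge0_ler_powR; rewrite ?nnegrE//; [exact: ltW|by rewrite mulr_ge0// ltW|].
      by clear - d0 d1; nra.
    rewrite -mulrA; move: W0 W1.
    move: ((1 - (1 - d) ^+ 2) `^ (s + 1 / 2)) (2 `^ (s + 1 / 2) * d `^ (s + 1 / 2)) => W V W0 W1.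
    by clear - d0 d1 W0 W1; apply/andP; split; nra.
  + exact: cvg_cst.
  + rewrite -[X in _ --> X](mulr0 (2 * 2 `^ (s + 1 / 2))); apply: cvgMl_tmp.
    by have := cvg_comp _ _ (@cvg_invn_at_right R) (powR_cvg0 ph).
Qed.

Lemma weight_integral_lty s : - (1 / 2) < s ->
  (\int[mu]_(x in B) (weight s x)%:E < +oo)%E.
Proof.
have E0 t : (0 <= \int[mu]_(x in B) (weight t x)%:E)%E.
  by apply: integral_ge0 => x _; rewrite lee_fin weight_ge0.
have big t : 1 / 2 <= t -> (\int[mu]_(x in B) (weight t x)%:E < +oo)%E.
  move=> t2; apply: (@le_lt_trans _ _ (\int[mu]_(x in B) (cst 1%E x))%E).
    apply: ge0_le_integral => //.
    - by move=> x _; rewrite lee_fin weight_ge0.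
    - exact: measurable_weight.
    - move=> x Bx; rewrite lee_fin /weight -[leRHS](powRr0 (1 - x ^+ 2)).
      apply: ger_powR; last by rewrite subr_ge0.
      by rewrite sqr_lt1_itv//= gerBl sqr_ge0.
  rewrite integral_cst//= mul1e lebesgue_measure_itv /=.
  by case: ifP => _; rewrite ?ltry.
move=> s0; have := weight_integral_recE s0.
have := big (s + 1); have := E0 s.
case: (\int[mu]_(x in B) (weight s x)%:E)%E => //.
  by move=> r _ _ _; rewrite ltry.
move=> _ b; have /b : 1 / 2 <= s + 1 by lra.
move=> fin E; move: E; rewrite gt0_muley; last by rewrite lte_fin; lra.
move=> E; exfalso; move: fin; have := E0 (s + 1).
move: E; case: (\int[mu]_(x in B) _)%E => //.
Qed.

Lemma integrable_weight s : - (1 / 2) < s -> mu.-integrable Bc (EFin \o weight s).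
Proof.
move=> s0; apply/integrableP; split; first exact: measurable_weight.
under eq_integral do rewrite /= ger0_norm ?weight_ge0//.
by rewrite weight_itv; exact: weight_integral_lty.
Qed.

Lemma weight_integralD1 s : - (1 / 2) < s ->
  weight_integral (s + 1) = weight_integral s * ((s + 1 / 2) / (s + 1)).
Proof.
move=> s0; rewrite /weight_integral /Rintegral !weight_itv.
have fin t : - (1 / 2) < t -> (\int[mu]_(x in B) (weight t x)%:E)%E \is a fin_num.
  move=> t0; rewrite ge0_fin_numE ?weight_integral_lty//.
  by apply: integral_ge0 => x _; rewrite lee_fin weight_ge0.
have := congr1 fine (weight_integral_recE s0).
have s10 : - (1 / 2) < s + 1 by lra.
rewrite fineM ?fin// fineM ?fin//.
set X := fine (\int[mu]_(x in B) (weight (s + 1) x)%:E)%E.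
set Y := fine (\int[mu]_(x in B) (weight s x)%:E)%E.
move: X Y => X Y /= E; clear - s0 E; have s1 : s + 1 != 0 by apply: lt0r_neq0; lra.
apply: (mulfI s1); transitivity ((2 * s + 2) * X / 2); first by field.
by rewrite E; field.
Qed.

Lemma weight_integral_le s t : - (1 / 2) < s -> s <= t ->
  weight_integral t <= weight_integral s.
Proof.
move=> s0 st; have t0 : - (1 / 2) < t by lra.
have E0 r : (0 <= \int[mu]_(x in B) (weight r x)%:E)%E.
  by apply: integral_ge0 => x _; rewrite lee_fin weight_ge0.
rewrite /weight_integral /Rintegral !weight_itv fine_le//.
- by rewrite ge0_fin_numE ?weight_integral_lty.
- by rewrite ge0_fin_numE ?weight_integral_lty.
apply: ge0_le_integral => //; try exact: measurable_weight.
- by move=> x _; rewrite lee_fin weight_ge0.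
- move=> x Bx; rewrite lee_fin; apply: ger_powR; last by rewrite lerB.
  by rewrite sqr_lt1_itv//= gerBl sqr_ge0.
Qed.

Lemma weight_integral_half : weight_integral (1 / 2) = 2.
Proof.
rewrite /weight_integral (@eq_Rintegral _ _ _ _ _ (cst 1)); last first.
  by move=> x _; rewrite weight_half.
rewrite Rintegral_cst//= lebesgue_measure_itv /= ifT; last by rewrite lte_fin; lra.
by rewrite mul1r /=; ring.
Qed.

(** [weight 0] is the derivative of [asin].  The intervals that exhaust ]-1, 1[ are
    bounded by values of [sin], where [asin] is known without a limit. *)
Lemma weight_integral0 : weight_integral 0 = pi.
Proof.
rewrite /weight_integral /Rintegral weight_itv.
pose y n : R := pi / 2 - n.+2%:R^-1.
have pi1 := @pihalf_ge1 R; have d0 n : 0 < n.+2%:R^-1 :> R by rewrite invr_gt0.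
have d1 n : n.+2%:R^-1 < 1 :> R by rewrite invf_lt1// ltr1n.
have ypi n : y n \in `[- (pi / 2), pi / 2].
  by rewrite in_itv /= /y; move: (n.+2%:R^-1) (d0 n) (d1 n) => d h1 h2; apply/andP; split; lra.
have yN n : - y n \in `[- (pi / 2), pi / 2].
  by have := ypi n; rewrite !in_itv /= => /andP[h1 h2]; rewrite lerN2 h2 lerNl h1.
have hp : pi / 2 \in `[- (pi / 2), pi / 2 :> R] by rewrite in_itv /= lexx andbT; lra.
have h0 : (0 : R) \in `[- (pi / 2), pi / 2 :> R] by rewrite in_itv /=; apply/andP; split; lra.
have yp n : y n < pi / 2 by rewrite /y ltrBlDr ltrDl.
have siny n : sin (y n) < 1 by rewrite -(@sin_pihalf R) ltr_sin.
have sin0y n : 0 < sin (y n).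
  by rewrite -(@sin0 R) ltr_sin// /y subr_gt0 (lt_le_trans (d1 n)).
have ler_sin : {in `[- (pi / 2), pi / 2] &, {mono (@sin R) : u v / u <= v}}.
  by apply: le_mono_in => u v hu hv; rewrite ltr_sin.
have ylt n : y n <= y n.+1 by rewrite /y lerD2l lerN2 lef_pV2 ?posrE// ler_nat.
have BE : B = \bigcup_n `[- sin (y n), sin (y n)]%classic.
  apply/seteqP; split=> x /=.
    rewrite in_itv /= => xB; have x1 : `|x| < 1 by rewrite ltr_norml.
    have nx : -1 <= `|x| < 1 by rewrite x1 andbT (le_trans _ (normr_ge0 x))// lerN10.
    have ax := asin_ltpi2 nx.
    have [n hn] := ltr_add_invr ax.
    exists n => //=; rewrite in_itv /= -ler_norml.
    have nx' : `|x| \in `[-1, 1] by rewrite in_itv /=; case/andP: nx => -> /ltW.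
    rewrite -(asinK nx') ler_sin//; last first.
      rewrite in_itv /= asin_geNpi2 ?asin_lepi2//; by move: nx'; rewrite in_itv.
    rewrite /y lerBrDr; apply: le_trans (ltW hn).
    by rewrite lerD2l lef_pV2 ?posrE// ler_nat.
  case=> n _ /=; rewrite !in_itv /= => /andP[h1 h2].
  by have := siny n => h; apply/andP; split; lra.
have Bx1 x : B x -> -1 < x < 1 by rewrite /= in_itv.
have dF x : B x -> is_derive x (1 : R) (@asin R) (weight 0 x - 0).
  move=> Bx; apply: (is_derive_eq (is_derive1_asin (Bx1 _ Bx))).
  have x0 := sqr_lt1_itv Bx.
  by rewrite subr0 /weight sub0r powRN -[1 / 2]/(1 * 2^-1) mul1r powR12_sqrt// ltW.
rewrite (@FTC_ge0_exhaustion R (weight 0) (fun=> 0) (@asin R)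
   (fun n => - sin (y n)) (fun n => sin (y n)) B pi _ _ _ BE _ _ _ _ dF).
- by rewrite integral0 add0e.
- by move=> n; have := sin0y n; lra.
- by move=> n; rewrite lerN2 ler_sin.
- by move=> n; rewrite ler_sin.
- by move=> x _; exact: weight_ge0.
- by [].
- by move=> x; exact: continuous_weight.
- by move=> x _; exact: cst_continuous.
rewrite (_ : (fun n => _) = (fun n => pi - 2 * n.+2%:R^-1)); last first.
  apply/funext => n; rewrite -sinN !sinK// /y; move: (n.+2%:R^-1) => d; by field.
rewrite -[X in _ --> X]subr0; apply: cvgB; first exact: cvg_cst.
rewrite -[X in _ --> X](mulr0 2); apply: cvgMl_tmp.
by have := @cvg_harmonic R; rewrite -cvg_shiftS.
Qed.

(** This will turn out to be the constant [Num.sqrt pi]. *)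
Definition weight_ratio s : R := weight_integral s * Gamma (s + 1) / Gamma (s + 1 / 2).

Lemma weight_ratioD1 s : - (1 / 2) < s -> weight_ratio (s + 1) = weight_ratio s.
Proof.
move=> s0; rewrite /weight_ratio weight_integralD1; last exact: s0.
have s1 : 0 < s + 1 by lra.
have sh : 0 < s + 1 / 2 by lra.
rewrite (GammaD1 s1) [s + 1 + 1 / 2]addrAC (GammaD1 sh).
have := Gamma_gt0 sh; have := sh; have := s1.
move: (weight_integral s) (Gamma (s + 1)) (Gamma (s + 1 / 2)) (s + 1) (s + 1 / 2).
by move=> a b c d e d0 e0 c0; clear - d0 e0 c0; field; rewrite !gt_eqF.
Qed.

Lemma weight_ratioDn s n : - (1 / 2) < s -> weight_ratio (s + n%:R) = weight_ratio s.
Proof.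
move=> s0; elim: n => [|n IH]; first by rewrite addr0.
rewrite -natr1 addrA weight_ratioD1; first exact: IH.
by rewrite ltr_wpDr.
Qed.

Lemma weight_integral_cvg s : - (1 / 2) < s ->
  weight_integral (s + n%:R) * n%:R `^ (1 / 2) @[n --> \oo] --> weight_ratio s.
Proof.
move=> s0; have s1 : 0 < s + 1 by lra.
have sh : 0 < s + 1 / 2 by lra.
pose q n := gamma_ratio (s + 1 / 2) n * (gamma_ratio (s + 1) n)^-1.
have : weight_ratio s * q n @[n --> \oo] --> weight_ratio s.
  rewrite [X in _ --> X](_ : _ = weight_ratio s * (1 * 1^-1)); last by rewrite invr1 !mulr1.
  apply: cvgMl_tmp; apply: cvgM; first exact: rate1_cvg (gamma_ratio_rate (ltW sh)).
  apply: cvgV; first by rewrite oner_eq0.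
  exact: rate1_cvg (gamma_ratio_rate (ltW s1)).
apply: cvg_trans; apply: near_eq_cvg; near=> n.
have n0 : 0 < n%:R :> R by rewrite ltr0n; near: n; exact: nbhs_infty_gt.
rewrite -(weight_ratioDn n s0) /weight_ratio /q /gamma_ratio.
rewrite [s + n%:R + 1]addrAC [s + n%:R + 1 / 2]addrAC.
have -> : n%:R `^ (s + 1) = n%:R `^ (s + 1 / 2) * n%:R `^ (1 / 2).
  by rewrite -powRD; [congr (_ `^ _); field|rewrite (gt_eqF n0) implybT].
have g1 : 0 < Gamma (s + 1 + n%:R) by apply: Gamma_gt0; exact: addr_gt0.
have g2 : 0 < Gamma (s + 1 / 2 + n%:R) by apply: Gamma_gt0; exact: addr_gt0.
have g3 := Gamma_gt0 n0.
have p1 := powR_gt0 (s + 1 / 2) n0; have p2 := powR_gt0 (1 / 2) n0.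
move: g1 g2 g3 p1 p2.
move: (weight_integral (s + n%:R)) (Gamma (s + 1 + n%:R)) (Gamma (s + 1 / 2 + n%:R)) (Gamma n%:R).
move: (n%:R `^ (s + 1 / 2)) (n%:R `^ (1 / 2)).
move=> a b c d e f d0 e0 f0 a0 b0; clear - a0 b0 d0 e0 f0.
by field; rewrite !gt_eqF.
Unshelve. all: by end_near. Qed.

(** The ratio has period 1.  At [s + n] it is asymptotic to
    [weight_integral (s + n) * n^(1/2)], which is monotone in [s], hence squeezed
    between its values at two consecutive integers, whose limits agree. *)
Lemma weight_ratio_eq s : - (1 / 2) < s -> weight_ratio s = weight_ratio 0.
Proof.
move=> s0; rewrite -(weight_ratioD1 s0).
have s1 : 0 <= s + 1 by lra.
have /andP[h1 h2] := truncn_itv s1; set m := Num.truncn _ in h1 h2.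
have m0 : - (1 / 2) < m%:R :> R by apply: lt_le_trans (ler0n _ _); lra.
have m10 : - (1 / 2) < m%:R + 1 :> R by lra.
have s10 : - (1 / 2) < s + 1 by lra.
rewrite -(weight_ratioDn m (_ : - (1 / 2) < 0)) ?add0r; last by lra.
have c1 := weight_integral_cvg m0; have c2 := weight_integral_cvg m10.
rewrite weight_ratioD1 in c2; last exact: m0.
suff c : weight_integral (s + 1 + n%:R) * n%:R `^ (1 / 2) @[n --> \oo] --> weight_ratio m%:R.
  exact: cvg_unique (weight_integral_cvg s10) c.
apply: (squeeze_cvgr _ c2 c1); apply: nearW => n /=.
apply/andP; split; apply: ler_wpM2r; try exact: powR_ge0; apply: weight_integral_le.
- by rewrite ltr_wpDr.
- by rewrite lerD2r natr1 ltW.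
- by rewrite ltr_wpDr.
- by rewrite lerD2r.
Qed.

(** The constant [weight_ratio] is [Gamma (1/2)] at [1/2] and [pi / Gamma (1/2)] at
    [0]. *)
Lemma Gamma_half : Gamma (1 / 2 : R) = Num.sqrt pi.
Proof.
have h : - (1 / 2) < 1 / 2 :> R by lra.
have h2 : 0 < 1 / 2 :> R by lra.
have := weight_ratio_eq h; rewrite /weight_ratio weight_integral_half weight_integral0.
rewrite !add0r Gamma1 (GammaD1 h2) (_ : 1 / 2 + 1 / 2 = 1); last by field.
rewrite Gamma1 invr1 !mulr1; have G0 := Gamma_gt0 h2.
move: G0; move: (Gamma _) => G G0 E.
have -> : pi = G ^+ 2.
  rewrite -[pi](divfK (lt0r_neq0 G0)) -E; by field.
by rewrite sqrtr_sqr gtr0_norm.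
Qed.

Lemma weight_integralE s : - (1 / 2) < s ->
  weight_integral s = Num.sqrt pi * Gamma (s + 1 / 2) / Gamma (s + 1).
Proof.
move=> s0; have := weight_ratio_eq s0; rewrite {2}/weight_ratio weight_integral0.
rewrite !add0r Gamma1 Gamma_half mulr1.
have -> : pi / Num.sqrt pi = Num.sqrt pi :> R.
  by rewrite -{1}(sqr_sqrtr (ltW (@pi_gt0 R))) expr2 mulfK// sqrtr_eq0 -ltNge pi_gt0.
rewrite /weight_ratio => <-.
have G1 : 0 < Gamma (s + 1) by apply: Gamma_gt0; lra.
have G2 : 0 < Gamma (s + 1 / 2) by apply: Gamma_gt0; lra.
move: G1 G2; move: (Gamma _) (Gamma _) (weight_integral _) => a b c a0 b0; clear - a0 b0.
by field; rewrite !gt_eqF.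
Qed.

End WeightIntegral.

(** * The integral as a convolution *)

Lemma Rintegral_sum (d : measure_display) (T : measurableType d) (R : realType)
  (m : {measure set T -> \bar R}) (D : set T) (f : nat -> T -> R) n :
  measurable D -> (forall k, m.-integrable D (EFin \o f k)) ->
  m.-integrable D (EFin \o (fun x => \sum_(k < n) f k x)) /\
  \int[m]_(x in D) (\sum_(k < n) f k x) = \sum_(k < n) \int[m]_(x in D) f k x.
Proof.
move=> mD fi; elim: n => [|n [IH1 IH2]].
  split.
    rewrite (_ : _ \o _ = cst 0%E); first exact: integrable0.
    by apply/funext => x /=; rewrite big_ord0.
  rewrite big_ord0 /Rintegral (@eq_integral _ _ _ _ _ (cst 0%E)) ?integral0// => x _.
  by rewrite big_ord0.
have e : (fun x => \sum_(k < n.+1) f k x) = (fun x => \sum_(k < n) f k x + f n x).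
  by apply/funext => x; rewrite big_ord_recr.
rewrite e big_ord_recr /= RintegralD//.
split; last by rewrite IH2.
by have := integrableD mD IH1 (fi n).
Qed.

Section JFormula.
Variables (R : realType) (l mu : R).

Lemma weight_integralDn n : - (1 / 2) < mu ->
  weight_integral (mu + n%:R) =
  weight_integral mu * (poch (mu + 1 / 2) n / poch (mu + 1) n).
Proof.
move=> mu0; elim: n => [|n IH]; first by rewrite addr0 !poch0 divr1 mulr1.
rewrite -natr1 addrA weight_integralD1; last by rewrite ltr_wpDr.
rewrite IH !pochS [mu + n%:R + 1 / 2]addrAC [mu + n%:R + 1]addrAC.
have h1 : poch (mu + 1) n != 0 by rewrite gt_eqF// poch_gt0//; lra.
have h2 : mu + 1 + n%:R != 0 by have : 0 <= n%:R :> R by []; lra.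
move: h1 h2; move: (poch _ _) (poch _ _) (weight_integral _) (mu + 1 + _) (mu + 1 / 2 + _).
by move=> A B C D E h1 h2; field; rewrite h1 h2.
Qed.

(** Each power of [1 - x^2] in Clausen's formula shifts the parameter of the weight
    by one. *)
Lemma weighted_sq_integralE C n : 0 < l -> - (1 / 2) < mu -> gegenbauer_family l C ->
  weighted_sq_integral C mu n =
  weight_integral mu * (poch (2 * l) n * poch (l + 1 / 2) n / (n`!%:R * poch (mu + 1) n)) *
  conv (hyper l (l - mu) (l + 1 / 2)) (hyper l (1 - (l - mu)) (l + 1 / 2)) n.
Proof.
move=> l0 mu0 hC; rewrite -mulrA -clausen_conv// mulr_sumr.
pose c k := (poch (2 * l) n / n`!%:R) ^+ 2 * clausen_coef l n%:R k.
have iw k : (@lebesgue_measure R).-integrable (`[-1, 1]%classic : set R)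
    (EFin \o weight (mu + k%:R)).
  by apply: integrable_weight; rewrite ltr_wpDr.
have icw k : (@lebesgue_measure R).-integrable (`[-1, 1]%classic : set R)
    (EFin \o (fun x => c k * weight (mu + k%:R) x)).
  by have := integrableZl _ (c k) (iw k); apply; exact: measurable_itv.
transitivity (\int[lebesgue_measure]_(x in `[-1, 1]%classic)
   (\sum_(k < n.+1) c k * weight (mu + k%:R) x)).
  apply: eq_Rintegral => x; rewrite inE /= in_itv /= => /andP[x1 x2].
  rewrite (gegenbauer_family_unique l0 hC) gegenbauer_sq// mulr_suml.
  apply: eq_bigr => k _; rewrite -/(c k) -mulrA; congr (_ * _).
  (* At the end points the power of 0 adds up correctly: if [k > 0] the total
     exponent is positive. *)
  have u0 : 0 <= 1 - x ^+ 2 by clear - x1 x2; nra.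
  rewrite /weight -(powR_mulrn k u0).
  have [->|k0] := eqVneq (k : nat) 0%N; first by rewrite !mulr0n powRr0 [LHS]mul1r !addr0.
  rewrite -powRD; first by congr (_ `^ _); ring.
  rewrite gt_eqF//; have : 1 <= k%:R :> R by rewrite ler1n lt0n.
  by move: (k%:R) => z; lra.
rewrite (Rintegral_sum n.+1 _ icw).2; last exact: measurable_itv.
apply: eq_bigr => k _.
rewrite RintegralZl; [|exact: measurable_itv|exact: iw].
rewrite -/(weight_integral _) weight_integralDn//.
by rewrite /c mulrCA -!mulrA; congr (_ * _); rewrite mulrCA.
Qed.

End JFormula.

(** * Convolution of power bounds *)

Section ConvBound.
Variable R : realType.
Implicit Types (p q r t x : R) (u v : nat -> R).

Lemma powR_mulD x p q : 0 < x -> x `^ p * x `^ q = x `^ (p + q).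
Proof. by move=> x0; rewrite -powRD// (gt_eqF x0) implybT. Qed.

Lemma powR_le_of_itv12 t p : 1 <= t -> t <= 2 -> t `^ p <= 1 + 2 `^ p.
Proof.
move=> t1 t2; have [p0|p0] := leP 0 p.
  apply: (@le_trans _ _ (2 `^ p)); last by rewrite lerDr.
  by apply: ge0_ler_powR; rewrite ?nnegrE// (le_trans ler01).
apply: (@le_trans _ _ (t `^ 0)); first exact: ler_powR (ltW p0).
by rewrite powRr0 lerDl powR_ge0.
Qed.

Lemma powR_comparable x y p : 0 < x -> x <= y -> y <= 2 * x ->
  x `^ p <= (1 + 2 `^ (- p)) * y `^ p.
Proof.
move=> x0 xy yx; have y0 : 0 < y by apply: lt_le_trans xy.
have t1 : 1 <= y / x by rewrite ler_pdivlMr// mul1r.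
have t2 : y / x <= 2 by rewrite ler_pdivrMr.
have h := powR_le_of_itv12 (- p) t1 t2.
rewrite -ler_pdivrMr ?powR_gt0//; apply: le_trans h.
have yx0 : 0 < y / x by rewrite divr_gt0.
have e : y `^ p = (y / x) `^ p * x `^ p.
  by rewrite -powRM ?ltW// divfK// gt_eqF.
have px := powR_gt0 p x0; have pyx := powR_gt0 p yx0.
by rewrite e powRN invfM mulrCA divff ?gt_eqF// mulr1.
Qed.

(** The bound telescopes: [(p - 1) (i + 1)^(- p)] is at most the decrement of
    [i^(- (p - 1))]. *)
Lemma sum_powR_le p N : 1 < p -> \sum_(i < N) i.+1%:R `^ (- p) <= 1 + (p - 1)^-1.
Proof.
move=> p1; set e := p - 1; have e0 : 0 < e by rewrite subr_gt0.
suff H n : \sum_(i < n.+1) i.+1%:R `^ (- p) <= 1 + e^-1 * (1 - n.+1%:R `^ (- e)).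
  case: N => [|n]; first by rewrite big_ord0 addr_ge0// invr_ge0 ltW.
  apply: le_trans (H n) _; rewrite lerD2l -[leRHS]mulr1.
  apply: ler_wpM2l; first by rewrite invr_ge0 ltW.
  by rewrite gerBl powR_ge0.
elim: n => [|n IH]; first by rewrite big_ord1 !powR1 subrr mulr0 addr0.
rewrite big_ord_recr /=; apply: le_trans (lerD IH (lexx _)) _.
have x0 : 0 < n.+1%:R :> R by [].
have y0 : 0 < n.+2%:R :> R by [].
have key : e * n.+2%:R `^ (- p) <= n.+1%:R `^ (- e) - n.+2%:R `^ (- e).
  have -> : n.+2%:R `^ (- p) = n.+2%:R `^ (- e) * n.+2%:R^-1.
    rewrite -[n.+2%:R^-1]powR_inv1 ?ler0n// powR_mulD//; congr (_ `^ _).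
    by rewrite /e; ring.
  have -> : n.+1%:R `^ (- e) = n.+2%:R `^ (- e) * (n.+1%:R / n.+2%:R) `^ (- e).
    by rewrite -powRM ?divr_ge0//; congr (_ `^ _); rewrite mulrCA divff ?mulr1// gt_eqF.
  rewrite mulrCA -[X in _ <= _ - X]mulr1 -mulrBr.
  apply: ler_wpM2l; first exact: powR_ge0.
  rewrite lerBrDl /powR gt_eqF ?divr_gt0// mulNr -mulrN.
  apply: le_trans (expR_ge1Dx _); rewrite lerD2l.
  apply: ler_wpM2l; first exact: ltW.
  have := ln_sub_ge x0 y0; rewrite -ln_div ?posrE//.
  rewrite -lnV ?posrE ?divr_gt0// invf_div.
  by rewrite -[n.+2%:R in X in X / _]natr1 [n.+1%:R + 1]addrC addrK mul1r.
have {key} : n.+2%:R `^ (- p) <= e^-1 * (n.+1%:R `^ (- e) - n.+2%:R `^ (- e)).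
  by rewrite mulrC ler_pdivlMr// mulrC.
move: (n.+2%:R `^ (- p)) (n.+1%:R `^ (- e)) (n.+2%:R `^ (- e)) (e^-1) => X Y Z W h.
by clear - h; lra.
Qed.

(** One of [i], [j] is at least [n / 2], and its power is then comparable to that of
    [n]; if it is [i], some powers of [j] still have to be traded for powers of
    [n], which is possible because [j <= n]. *)
Lemma powR_conv_term p q (i j n : nat) : 1 < p -> (i + j = n)%N ->
  i.+1%:R `^ (- p) * j.+1%:R `^ (- q) <=
  (2 + 2 `^ p + 2 `^ q) * n.+1%:R `^ (- Num.min p q) *
    (i.+1%:R `^ (- p) + j.+1%:R `^ (- p)) :> R.
Proof.
move=> p1 ijn; set r := Num.min p q.
have I0 : 0 < i.+1%:R :> R by []. have J0 : 0 < j.+1%:R :> R by [].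
have N1 : 1 <= n.+1%:R :> R by rewrite ler1n.
have rq : n.+1%:R `^ (- q) <= n.+1%:R `^ (- r) :> R.
  by apply: ler_powR => //; rewrite lerN2 ge_min lexx orbT.
have C0 : 0 <= 2 + 2 `^ p + 2 `^ q :> R by rewrite !addr_ge0// powR_ge0.
have p2 := powR_ge0 (2 : R) p; have q2 := powR_ge0 (2 : R) q.
have pI := powR_ge0 (i.+1%:R : R) (- p); have pJ := powR_ge0 (j.+1%:R : R) (- p).
have pr := powR_ge0 (n.+1%:R : R) (- r).
(* An index not below the other one is at least half of [n]. *)
have half (k m : nat) s : (k + m = n)%N -> (m <= k)%N ->
    k.+1%:R `^ (- s) <= (1 + 2 `^ s) * n.+1%:R `^ (- s) :> R.
  move=> kmn mk; have := @powR_comparable k.+1%:R n.+1%:R (- s).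
  rewrite opprK; apply => //; first by rewrite ler_nat ltnS -kmn leq_addr.
  by rewrite -natrM ler_nat -kmn mul2n -addnn addSn addnS ltnS leqW// leq_add2l.
have [ij|ji] := leqP i j.
  have h := half j i q (etrans (addnC _ _) ijn) ij.
  apply: (@le_trans _ _ (i.+1%:R `^ (- p) * ((1 + 2 `^ q) * n.+1%:R `^ (- r)))).
    apply: ler_wpM2l => //; apply: le_trans h _.
    by apply: ler_wpM2l; [exact: addr_ge0 ler01 q2|exact: rq].
  move: p2 q2 pI pJ pr; move: (2 `^ p) (2 `^ q) (i.+1%:R `^ (- p)) (j.+1%:R `^ (- p)) (n.+1%:R `^ (- r)).
  move=> A B X Y Z A0 B0 X0 Y0 Z0; clear - A0 B0 X0 Y0 Z0.
  rewrite mulrC -[leRHS]mulrA -mulrA; apply: ler_pM; rewrite ?mulr_ge0 ?addr_ge0//; first lra.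
  by apply: ler_wpM2l => //; rewrite lerDl.
have h := half i j p ijn (ltnW ji).
have h2 : n.+1%:R `^ (- p) * j.+1%:R `^ (- q) <= n.+1%:R `^ (- r) * j.+1%:R `^ (- p) :> R.
  have jn : j.+1%:R <= n.+1%:R :> R by rewrite ler_nat ltnS -ijn leq_addl.
  have N0 : 0 < n.+1%:R :> R by [].
  have [qp|pq] := leP q p.
    have -> : r = q by rewrite /r min_r.
    have -> : j.+1%:R `^ (- q) = j.+1%:R `^ (- p) * j.+1%:R `^ (p - q) :> R.
      by rewrite powR_mulD//; congr (_ `^ _); ring.
    have -> : n.+1%:R `^ (- q) = n.+1%:R `^ (- p) * n.+1%:R `^ (p - q) :> R.
      by rewrite powR_mulD//; congr (_ `^ _); ring.
    rewrite -mulrA; apply: ler_wpM2l; first exact: powR_ge0.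
    rewrite mulrC; apply: ler_wpM2r => //.
    by apply: ge0_ler_powR; rewrite ?nnegrE// subr_ge0.
  have -> : r = p by rewrite /r min_l// ltW.
  apply: ler_wpM2l; first exact: powR_ge0.
  by apply: ler_powR; rewrite ?ler1n// lerN2 ltW.
apply: (@le_trans _ _ ((1 + 2 `^ p) * (n.+1%:R `^ (- p) * j.+1%:R `^ (- q)))).
  by rewrite mulrA; apply: ler_wpM2r => //; exact: powR_ge0.
apply: le_trans (ler_wpM2l (addr_ge0 ler01 p2) h2) _.
move: p2 q2 pI pJ pr; move: (2 `^ p) (2 `^ q) (i.+1%:R `^ (- p)) (j.+1%:R `^ (- p)) (n.+1%:R `^ (- r)).
move=> A B X Y Z A0 B0 X0 Y0 Z0; clear - A0 B0 X0 Y0 Z0.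
rewrite -[leRHS]mulrA; apply: ler_pM; rewrite ?mulr_ge0 ?addr_ge0//; first lra.
by apply: ler_wpM2l => //; rewrite lerDr.
Qed.

(** Once [powR_conv_term] has taken the power of [n] out of every term, only powers
    of exponent [- p < -1] remain to be summed. *)
Lemma conv_bound u v p q K M : 1 < p -> 0 <= K -> 0 <= M ->
  (forall k, `|u k| <= K * k.+1%:R `^ (- p)) ->
  (forall k, `|v k| <= M * k.+1%:R `^ (- q)) ->
  exists2 L, 0 <= L & forall n, `|conv u v n| <= L * n.+1%:R `^ (- Num.min p q).
Proof.
move=> p1 K0 M0 uK vM; set r := Num.min p q.
set C := 2 + 2 `^ p + 2 `^ q : R.
have C0 : 0 <= C by rewrite !addr_ge0// powR_ge0.
set Z := 1 + (p - 1)^-1.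
have Z0 : 0 <= Z by rewrite addr_ge0// invr_ge0 subr_ge0 ltW.
exists (K * M * C * (Z + Z)) => [|n].
  by rewrite !mulr_ge0// addr_ge0.
rewrite /conv; apply: le_trans (ler_norm_sum _ _ _) _.
apply: (@le_trans _ _ (\sum_(i < n.+1) K * M * (C * n.+1%:R `^ (- r)) *
    (i.+1%:R `^ (- p) + (n - i).+1%:R `^ (- p)))).
  apply: ler_sum => i _; have i_n : (i + (n - i) = n)%N by rewrite subnKC// -ltnS.
  have := powR_conv_term q p1 i_n; rewrite -/r -/C => h.
  rewrite normrM; apply: le_trans (ler_pM _ _ (uK i) (vM (n - i)%N)) _ => //.
  rewrite mulrACA -[leRHS]mulrA; apply: ler_wpM2l => //; exact: mulr_ge0.
rewrite -mulr_sumr big_split /=.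
have -> : \sum_(i < n.+1) (n - i).+1%:R `^ (- p) = \sum_(i < n.+1) i.+1%:R `^ (- p) :> R.
  rewrite (reindex_inj rev_ord_inj) /=; apply: eq_bigr => i _.
  by rewrite subSS subKn// -ltnS.
have -> : K * M * C * (Z + Z) * n.+1%:R `^ (- r) = K * M * (C * n.+1%:R `^ (- r)) * (Z + Z).
  by move: (n.+1%:R `^ _) => X; ring.
apply: ler_wpM2l; first by rewrite !mulr_ge0 ?powR_ge0.
by apply: lerD; exact: sum_powR_le.
Qed.

End ConvBound.

(** * The two power regimes *)

(** [f n = L * n^p * (1 + O(1/n))] when [L] is not zero; this normalised form makes
    products immediate. *)
Definition powR_asymp (R : realType) (f : nat -> R) (p L : R) : Prop :=
  rate1 (fun n => f n * n%:R `^ (- p)) L.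

Section PowerAsymptotics.
Variable R : realType.
Implicit Types (p q x y L c : R) (f g u v w : nat -> R).

Lemma near_gt0_nat : \forall n \near \oo, 0 < n%:R :> R.
Proof. by near=> n; rewrite ltr0n; near: n; exact: nbhs_infty_gt. Unshelve. all: by end_near. Qed.

Lemma Oh_powR p q : p <= q -> Oh (fun n => n%:R `^ p : R) (fun n => n%:R `^ q).
Proof.
move=> pq; apply: Oh_le; near=> n; rewrite ger0_norm ?powR_ge0//.
apply: ler_powR => //; rewrite ler1n; near: n; exact: nbhs_infty_gt.
Unshelve. all: by end_near. Qed.

Lemma Oh_powRM u v p q : Oh u (fun n => n%:R `^ p) -> Oh v (fun n => n%:R `^ q) ->
  Oh (fun n => u n * v n) (fun n => n%:R `^ (p + q)).
Proof.
move=> h k; apply: Oh_near (OhM h k); first exact: nearW.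
apply: filterS near_gt0_nat => n n0; exact: powR_mulD.
Qed.

Lemma Oh_powR_succ p : Oh (fun n => n%:R `^ p : R) (fun n => n.+1%:R `^ p).
Proof.
exists (1 + 2 `^ (- p)); first by rewrite addr_ge0// powR_ge0.
near=> n; have n0 : 0 < n%:R :> R by near: n; exact: near_gt0_nat.
rewrite !ger0_norm ?powR_ge0//; apply: powR_comparable => //.
  by rewrite ler_nat.
rewrite -natr1 mulr_natl mulr2n lerD2l ler1n -(ltr0n R); exact: n0.
Unshelve. all: by end_near. Qed.

Lemma Oh_succ_powR p : Oh (fun n => n.+1%:R `^ p : R) (fun n => n%:R `^ p).
Proof.
exists (1 + 2 `^ p); first by rewrite addr_ge0// powR_ge0.
near=> n; have n0 : 0 < n%:R :> R by near: n; exact: near_gt0_nat.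
rewrite !ger0_norm ?powR_ge0// -[n.+1%:R](@mulfVK _ n%:R) ?gt_eqF//.
rewrite powRM ?divr_ge0//; apply: ler_wpM2r; first exact: powR_ge0.
apply: powR_le_of_itv12.
  by rewrite ler_pdivlMr// mul1r ler_nat.
rewrite ler_pdivrMr// -natr1 mulr_natl mulr2n lerD2l ler1n -(ltr0n R); exact: n0.
Unshelve. all: by end_near. Qed.

Lemma powR_asymp_Oh f p L : powR_asymp f p L -> Oh f (fun n => n%:R `^ p).
Proof.
move=> /Oh_bounded_rate1 h.
have := OhM h (Oh_refl (fun n => n%:R `^ p : R)); apply: Oh_near.
  apply: filterS near_gt0_nat => n n0.
  by rewrite -mulrA powR_mulD// addNr powRr0 mulr1.
by apply: nearW => n; rewrite mul1r.
Qed.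

Lemma powR_asymp_sub f p L : powR_asymp f p L ->
  Oh (fun n => f n - L * n%:R `^ p) (fun n => n%:R `^ (p - 1)).
Proof.
move=> h; have := OhM h (Oh_refl (fun n => n%:R `^ p : R)); apply: Oh_near.
  apply: filterS near_gt0_nat => n n0.
  by rewrite mulrBl -mulrA powR_mulD// addNr powRr0 mulr1.
apply: filterS near_gt0_nat => n n0.
by rewrite -[n%:R^-1]powR_inv1 ?powR_mulD ?ler0n// addrC.
Qed.

Lemma powR_asympM f g p q L L' : powR_asymp f p L -> powR_asymp g q L' ->
  powR_asymp (fun n => f n * g n) (p + q) (L * L').
Proof.
move=> h k; apply: rate1_eq (rate1M h k).
apply: filterS near_gt0_nat => n n0.
by rewrite opprD -powR_mulD// mulrACA.
Qed.

Lemma powR_asymp_eq f g p q L L' : f =1 g -> p = q -> L = L' ->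
  powR_asymp f p L -> powR_asymp g q L'.
Proof. by move=> /funext -> -> ->. Qed.

Lemma powR_asymp_poch x y : 0 < x -> 0 < y ->
  powR_asymp (fun n => poch x n / poch y n) (x - y) (Gamma y / Gamma x).
Proof. by move=> x0 y0; rewrite /powR_asymp opprB; exact: poch_ratio_rate. Qed.

Lemma powR_asymp_hyper x y c : 0 < x -> 0 < y -> 0 < c ->
  powR_asymp (hyper x y c) (x + y - c - 1) (Gamma c / (Gamma x * Gamma y)).
Proof.
move=> x0 y0 c0.
have := powR_asympM (powR_asymp_poch x0 c0) (powR_asymp_poch y0 ltr01).
apply: powR_asymp_eq; last 2 first.
- by ring.
- by rewrite Gamma1 mul1r invfM mulrA.
by move=> n; rewrite /hyper poch1 mulf_div.
Qed.

(** For [x <= 0] there is no Gamma quotient, and at negative integers the symbol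
    vanishes for large [n]; dividing by [x + n] lowers [x] by one. *)
Lemma Oh_poch_fact x : Oh (fun n => poch x n / n`!%:R) (fun n => n%:R `^ (x - 1)).
Proof.
have pos y : 0 < y -> Oh (fun n => poch y n / n`!%:R) (fun n => n%:R `^ (y - 1)).
  move=> y0; have := powR_asymp_Oh (powR_asymp_poch y0 ltr01); apply: Oh_near; last exact: nearW.
  by apply: nearW => n; rewrite poch1.
have down y : Oh (fun n => poch (y + 1) n / n`!%:R) (fun n => n%:R `^ y) ->
    Oh (fun n => poch y n / n`!%:R) (fun n => n%:R `^ (y - 1)).
  move=> h; have hy : Oh (fun n => (y + n%:R)^-1) (fun n => n%:R `^ (- 1)).
    exists 2 => //; near=> n.
    have n0 : 0 < n%:R :> R by near: n; exact: near_gt0_nat.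
    have ny : 2 * `|y| <= n%:R by near: n; exact: nbhs_infty_ger.
    rewrite powR_inv1; last exact: ltW.
    rewrite !normfV ler_pdivlMr; last by rewrite normr_gt0 gt_eqF.
    have yn : n%:R / 2 <= `|y + n%:R|.
      have := lerB_normD n%:R y; rewrite [n%:R + y]addrC [`|n%:R|]gtr0_norm//.
      by move: (`|y + _|) (`|y|) ny => A B ny h'; clear - ny h'; lra.
    rewrite (gtr0_norm n0) mulrC ler_pdivrMr; last by apply: lt_le_trans yn; rewrite divr_gt0.
    by move: yn; rewrite ler_pdivrMr// mulrC.
  have := OhZ y (Oh_powRM h hy); apply: Oh_near; last exact: nearW.
  near=> n.
  have ny : 1 + `|y| <= n%:R by near: n; exact: nbhs_infty_ger.
  have yn : y + n%:R != 0.
    apply: lt0r_neq0; have := ler_norm (- y); rewrite normrN.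
    by move: (`|y|) ny => A; lra.
  have := pochS y n; rewrite pochSl => E.
  have -> : poch y n = y * poch (y + 1) n / (y + n%:R) by rewrite E mulfK.
  by move: (n`!%:R^-1) (poch _ _) ((y + n%:R)^-1) => A B C; ring.
(* Induction on the number of unit steps needed to make [x] positive. *)
have [N xN] : exists N : nat, 0 < x + N%:R.
  exists (Num.truncn (- x)).+1; rewrite -ltrBlDl sub0r; exact: truncnS_gt.
elim: N x xN => [|N IH] x xN; first by apply: pos; rewrite addr0 in xN.
apply: down; have := IH (x + 1); rewrite addrK; apply.
by rewrite -addrA [1 + _]addrC natr1.
Unshelve. all: by end_near. Qed.

Lemma Oh_hyper x y c : 0 < x -> 0 < c ->
  Oh (hyper x y c) (fun n => n%:R `^ (x + y - c - 1)).
Proof.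
move=> x0 c0; have := Oh_powRM (powR_asymp_Oh (powR_asymp_poch x0 c0)) (Oh_poch_fact y).
apply: Oh_near; apply: nearW => n.
  by rewrite /hyper mulf_div.
by congr (_ `^ _); ring.
Qed.

Lemma Oh_conv u v p q : 1 < p ->
  Oh u (fun n => n%:R `^ (- p)) -> Oh v (fun n => n%:R `^ (- q)) ->
  Oh (conv u v) (fun n => n%:R `^ (- Num.min p q)).
Proof.
move=> p1 h k.
have pos s n : 0 < n.+1%:R `^ s :> R by rewrite powR_gt0.
have [K K0 uK] := Oh_all (pos (- p)) (Oh_trans h (Oh_powR_succ _)).
have [M M0 vM] := Oh_all (pos (- q)) (Oh_trans k (Oh_powR_succ _)).
have [L L0 cL] := conv_bound p1 K0 M0 uK vM.
apply: Oh_trans (Oh_succ_powR _); exists L => //; apply: nearW => n.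
by rewrite [X in _ <= _ * X]ger0_norm ?powR_ge0.
Qed.

Lemma conv_lin u v w c n : conv u (fun k => c * v k + w k) n = c * conv u v n + conv u w n.
Proof.
by rewrite /conv mulr_sumr -big_split; apply: eq_bigr => i _; rewrite mulrDr mulrCA.
Qed.

End PowerAsymptotics.

Section MainTerms.
Variable R : realType.
Implicit Types (a l mu : R).

(** The second factor is replaced by a multiple of the coefficients of
    [(1 - z)^(a - 1/2)], for which [saalschutz] evaluates the convolution. *)
Lemma hyper_conv_asym a l : 0 < l -> a < 1 / 2 ->
  Oh (fun n => conv (hyper l a (l + 1 / 2)) (hyper l (1 - a) (l + 1 / 2)) n
      - Gamma (l + 1 / 2) * Gamma (1 / 2 - a) / (Gamma l * Gamma (1 - a)) *
        hyper (1 / 2) (l + 1 / 2 - a) (l + 1 / 2) n)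
    (fun n => n%:R `^ (- Num.min (3 / 2 - a) (3 / 2 + a))).
Proof.
move=> l0 a2; have lh0 : 0 < l + 1 / 2 by lra.
have b0 : 0 < 1 / 2 - a by lra.
have a10 : 0 < 1 - a by lra.
set c := Gamma (l + 1 / 2) * _ / _.
pose u := hyper l a (l + 1 / 2).
pose v := hyper l (1 - a) (l + 1 / 2).
pose b k : R := poch (1 / 2 - a) k / k`!%:R.
pose w k := v k - c * b k.
have saal n : conv u b n = hyper (1 / 2) (l + 1 / 2 - a) (l + 1 / 2) n.
  have nz i : (i < n)%N -> l + 1 / 2 + i%:R != 0.
    by move=> _; rewrite gt_eqF// ltr_wpDr.
  have := saalschutz l a nz.
  rewrite (_ : l + 1 / 2 - l = 1 / 2); last by ring.
  exact.
have Ou : Oh u (fun n => n%:R `^ (- (3 / 2 - a))).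
  have := Oh_hyper a l0 lh0; apply: Oh_near; first exact: nearW.
  by apply: nearW => n; congr (_ `^ _); field.
have Ow : Oh w (fun n => n%:R `^ (- (3 / 2 + a))).
  have h1 := powR_asympM (powR_asymp_poch l0 lh0) (powR_asymp_poch a10 b0).
  have h2 := powR_asymp_sub h1; have := Oh_powRM (Oh_poch_fact (1 / 2 - a)) h2.
  apply: Oh_near; last by apply: nearW => n; congr (_ `^ _); field.
  apply: nearW => n; rewrite /w /v /b /c /hyper.
  have f0 := fact_neq0 R n.
  have p1 : poch (l + 1 / 2) n != 0 by rewrite gt_eqF// poch_gt0.
  have p2 : poch (1 / 2 - a) n != 0 by rewrite gt_eqF// poch_gt0.
  rewrite (_ : l - (l + 1 / 2) + (1 - a - (1 / 2 - a)) = 0); last by field.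
  rewrite powRr0 mulr1.
  have := gt_eqF (Gamma_gt0 l0); have := gt_eqF (Gamma_gt0 a10).
  move: p1 p2 f0; move: (Gamma l) (Gamma (1 - a)) (Gamma (l + 1 / 2)) (Gamma (1 / 2 - a)).
  move: (poch l n) (poch (l + 1 / 2) n) (poch (1 / 2 - a) n) (poch (1 - a) n) (n`!%:R).
  move=> A B D E F G H I J B0 D0 F0 H0 G0; clear - B0 D0 F0 H0 G0.
  by field; rewrite B0 D0 F0 H0 G0.
have p1 : 1 < 3 / 2 - a by lra.
apply: Oh_eq (Oh_conv p1 Ou Ow); apply: nearW => n.
have -> : conv (hyper l a (l + 1 / 2)) (hyper l (1 - a) (l + 1 / 2)) n =
   conv u (fun k => c * b k + w k) n.
  by apply: eq_conv => // i _; rewrite /w addrCA subrr addr0.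
by rewrite conv_lin saal addrAC subrr add0r.
Qed.

Lemma Gamma_duplication l : 0 < l ->
  Gamma (l + 1 / 2) / Gamma (2 * l) = Num.sqrt pi / (2 `^ (2 * l - 1) * Gamma l).
Proof.
move=> l0; have h0 : 0 < 1 / 2 :> R by lra.
have l20 : 0 < 2 * l by lra.
have G1 := Gamma_gt0 l0; have G2 := Gamma_gt0 l20.
have := duplication_ratio_eq l0 h0; rewrite /duplication_ratio.
rewrite (_ : 2 * (1 / 2) = 1); last by field.
rewrite (_ : 1 / 2 + 1 / 2 = 1); last by field.
rewrite Gamma1 Gamma_half powRr1// divr1 mulr1.
have -> : 2 `^ (2 * l) = 2 * 2 `^ (2 * l - 1) :> R.
  by rewrite mulr_powRB1// mulr_gt0.
have p0 : 0 < 2 `^ (2 * l - 1) :> R by rewrite powR_gt0.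
move: G1 G2 p0; move: (Gamma (2 * l)) (Gamma l) (Gamma (l + 1 / 2)) (2 `^ (2 * l - 1)) (Num.sqrt pi).
move=> A B C D E B0 A0 D0 H; clear - A0 B0 D0 H.
have -> : E = D * B * C / A by apply: (@mulfI _ 2); rewrite // -H; field; rewrite gt_eqF.
by field; rewrite !gt_eqF.
Qed.

Lemma powR_asymp_prefactor l mu : 0 < l -> - (1 / 2) < mu ->
  powR_asymp (fun n => weight_integral mu *
      (poch (2 * l) n * poch (l + 1 / 2) n / (n`!%:R * poch (mu + 1) n)))
    (3 * l - mu - 3 / 2)
    (Num.sqrt pi * Gamma (mu + 1 / 2) / (Gamma (2 * l) * Gamma (l + 1 / 2))).
Proof.
move=> l0 mu0; have l20 : 0 < 2 * l by lra.
have lh0 : 0 < l + 1 / 2 by lra.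
have mu10 : 0 < mu + 1 by lra.
have muh0 : 0 < mu + 1 / 2 by lra.
have h := powR_asympM (powR_asymp_poch l20 ltr01) (powR_asymp_poch lh0 mu10).
have hW : powR_asymp (fun=> weight_integral mu) 0 (weight_integral mu).
  apply: rate1_eq (rate1_cst (weight_integral mu)); apply: nearW => n.
  by rewrite oppr0 powRr0 mulr1.
apply: powR_asymp_eq (powR_asympM hW h).
- by move=> n; rewrite poch1 mulf_div.
- by field.
rewrite weight_integralE// Gamma1.
have := gt_eqF (Gamma_gt0 l20); have := gt_eqF (Gamma_gt0 lh0); have := gt_eqF (Gamma_gt0 mu10).
move: (Gamma (2 * l)) (Gamma (l + 1 / 2)) (Gamma (mu + 1)) (Gamma (mu + 1 / 2)) (Num.sqrt pi).
move=> A B C D E C0 B0 A0; clear - A0 B0 C0.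
by field; rewrite A0 B0 C0.
Qed.

(** The two values of [a] are the parameters of the two factors of the convolution;
    the one below [1/2] is to be chosen, which settles both power regimes at
    once. *)
Lemma weighted_sq_integral_asym l mu a C eta : 0 < l -> - (1 / 2) < mu ->
  gegenbauer_family l C -> a < 1 / 2 -> 0 < l + 1 / 2 - a ->
  a = l - mu \/ a = 1 - (l - mu) ->
  3 * l - mu - 3 - a <= eta -> 3 * l - mu - 3 + a <= eta ->
  Oh (fun n => weighted_sq_integral C mu n -
      Num.sqrt pi * Gamma (mu + 1 / 2) * Gamma (1 / 2 - a) /
      (2 `^ (2 * l - 1) * Gamma l ^+ 2 * Gamma (l + 1 / 2 - a) * Gamma (1 - a)) *
      n%:R `^ (3 * l - mu - 2 - a))
    (fun n => n%:R `^ eta).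
Proof.
move=> l0 mu0 hC a2 k0 am e1 e2.
have l20 : 0 < 2 * l by lra.
have lh0 : 0 < l + 1 / 2 by lra.
have h0 : 0 < 1 / 2 :> R by lra.
have b0 : 0 < 1 / 2 - a by lra.
have a10 : 0 < 1 - a by lra.
pose P n := weight_integral mu *
      (poch (2 * l) n * poch (l + 1 / 2) n / (n`!%:R * poch (mu + 1) n)).
have eP : powR_asymp P _ _ := powR_asymp_prefactor l0 mu0.
pose Q n := conv (hyper l a (l + 1 / 2)) (hyper l (1 - a) (l + 1 / 2)) n.
have JE n : weighted_sq_integral C mu n = P n * Q n.
  rewrite (weighted_sq_integralE n l0 mu0 hC) /P /Q; congr (_ * _).
  case: am => ->; first by [].
  by rewrite convC (_ : 1 - (1 - (l - mu)) = l - mu)//; ring.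
have := hyper_conv_asym l0 a2; rewrite -/Q.
set c := (X in Oh (fun n => _ - X * _) _); set h := hyper (1 / 2) _ _ => OQ.
have eh := powR_asymp_hyper h0 k0 lh0; rewrite -/h in eh.
have main := OhZ c (powR_asymp_sub (powR_asympM eP eh)).
have err := Oh_powRM (powR_asymp_Oh eP) OQ.
have i1 : 3 * l - mu - 3 / 2 + (1 / 2 + (l + 1 / 2 - a) - (l + 1 / 2) - 1) - 1 <= eta.
  by apply: le_trans e1; rewrite le_eqVlt; apply/orP; left; apply/eqP; field.
have i2 : 3 * l - mu - 3 / 2 + - Num.min (3 / 2 - a) (3 / 2 + a) <= eta.
  by have [_|_] := leP (3 / 2 - a) (3 / 2 + a); lra.
have := OhD (Oh_trans main (Oh_powR i1)) (Oh_trans err (Oh_powR i2)).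
apply: Oh_near; last exact: nearW.
apply: nearW => n; rewrite JE.
  rewrite (_ : 3 * l - mu - 3 / 2 + (1 / 2 + (l + 1 / 2 - a) - (l + 1 / 2) - 1) =
    3 * l - mu - 2 - a); last by field.
  set Lf := (X in _ = _ - X * _).
  set Lp := (X in c * (_ - X * _) + _).
  have -> : Lf = c * Lp.
    have := Gamma_duplication l0; rewrite /Lf /Lp Gamma_half /c.
    have G1 := Gamma_gt0 l0; have G2 := Gamma_gt0 l20; have G3 := Gamma_gt0 lh0.
    have G4 := Gamma_gt0 k0; have G5 := Gamma_gt0 a10.
    have p0 : 0 < 2 `^ (2 * l - 1) :> R by rewrite powR_gt0.
    have s0 : 0 < Num.sqrt pi :> R by rewrite sqrtr_gt0 pi_gt0.
    move: G1 G2 G3 G4 G5 p0 s0.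
    move: (Gamma l) (Gamma (2 * l)) (Gamma (l + 1 / 2)) (Gamma (l + 1 / 2 - a)) (Gamma (1 - a)).
    move: (2 `^ (2 * l - 1)) (Num.sqrt pi) (Gamma (mu + 1 / 2)) (Gamma (1 / 2 - a)).
    move=> p s A B D E F G H D0 E0 F0 G0 H0 p0 s0 dup; clear - D0 E0 F0 G0 H0 p0 s0 dup.
    have -> : F = s / (p * D) * E by rewrite -dup divfK// gt_eqF.
    by field; rewrite !gt_eqF.
  rewrite -/(Q n); move: (n%:R `^ _) (P n) (Q n) (h n) (c) (Lp) => X Y Z W V T; clear; ring.
Qed.

End MainTerms.

(** * The logarithmic regime and the theorem *)

Section LogCase.
Variable R : realType.
Implicit Types (x l q L : R).

Local Notation H := harmonic_sum.

Lemma Oh_inv_log : Oh (fun n => n%:R^-1 : R) (fun n => n%:R^-1 * ln n%:R).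
Proof.
have l2 : 0 < ln 2 :> R by rewrite ln_gt0// ltr1n.
exists (ln 2)^-1; first by rewrite invr_ge0 ltW.
near=> n; have n2 : (2 <= n)%N by near: n; exact: nbhs_infty_ge.
have n0 : 0 < n%:R :> R by rewrite ltr0n (leq_trans _ n2).
rewrite normrM mulrCA ler_peMr// -ler_pdivrMl ?invr_gt0// invrK mulr1.
apply: le_trans (ler_norm _); rewrite ler_ln ?posrE// ler_nat//.
Unshelve. all: by end_near. Qed.

Lemma Oh_ln1 : Oh (fun=> 1 : R) (fun n => ln n%:R : R).
Proof.
have := OhM Oh_inv_log (Oh_refl (fun n => n%:R : R)); apply: Oh_near.
  by apply: filterS (@near_gt0_nat R) => n n0; rewrite mulVf// gt_eqF.
by apply: filterS (@near_gt0_nat R) => n n0; rewrite mulrAC mulVf ?mul1r// gt_eqF.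
Qed.

Lemma rate1_double (q : nat -> R) L : rate1 q L -> rate1 (fun n => q (2 * n)%N) L.
Proof.
move=> [K K0 [N _ h]]; exists K => //; near=> n.
have n0 : 0 < n%:R :> R by near: n; exact: near_gt0_nat.
have Nn : (N <= 2 * n)%N.
  by rewrite (@leq_trans n)// ?leq_pmull//; near: n; exact: nbhs_infty_ge.
apply: le_trans (h _ Nn) _; apply: ler_wpM2l => //.
rewrite natrM !ger0_norm ?invr_ge0 ?mulr_ge0//.
by rewrite lef_pV2 ?posrE ?mulr_gt0// ler_peMl ?ler1n// ltW.
Unshelve. all: by end_near. Qed.

(** Reciprocals of odd numbers, as all reciprocals less those of the even ones. *)
Lemma harmonic_sum_half n : H (1 / 2 : R) n = 2 * H 1 (2 * n) - H 1 n.
Proof.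
elim: n => [|n IH]; first by rewrite muln0 /H !big_ord0; ring.
rewrite mulnS /= !addSn add0n /H !big_ord_recr /= -!/(H _ _) IH natrM.
have n0 : 0 <= n%:R :> R by [].
rewrite -[(2 * n).+1%:R]natr1 natrM; move: (H 1 (2 * n)) (H 1 n) => X Y.
by field; lra.
Qed.

Lemma harmonic_sum_half_rate :
  rate1 (fun n => H (1 / 2) n - ln n%:R) (2 * ln 2 - digamma 1 : R).
Proof.
have h := harmonic_sum_digamma (ltr01 : 0 < 1 :> R).
have h2 := rate1_double h.
have := rate1D (rate1M (rate1_cst 2) h2) (rate1D (rate1M (rate1_cst (-1)) h) (rate1_cst (2 * ln 2))).
rewrite (_ : 2 * - digamma 1 + (-1 * - digamma 1 + 2 * ln 2) = 2 * ln 2 - digamma 1); last by ring.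
apply: rate1_eq; apply: filterS (@near_gt0_nat R) => n n0.
rewrite harmonic_sum_half natrM lnM ?posrE//.
by move: (H 1 _) (H 1 _) (ln _) (ln _) => *; ring.
Qed.

(** Since [0^-1 = 0], the two extreme terms of the convolution vanish; partial
    fractions do the rest. *)
Lemma conv_inv_inv m :
  conv (fun k => k%:R^-1 : R) (fun k => k%:R^-1) m.+1 = 2 / m.+1%:R * H 1 m.
Proof.
rewrite /conv big_ord_recl /= invr0 mul0r add0r big_ord_recr /= subnn invr0 mulr0 addr0.
transitivity (\sum_(i < m) (m.+1%:R^-1 * (i.+1%:R^-1 + (m - i)%:R^-1) : R)).
  apply: eq_bigr => i _; rewrite /bump /= add1n subSS.
  have im := ltn_ord i.
  have h1 : (m - i)%:R != 0 :> R by rewrite pnatr_eq0 -lt0n subn_gt0.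
  have e : m.+1%:R = i.+1%:R + (m - i)%:R :> R by rewrite -natrD addSn subnKC// ltnW.
  have h2 : i.+1%:R != 0 :> R by rewrite pnatr_eq0.
  have h3 : i.+1%:R + (m - i)%:R != 0 :> R by rewrite -e pnatr_eq0.
  rewrite e; move: h1 h2 h3; move: (i.+1%:R) (m - i)%:R => A B B0 A0 AB.
  by field; rewrite A0 B0 AB.
rewrite -mulr_sumr big_split /=.
have e1 : \sum_(i < m) i.+1%:R^-1 = H 1 m :> R.
  by apply: eq_bigr => i _; rewrite -natr1 addrC.
have e2 : \sum_(i < m) (m - i)%:R^-1 = H 1 m :> R.
  rewrite (reindex_inj rev_ord_inj) /= -e1; apply: eq_bigr => i _.
  by rewrite subKn.
by rewrite e1 e2; ring.
Qed.

(** With [b_k = 1/k] and [w = u - B b], bilinearity gives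
    [u * u = 2 B (u * b) - B^2 (b * b) + w * w]; the first two convolutions are
    exact and the last is [O(n^-2)]. *)
Lemma log_conv_asym l : 0 < l ->
  let B := Gamma (l + 1 / 2) / (Gamma l * Gamma (1 / 2)) in
  Oh (fun n => n%:R * conv (hyper l (1 / 2) (l + 1 / 2)) (hyper l (1 / 2) (l + 1 / 2)) n
       - 2 * B ^+ 2 * (ln n%:R + 2 * ln 2 - digamma l))
     (fun n => n%:R^-1 * ln n%:R).
Proof.
move=> l0 B; have lh0 : 0 < l + 1 / 2 by lra.
have h0 : 0 < 1 / 2 :> R by lra.
pose u := hyper l (1 / 2) (l + 1 / 2); pose b k : R := k%:R^-1.
pose w k := u k - B * b k.
have bE k : b k = k%:R `^ (- 1) by rewrite powR_inv1.
have eu : powR_asymp u (- 1) B.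
  by apply: powR_asymp_eq (powR_asymp_hyper l0 h0 lh0); [|rewrite subrr sub0r|].
have Ow : Oh w (fun n => n%:R `^ (- 2)).
  have := powR_asymp_sub eu; apply: Oh_near; apply: nearW => n; first by rewrite -bE.
  by congr (_ `^ _); ring.
have Oww : Oh (fun n => n%:R * conv w w n) (fun n => n%:R^-1).
  have n21 : 1 < 2 :> R by rewrite ltr1n.
  have h := Oh_conv n21 Ow Ow; rewrite minxx in h.
  have Oid : Oh (fun n => n%:R : R) (fun n => n%:R `^ 1).
    by apply: Oh_near (Oh_refl (fun n => n%:R : R)); apply: nearW => n //; rewrite powRr1.
  apply: Oh_near (Oh_powRM Oid h); apply: nearW => n //.
  by rewrite (_ : 1 + - 2 = - 1); [rewrite -bE|ring].
have uE n : conv u u n = 2 * B * conv u b n - B ^+ 2 * conv b b n + conv w w n.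
  have uw k : (k <= n)%N -> u k = B * b k + w k.
    by move=> _; rewrite /w addrCA subrr addr0.
  have e1 : conv u u n = B * conv u b n + conv w u n.
    by rewrite [conv w u n]convC -conv_lin; exact: eq_conv.
  have e2 : conv w u n = B * conv w b n + conv w w n.
    by rewrite -conv_lin; exact: eq_conv.
  have e3 : conv u b n = B * conv b b n + conv w b n.
    by rewrite [conv w b n]convC -conv_lin [LHS]convC; exact: eq_conv.
  have e4 : conv w b n = conv u b n - B * conv b b n by rewrite e3 addrAC subrr add0r.
  by rewrite e1 e2 e4; move: (conv u b n) (conv b b n) (conv w w n) (B) => *; ring.
have ubE n : conv u b n = u n * (H l n + H (1 / 2) n).
  have nz x : 0 < x -> forall i : nat, x + i%:R != 0.
    by move=> x0 i; rewrite gt_eqF// ltr_wpDr.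
  have := saalschutz_log n (nz _ l0) (nz _ h0) (nz _ lh0).
  rewrite big_split => <-; rewrite /conv big_ord_recr /= subnn.
  by rewrite /b invr0 mulr0 addr0.
have Hl := harmonic_sum_digamma l0.
have Hh := harmonic_sum_half_rate.
have H1 := harmonic_sum_digamma (ltr01 : 0 < 1 :> R).
have nu : rate1 (fun n => u n * n%:R) B.
  apply: rate1_eq eu; apply: filterS (@near_gt0_nat R) => n n0.
  by rewrite opprK powRr1// ltW.
have OHH : Oh (fun n => H l n + H (1 / 2) n) (fun n => ln n%:R : R).
  have k := Oh_trans (Oh_bounded_rate1 (rate1D Hl Hh)) Oh_ln1.
  have := OhD k (OhZ 2 (Oh_refl (fun n => ln n%:R : R))).
  by apply: Oh_eq; apply: nearW => n; ring.
have t1 := OhZ (2 * B) (OhM nu OHH).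
have t2 := Oh_trans (OhZ (2 * B ^+ 2) (rate1D (rate1D Hl Hh) (rate1M (rate1_cst (-1)) H1))) Oh_inv_log.
have t3 := OhZ (2 * B ^+ 2) Oh_inv_log.
have t4 := Oh_trans Oww Oh_inv_log.
have := OhD (OhD t1 t2) (OhD t3 t4).
apply: Oh_eq; apply: filterS (@near_gt0_nat R) => -[|m]; first by rewrite ltxx.
move=> m0; rewrite -/u uE ubE conv_inv_inv.
have -> : H 1 m = H 1 m.+1 - m.+1%:R^-1 :> R.
  by rewrite /H big_ord_recr /= [1 + m%:R]addrC natr1 addrK.
have := lt0r_neq0 m0; move: (m.+1%:R) => N N0.
move: (u m.+1) (H l m.+1) (H (1 / 2) m.+1) (H 1 m.+1) (conv w w m.+1).
move: (ln N) (ln 2) (digamma l) (digamma 1) (B).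
by move=> A C D E F G I J X Y; clear - N0; field; rewrite N0.
Qed.

Lemma weighted_sq_integral_log l mu C : 0 < l -> mu = l - 1 / 2 ->
  gegenbauer_family l C ->
  Oh (fun n => weighted_sq_integral C mu n -
      1 / (2 `^ (2 * l - 2) * Gamma l ^+ 2) * n%:R `^ (2 * l - 2) *
      (ln n%:R + 2 * ln 2 - digamma l))
    (fun n => n%:R `^ (2 * l - 3) * ln n%:R).
Proof.
move=> l0 mul hC; have mu0 : - (1 / 2) < mu by lra.
have l20 : 0 < 2 * l by lra.
have lh0 : 0 < l + 1 / 2 by lra.
pose P n := weight_integral mu *
      (poch (2 * l) n * poch (l + 1 / 2) n / (n`!%:R * poch (mu + 1) n)).
pose u := hyper l (1 / 2) (l + 1 / 2).
have JE n : weighted_sq_integral C mu n = P n * conv u u n.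
  rewrite (weighted_sq_integralE n l0 mu0 hC) /P /u; congr (_ * _).
  have -> : l - mu = 1 / 2 by rewrite mul; ring.
  by rewrite (_ : 1 - 1 / 2 = 1 / 2)//; field.
have eP : powR_asymp P _ _ := powR_asymp_prefactor l0 mu0.
rewrite (_ : 3 * l - mu - 3 / 2 = 2 * l - 1) in eP; last by rewrite mul; field.
rewrite (_ : mu + 1 / 2 = l) in eP; last by rewrite mul; ring.
have := log_conv_asym l0; rewrite -/u /=.
set B := _ / (_ * _); set Lp := (X in powR_asymp _ _ X) in eP; move=> OT.
pose M n : R := 2 * B ^+ 2 * (ln n%:R + 2 * ln 2 - digamma l).
have Oln : Oh (fun=> 1 : R) (fun n => ln n%:R : R) by exact: Oh_ln1.
have OM : Oh M (fun n => ln n%:R).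
  have := OhZ (2 * B ^+ 2) (OhD (Oh_refl (fun n => ln n%:R : R)) (OhZ (2 * ln 2 - digamma l) Oln)).
  by apply: Oh_eq; apply: nearW => n; rewrite /M; ring.
have h1 : Oh (fun n => P n * n%:R `^ (- (2 * l - 1)) * (n%:R * conv u u n - M n))
    (fun n => n%:R^-1 * ln n%:R).
  have := OhM (Oh_bounded_rate1 eP) OT; apply: Oh_near; first exact: nearW.
  by apply: nearW => n; rewrite mul1r.
have h2 := OhM eP OM.
have := OhM (Oh_refl (fun n => n%:R `^ (2 * l - 2) : R)) (OhD h1 h2).
apply: Oh_near; apply: filterS (@near_gt0_nat R) => n n0; last first.
  rewrite mulrA -powR_inv1 ?ler0n// powR_mulD//.
  by congr (_ `^ _ * _); ring.
rewrite JE -/(M n).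
have pe : n%:R `^ (- (2 * l - 1)) = n%:R^-1 * (n%:R `^ (2 * l - 2))^-1.
  rewrite -powRN -(powR_inv1 (ltW n0)) powR_mulD//; congr (_ `^ _); ring.
have x0 : n%:R `^ (2 * l - 2) != 0 by rewrite gt_eqF// powR_gt0.
have cE : 1 / (2 `^ (2 * l - 2) * Gamma l ^+ 2) = Lp * (2 * B ^+ 2).
  have := Gamma_duplication l0; rewrite /Lp /B Gamma_half.
  have -> : 2 `^ (2 * l - 1) = 2 * 2 `^ (2 * l - 2) :> R.
    transitivity (2 `^ 1 * 2 `^ (2 * l - 2) : R); last by rewrite powRr1.
    by rewrite powR_mulD//; congr (_ `^ _); ring.
  have G1 := Gamma_gt0 l0; have G2 := Gamma_gt0 l20; have G3 := Gamma_gt0 lh0.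
  have p0 : 0 < 2 `^ (2 * l - 2) :> R by rewrite powR_gt0.
  have s0 : 0 < Num.sqrt pi :> R by rewrite sqrtr_gt0 pi_gt0.
  move: G1 G2 G3 p0 s0.
  move: (Gamma l) (Gamma (2 * l)) (Gamma (l + 1 / 2)) (2 `^ (2 * l - 2)) (Num.sqrt pi).
  move=> X Y Z p s X0 Y0 Z0 p0 s0 dup; clear - X0 Y0 Z0 p0 s0 dup.
  have -> : Z = s / (2 * p * X) * Y by rewrite -dup divfK// gt_eqF.
  by field; rewrite !gt_eqF.
rewrite cE (_ : Lp * (2 * B ^+ 2) * n%:R `^ (2 * l - 2) * (ln n%:R + 2 * ln 2 - digamma l)
  = Lp * n%:R `^ (2 * l - 2) * M n); last by rewrite /M; ring.
rewrite pe; have := lt0r_neq0 n0; move: x0.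
move: (n%:R) (P n) (conv u u n) (M n) (_ `^ _) (Lp) => N p c m X L X0 N0; clear - X0 N0.
by field; rewrite X0 N0.
Qed.

End LogCase.

Lemma Oh_eqaddO (R : realType) (f g h : nat -> R) :
  Oh (fun n => f n - g n) h -> f = g +O_\oo h.
Proof.
move=> [K K0 fg]; apply/eqaddOP; near=> k; apply: filterS fg => n /le_trans; apply.
apply: ler_wpM2r => //; near: k; exact: nbhs_pinfty_ge.
Unshelve. all: by end_near. Qed.

Theorem theorem6 (R : realType) (lambda mu : R) (C : nat -> {poly R})
    (hmu : - (1 / 2) < mu) (hlambda : 0 < lambda)
    (hC : gegenbauer_family lambda C) :
  let J := weighted_sq_integral C mu in
  [/\ lambda - 1 / 2 < mu ->
        J = (fun n : nat =>
               Num.sqrt pi * Gamma (mu + 1 / 2 - lambda) /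
               (2 `^ (2 * lambda - 1) * Gamma lambda ^+ 2 *
                Gamma (mu + 1 - lambda)) *
               n%:R `^ (2 * lambda - 2))
            +O_\oo (fun n : nat =>
               n%:R `^ Num.max (2 * lambda - 3)
                               (4 * lambda - 2 * mu - 3)),
      mu = lambda - 1 / 2 ->
        J = (fun n : nat =>
               1 / (2 `^ (2 * lambda - 2) * Gamma lambda ^+ 2) *
               n%:R `^ (2 * lambda - 2) *
               (ln n%:R + 2 * ln 2 - digamma lambda))
            +O_\oo (fun n : nat =>
               n%:R `^ (2 * lambda - 3) * ln n%:R)
    & mu < lambda - 1 / 2 ->
        J = (fun n : nat =>
               Num.sqrt pi * Gamma (lambda - mu - 1 / 2) *
               Gamma (mu + 1 / 2) /
               (2 `^ (2 * lambda - 1) * Gamma lambda ^+ 2 *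
                Gamma (lambda - mu) *
                Gamma (2 * lambda - mu - 1 / 2)) *
               n%:R `^ (4 * lambda - 2 * mu - 3))
            +O_\oo (fun n : nat =>
               n%:R `^ Num.max (2 * lambda - 2)
                               (4 * lambda - 2 * mu - 4))].
Proof.
move=> J; split => hm.
- have a2 : lambda - mu < 1 / 2 by lra.
  have k0 : 0 < lambda + 1 / 2 - (lambda - mu) by lra.
  apply: Oh_eqaddO; set eta := Num.max _ _.
  have e1 : 3 * lambda - mu - 3 - (lambda - mu) <= eta.
    by rewrite /eta le_max; apply/orP; left; lra.
  have e2 : 3 * lambda - mu - 3 + (lambda - mu) <= eta.
    by rewrite /eta le_max; apply/orP; right; lra.
  have := weighted_sq_integral_asym hlambda hmu hC a2 k0 (or_introl erefl) e1 e2.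
  rewrite (_ : 3 * lambda - mu - 2 - (lambda - mu) = 2 * lambda - 2); last by ring.
  rewrite (_ : lambda + 1 / 2 - (lambda - mu) = mu + 1 / 2); last by ring.
  rewrite (_ : 1 / 2 - (lambda - mu) = mu + 1 / 2 - lambda); last by ring.
  rewrite (_ : 1 - (lambda - mu) = mu + 1 - lambda); last by ring.
  apply: Oh_eq; apply: nearW => n; congr (_ - _ * _).
  have muh : 0 < mu + 1 / 2 by lra.
  have ml : 0 < mu + 1 - lambda by lra.
  have p0 : 0 < 2 `^ (2 * lambda - 1) :> R by rewrite powR_gt0.
  have G1 := Gamma_gt0 muh; have G2 := Gamma_gt0 ml; have G3 := Gamma_gt0 hlambda.
  move: p0 G1 G2 G3; move: (2 `^ _) (Gamma (mu + 1 / 2)) (Gamma (mu + 1 - lambda)) (Gamma lambda).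
  move: (Num.sqrt pi) (Gamma _) => s g p X Y Z p0 X0 Y0 Z0; clear - p0 X0 Y0 Z0.
  by field; rewrite !gt_eqF.
- exact/Oh_eqaddO/weighted_sq_integral_log.
- have a2 : 1 - (lambda - mu) < 1 / 2 by lra.
  have k0 : 0 < lambda + 1 / 2 - (1 - (lambda - mu)) by lra.
  apply: Oh_eqaddO; set eta := Num.max _ _.
  have e1 : 3 * lambda - mu - 3 - (1 - (lambda - mu)) <= eta.
    by rewrite /eta le_max; apply/orP; right; lra.
  have e2 : 3 * lambda - mu - 3 + (1 - (lambda - mu)) <= eta.
    by rewrite /eta le_max; apply/orP; left; lra.
  have := weighted_sq_integral_asym hlambda hmu hC a2 k0 (or_intror erefl) e1 e2.
  rewrite (_ : 3 * lambda - mu - 2 - (1 - (lambda - mu)) = 4 * lambda - 2 * mu - 3); last by ring.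
  rewrite (_ : lambda + 1 / 2 - (1 - (lambda - mu)) = 2 * lambda - mu - 1 / 2); last by field.
  rewrite (_ : 1 / 2 - (1 - (lambda - mu)) = lambda - mu - 1 / 2); last by field.
  rewrite (_ : 1 - (1 - (lambda - mu)) = lambda - mu); last by ring.
  apply: Oh_eq; apply: nearW => n; move: (2 `^ _ * _) (Num.sqrt pi).
  move: (Gamma (mu + 1 / 2)) (Gamma (lambda - mu - 1 / 2)) (Gamma (2 * lambda - mu - 1 / 2)) (Gamma (lambda - mu)).
  by move=> A B D E p s; rewrite (mulrAC s) (mulrAC p).
Qed.
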